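(* Let $\ell\geq 2$, $\ell_1=\lfloor\ell/2\rfloor$, $\ell_2=\lceil\ell/2\rceil$. Let $A_1,A_2\in\mathfrak g(\mathfrak o_{\ell_1})$ be regular matrices such that $A_1+A_2$ is regular and $\mathrm{tt}(A_1)=\mathrm{tt}(A_2)=\mathbf{cus}$. For $i\in\{1,2\}$ let $\phi_i$ be an irreducible representation of $S_{A_i}$ whose restriction to $K^{\ell_2}$ contains $\psi_{A_i}$. Then the representation $\mathrm{Res}^{S_{A_1}}_{S_{A_1}\cap S_{A_2}}(\phi_1)\otimes \mathrm{Res}^{S_{A_2}}_{S_{A_1}\cap S_{A_2}}(\phi_2)$ of $S_{A_1}\cap S_{A_2}$ is multiplicity free.
   Context: Let $\mathcal O$ be a complete discrete valuation ring with maximal ideal $\mathfrak p=\pi\mathcal O$ and finite residue field of odd characteristic and cardinality $q$. Let $\mathfrak O=\mathcal O[\vartheta]$ be the unramified quadratic extension, with $\vartheta^2\in\mathcal O^\times$ a non-square, and Galois involution $x\mapsto x^\circ$, $\vartheta^\circ=-\vartheta$. Let $\mathfrak o_k=\mathcal O/\mathfrak p^k$ and $\mathfrak O_k=\mathfrak O/\pi^k\mathfrak O$. $\mathrm G$ denotes either $\mathrm{GL}_2$ (so $\mathrm G(\mathfrak o_k)=\mathrm{GL}_2(\mathfrak o_k)$, $R_k=\mathfrak o_k$, $\epsilon=1$, $\mathfrak g(\mathfrak o_k)=M_2(\mathfrak o_k)$) or $\mathrm{GU}_2$ (so $\mathrm G(\mathfrak o_k)=\{A\in \mathrm{GL}_2(\mathfrak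 O_k): A^\star A=I\}$ where $(a_{ij})^\star=W(a_{ji}^\circ)W^{-1}$, $W=\begin{pmatrix}0&1\\1&0\end{pmatrix}$, $R_k=\mathfrak O_k$, $\epsilon=\vartheta$, $\mathfrak g(\mathfrak o_k)=\{A\in M_2(\mathfrak O_k):A+A^\star=0\}$). Fix an additive character $\psi$ of $R_\ell$ nontrivial on $\pi^{\ell-1}\mathfrak o_\ell$ (for $\mathrm{GU}_2$ with $\psi(x+\vartheta y)=\psi'(x)\psi'(y)$ for such a character $\psi'$ of $\mathfrak o_\ell$). $K^{i}=\{I+\pi^iB\}\cap\mathrm G(\mathfrak o_\ell)$ is the kernel of reduction $\mathrm G(\mathfrak o_\ell)\to\mathrm G(\mathfrak o_i)$. For $A\in\mathfrak g(\mathfrak o_{\ell_1})$, $\psi_A$ is the character of $K^{\ell_2}$ given by $\psi_A(I+\pi^{\ell_2}B)=\psi(\pi^{\ell_2}\mathrm{tr}(\tilde AB))$ for any lift $\tilde A\in\mathfrak g(\mathfrak o_\ell)$ of $A$, and $S_A=\{g\in\mathrm G(\mathfrak o_\ell):\psi_A(g^{-1}xg)=\psi_A(x)\ \forall x\in K^{\ell_2}\}$ is its stabilizer. A matrix in $\mathfrak g(\mathfrak o_{k})$ is regular if its reduction modulo $\pi$ is not scalar. $\mathrm{tt}(A)=\mathbf{cus}$ means $A$ is $\mathrm G(\mathfrak o_{\ell_1})$-conjugate to a matrix in $\mathfrak g(\mathfrak o_{\ell_1})$ of the form $\begin{pmatrix}x&\epsilon\sigma\\ \epsilon&x\end{pmatrix}$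 with $\sigma\in\mathfrak o_{\ell_1}^\times$ a non-square (for $\mathrm{GL}_2$) respectively a square (for $\mathrm{GU}_2$). *)

(* Defs.v *)
From HB Require Import structures.
From mathcomp Require Import all_boot all_order all_algebra all_fingroup.
From mathcomp Require Import algC classfun character.
Set Implicit Arguments. Unset Strict Implicit. Unset Printing Implicit Defensive.
Import Order.TTheory GRing.Theory Num.Theory.
Local Open Scope ring_scope.

Definition residue_finite_odd (O : idomainType) (pi : O) : Prop :=
  (exists s : seq O, forall x : O,
     exists2 y, y \in s & exists c : O, x - y = pi * c) /\
  (* its characteristic is odd, i.e. 2 is not in the maximal ideal *)
  (2%:R : O) \is a GRing.unit.

Definition is_complete_dvr_odd (O : idomainType) (pi : O) : Prop :=
  [/\ pi != 0, pi \notin GRing.unit,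
      (* every nonzero element is a unit times a power of pi: O is a DVR with
         maximal ideal pi O *)
      (forall x : O, x != 0 ->
         exists (n : nat) (u : O), u \is a GRing.unit /\ x = u * pi ^+ n),
      (forall a : nat -> O,
         (forall k : nat, exists N : nat, forall m n : nat, (N <= m)%N -> (N <= n)%N ->
            exists c : O, a m - a n = pi ^+ k * c) ->
         exists L : O, forall k : nat, exists N : nat, forall n : nat, (N <= n)%N ->
            exists c : O, a n - L = pi ^+ k * c) &
      residue_finite_odd pi].


Definition is_quotient_mod_pow (O : idomainType) (pi : O) (l : nat)
    (R : comNzRingType) (red : {rmorphism O -> R}) : Prop :=
  (forall r : R, exists x : O, red x = r) /\
  (forall x : O, red x = 0 <-> exists c : O, x = pi ^+ l * c).

(* S is (isomorphic to) frakO / pi^l frakO = R[theta], theta^2 = d, with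
   Galois involution conj : x + theta y |-> x - theta y *)
Definition is_unram_quad_ext (O : idomainType) (R : comNzRingType)
    (red : {rmorphism O -> R}) (S : comNzRingType) (iota : {rmorphism R -> S})
    (th : S) (d : O) (conj : S -> S) : Prop :=
  [/\ d \is a GRing.unit, ~ (exists t : O, d = t * t), th ^+ 2 = iota (red d),
      (forall s : S, exists! xy : R * R, s = iota xy.1 + iota xy.2 * th) &
      (forall x y : R, conj (iota x + iota y * th) = iota x - iota y * th)].

Definition is_add_char_nontriv (R : comNzRingType) (p : R) (l : nat) (psi : R -> algC) :=
  (forall x y : R, psi (x + y) = psi x * psi y) /\
  (exists x : R, psi (p ^+ l.-1 * x) != 1).

Section Generic.
Variable T : finComUnitRingType.
Local Notation gT := {'GL_2[T]}.

Definition scong (p : T) (k : nat) (a b : T) : bool :=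
  [exists c : T, a - b == p ^+ k * c].
Definition mxcong (p : T) (k : nat) (A B : 'M[T]_2) : bool :=
  [exists C : 'M[T]_2, A - B == p ^+ k *: C].

Definition mx2 (a b c d : T) : 'M[T]_2 :=
  \matrix_(i < 2, j < 2)
    if (i == 0 :> nat) then (if (j == 0 :> nat) then a else b)
    else (if (j == 0 :> nat) then c else d).

Definition regular (p : T) (A : 'M[T]_2) : bool :=
  ~~ [exists c : T, mxcong p 1 A c%:M].

Definition kerset (G : {set gT}) (p : T) (i : nat) : {set gT} :=
  [set g in G | mxcong p i (GLval g) 1%:M].

(* psi_A (I + p^l2 B) = psi (p^l2 tr (A B)) = psi (tr (A (g - 1))) *)
Definition psiA (psi : T -> algC) (A : 'M[T]_2) (g : gT) : algC :=
  psi (\tr (A *m (GLval g - 1%:M))).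

Definition stab (G : {set gT}) (p : T) (l2 : nat) (psi : T -> algC)
    (A : 'M[T]_2) : {set gT} :=
  [set g in G | [forall x in kerset G p l2, psiA psi A (x ^ g)%g == psiA psi A x]].

(* The conclusion of Theorem 5.1, for A1, A2 (lifts to g(o_l)) *)
Definition mult_free_claim (G : {set gT}) (p : T) (l : nat) (psi : T -> algC)
    (A1 A2 : 'M[T]_2) : Prop :=
  forall (S1 S2 K : {group gT}),
    S1 :=: stab G p (uphalf l) psi A1 ->
    S2 :=: stab G p (uphalf l) psi A2 ->
    K :=: kerset G p (uphalf l) ->
  forall (i1 : Iirr S1) (i2 : Iirr S2),
    (* Res_{K^l2} phi_i contains psi_{A_i}:  '[Res phi_i, psi_{A_i}]_K != 0 *)
    \sum_(x in K) ('Res[K] 'chi_i1) x * (psiA psi A1 x)^* != 0 ->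
    \sum_(x in K) ('Res[K] 'chi_i2) x * (psiA psi A2 x)^* != 0 ->
  forall j : Iirr (S1 :&: S2)%G,
    '['chi_j, 'Res[S1 :&: S2] 'chi_i1 * 'Res[S1 :&: S2] 'chi_i2] <= 1.

End Generic.

Section GL.
Variable T : finComUnitRingType.
Definition GL_set : {set {'GL_2[T]}} := [set: {'GL_2[T]}].
Definition inGL_mod (p : T) (k : nat) (g : 'M[T]_2) : bool :=
  [exists u : T, scong p k (\det g * u) 1].
(* tt(A) = cus over o_l1 (A given by a lift) *)
Definition cus_GL (p : T) (k : nat) (A : 'M[T]_2) : Prop :=
  exists (g : 'M[T]_2) (x sigma : T),
    [/\ inGL_mod p k g,
        (exists u : T, scong p k (sigma * u) 1),
        ~ (exists t : T, scong p k (t * t) sigma) &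
        mxcong p k (g *m A) (mx2 x sigma 1 x *m g)].
End GL.

Section GU.
Variable S : finComUnitRingType.
Variable conj : S -> S.
Definition Wmx : 'M[S]_2 := mx2 0 1 1 0.
Definition star (A : 'M[S]_2) : 'M[S]_2 := Wmx *m (map_mx conj A)^T *m Wmx.
Definition GU_set : {set {'GL_2[S]}} :=
  [set g : {'GL_2[S]} | star (GLval g) *m GLval g == 1%:M].
Definition inGU_mod (p : S) (k : nat) (g : 'M[S]_2) : bool :=
  mxcong p k (star g *m g) 1%:M.
Definition in_gu_mod (p : S) (k : nat) (A : 'M[S]_2) : bool :=
  mxcong p k (A + star A) 0.
Variable R : finComUnitRingType.
Variable iota : R -> S.
(* tt(A) = cus over o_l1 (A given by a lift); pR = pi in R, p = pi in S *)
Definition cus_GU (pR : R) (p : S) (th : S) (k : nat) (A : 'M[S]_2) : Prop :=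
  exists (g : 'M[S]_2) (x : S) (sigma : R),
    [/\ inGU_mod p k g,
        in_gu_mod p k (mx2 x (th * iota sigma) th x),
        (exists u : R, scong pR k (sigma * u) 1),
        (exists t : R, scong pR k (t * t) sigma) &
        mxcong p k (g *m A) (mx2 x (th * iota sigma) th x *m g)].
End GU.

(* Main.v *)
Require Import Defs.
From HB Require Import structures.
From mathcomp Require Import all_boot all_order all_algebra all_fingroup.
From mathcomp Require Import all_solvable all_field all_character.
From mathcomp Require Import ring.
Set Implicit Arguments. Unset Strict Implicit. Unset Printing Implicit Defensive.
Import Order.TTheory GRing.Theory Num.Theory.
Local Open Scope ring_scope.

(** Write [l = l1 + l2] with [l1 = l./2] and [l2 = uphalf l].  The stabilizer
    [S] of [psi_A] is the group of all [g] commuting with [A] modulo [pi^l1].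
    For even [l] commutators of [S] lie in the kernel of [psi_A], so both
    representations are characters of degree 1.  For odd [l] let [M] be the
    subgroup of [S] of elements which are scalar modulo [pi], and [N] the subgroup
    of [M] of elements commuting with [A] modulo [pi^l2].  A constituent [phi] over
    [psi_A] is scalar on [N] and vanishes on [M \ N]; a character [lam] of [S / M]
    fixing [phi] under twisting is trivial, because the number of such [lam]
    divides both [|S : M|] and [phi(1)], and [|M : N| = q^2] is coprime to
    [|S : M| >= q].  Hence [phi(1)^2 = |M : N|], and, [S / N] being a
    Frobenius group, [|phi| = 1] on [S \ M].

    If [A1] and [A2] commute modulo [pi^l1], the groups [S], [M], [N] agree for
    [A1], [A2] and [A1 + A2], and the three character values bound each
    multiplicity by [(q^3 |N| + |S| - |M|) / |S| < 2].  Otherwise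
    the product is supported, on the subgroup generated by [N1] and [N2] inside
    [S1] and [S2], on [N1] and [N2] simultaneously; its commutators act
    trivially and the index of the support is at least [q^2], so every
    linear character occurs at most once.

    The groups [GL_2] and [GU_2] are treated together, through the traceless part
    of their Lie algebras. *)

(** * Two by two matrices and congruences *)

(** In the commuting case the estimate needs phi(1) <= |S : M|. This is where the cuspidal type
    enters: the discriminant of the traceless part of [A1] is a non-square modulo pi, so all
    matrices [r + A1] are invertible, and after rescaling they give q different cosets of M. The
    third character lies over psi of [A1 + A2]; it obeys the same bounds once the discriminant of
    the sum is a unit, which for commuting [A1] and [A2] follows from regularity of the sum.

    No representation is constructed. Degree and absolute values are read off from the sums of
    |phi|^2 over cosets of M, that is, from Fourier analysis on the abelian group S / M. The
    obstacle is a nontrivial twist fixing phi: E such twists multiply phi(1)^2 by E.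

    For X in the unitary Lie algebra, [I + pi^i X] need not be unitary when i = l1. The Cayley
    transform replaces it in both families, with an error of order pi^(2i): zero for i = l2, and
    small enough for i = l1 wherever it is used. *)

Section TwoByTwo.

Variable T : finComUnitRingType.
Implicit Types (a b c d x : T) (A B X Y : 'M[T]_2).

Lemma mx2_eta A : A = mx2 (A 0 0) (A 0 1) (A 1 0) (A 1 1).
Proof.
apply/matrixP => i j; rewrite mxE.
by case: i j => [[|[|i]] // hi] [[|[|j]] // hj] /=; congr (A _ _); apply/val_inj.
Qed.

Lemma mx2_inj a b c d a' b' c' d' :
  mx2 a b c d = mx2 a' b' c' d' -> [/\ a = a', b = b', c = c' & d = d'].
Proof.
move/matrixP=> E; split.
- by have := E 0 0; rewrite !mxE.
- by have := E 0 1; rewrite !mxE.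
- by have := E 1 0; rewrite !mxE.
- by have := E 1 1; rewrite !mxE.
Qed.

Lemma mx2_add a b c d a' b' c' d' :
  mx2 a b c d + mx2 a' b' c' d' = mx2 (a + a') (b + b') (c + c') (d + d').
Proof. by rewrite [LHS]mx2_eta !mxE. Qed.

Lemma mx2_opp a b c d : - mx2 a b c d = mx2 (- a) (- b) (- c) (- d).
Proof. by rewrite [LHS]mx2_eta !mxE. Qed.

Lemma mx2_scale x a b c d : x *: mx2 a b c d = mx2 (x * a) (x * b) (x * c) (x * d).
Proof. by rewrite [LHS]mx2_eta !mxE. Qed.

Lemma mx2_scalar x : x%:M = mx2 x 0 0 x.
Proof. by rewrite [LHS]mx2_eta !mxE. Qed.

Lemma mx2_mul a b c d a' b' c' d' :
  mx2 a b c d *m mx2 a' b' c' d' =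
  mx2 (a * a' + b * c') (a * b' + b * d') (c * a' + d * c') (c * b' + d * d').
Proof.
by rewrite [LHS]mx2_eta !mxE !big_ord_recl !big_ord0 !mxE /= !addr0.
Qed.

Lemma mx2_tr a b c d : \tr (mx2 a b c d) = a + d.
Proof. by rewrite /mxtrace !big_ord_recl big_ord0 !mxE /= addr0. Qed.

Lemma mx2_det a b c d : \det (mx2 a b c d) = a * d - b * c.
Proof.
rewrite (expand_det_row _ 0) !big_ord_recl big_ord0 /cofactor !det_mx11 !mxE /=.
by rewrite /bump /= addn0 expr0 expr1; ring.
Qed.

Definition mx2E := (mx2_add, mx2_opp, mx2_scale, mx2_scalar, mx2_mul).

Lemma mx2_traceless X : \tr X = 0 -> X = mx2 (X 0 0) (X 0 1) (X 1 0) (- X 0 0).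
Proof.
move=> trX; rewrite {1}[X]mx2_eta; congr mx2; apply/eqP.
by rewrite -addr_eq0 addrC -(mx2_tr _ (X 0 1) (X 1 0)) -mx2_eta trX.
Qed.

(** Polarized Cayley-Hamilton theorem for traceless matrices. *)
Lemma traceless_anticomm X Y : \tr X = 0 -> \tr Y = 0 ->
  X *m Y + Y *m X = (\tr (X *m Y))%:M.
Proof.
move=> /mx2_traceless-> /mx2_traceless->; rewrite !mx2E mx2_tr.
by congr mx2; ring.
Qed.

Section Decomposition.

Variables (A : 'M[T]_2) (del : T).
Hypotheses (trA : \tr A = 0) (A2 : A *m A = del%:M).
Hypotheses (u2 : (2 : T) \is a GRing.unit) (udel : del \is a GRing.unit).

(** For traceless [X] the anticommutator with [A] is scalar, so [X *m A - A *m X] is [2 *: (X *m A)]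
    minus a scalar; multiplying by [A] and dividing by [2 * del] recovers [X]. Hence a matrix
    commuting with [A] modulo [P ^+ k] is a polynomial in [A] modulo [P ^+ k]. *)
Lemma traceless_decomp X : X = (\tr X / 2)%:M + (\tr (X *m A) / (2 * del)) *: A
  + (2 * del)^-1 *: ((X *m A - A *m X) *m A).
Proof.
have [X0 trX0 DX] : exists2 X0, \tr X0 = 0 & X = (\tr X / 2)%:M + X0.
  exists (X - (\tr X / 2)%:M); last by rewrite addrC subrK.
  by rewrite linearB /= mxtrace_scalar -[_ *+ 2]mulr_natr divrK // subrr.
have trXA : \tr (X *m A) = \tr (X0 *m A).
  by rewrite {1}DX mulmxDl mul_scalar_mx mxtraceD linearZ /= trA mulr0 add0r.
have comX : X *m A - A *m X = X0 *m A - A *m X0.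
  rewrite {1 2}DX mulmxDl mulmxDr opprD addrACA scalar_mxC subrr add0r //.
rewrite trXA comX {1}DX -addrA; congr (_ + _).
have anti := traceless_anticomm trX0 trA.
have -> : X0 *m A - A *m X0 = 2 *: (X0 *m A) - (\tr (X0 *m A))%:M.
  by rewrite -anti scaler_nat mulr2n addrKA.
rewrite mulmxBl -scalemxAl -mulmxA A2 mul_mx_scalar mul_scalar_mx scalerBr.
rewrite !scalerA -mulrA mulVr ?unitrM ?u2 // scale1r.
by rewrite [(2 * del)^-1 * _]mulrC addrC subrK.
Qed.

End Decomposition.

End TwoByTwo.

Section Entries.

Variable T : finComUnitRingType.
Implicit Types X Y : 'M[T]_2.

Lemma addmx_ij X Y i j : (X + Y) i j = X i j + Y i j. Proof. by rewrite mxE. Qed.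
Lemma oppmx_ij X i j : (- X) i j = - X i j. Proof. by rewrite mxE. Qed.
Lemma scalemx_ij a X i j : (a *: X) i j = a * X i j. Proof. by rewrite mxE. Qed.

End Entries.

Ltac mx_linear :=
  apply/matrixP => ? ?; rewrite ?(addmx_ij, oppmx_ij, scalemx_ij); ring.

Section Congruence.

Variables (T : finComUnitRingType) (P : T).
Implicit Types (x y : T) (A B X Y : 'M[T]_2).

Definition dv k x := exists c, x = P ^+ k * c.
Definition dvm k X := exists C, X = P ^+ k *: C.

Lemma scongP k x y : reflect (dv k (x - y)) (scong P k x y).
Proof.
apply: (iffP existsP) => [[c /eqP ->]|[c ->]]; first by exists c.
by exists c.
Qed.

Lemma mxcongP k X Y : reflect (dvm k (X - Y)) (mxcong P k X Y).
Proof.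
apply: (iffP existsP) => [[c /eqP ->]|[c ->]]; first by exists c.
by exists c.
Qed.

Lemma dvD k x y : dv k x -> dv k y -> dv k (x + y).
Proof. by move=> [c ->] [d ->]; exists (c + d); rewrite mulrDr. Qed.
Lemma dvN k x : dv k x -> dv k (- x).
Proof. by move=> [c ->]; exists (- c); rewrite mulrN. Qed.
Lemma dvB k x y : dv k x -> dv k y -> dv k (x - y).
Proof. by move=> hx /dvN; apply: dvD. Qed.
Lemma dvMl k x y : dv k y -> dv k (x * y).
Proof. by move=> [c ->]; exists (x * c); rewrite mulrCA. Qed.
Lemma dvMr k x y : dv k x -> dv k (x * y).
Proof. by rewrite mulrC; apply: dvMl. Qed.
Lemma dvM i j x y : dv i x -> dv j y -> dv (i + j) (x * y).
Proof. by move=> [c ->] [d ->]; exists (c * d); rewrite exprD mulrACA. Qed.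
Lemma dvW i j x : (i <= j)%N -> dv j x -> dv i x.
Proof. by move=> /subnK<- [c ->]; exists (P ^+ (j - i) * c); rewrite mulrA -exprD addnC. Qed.
Lemma dv_exp k : dv k (P ^+ k).
Proof. by exists 1; rewrite mulr1. Qed.

Lemma dvmD k X Y : dvm k X -> dvm k Y -> dvm k (X + Y).
Proof. by move=> [c ->] [d ->]; exists (c + d); rewrite scalerDr. Qed.
Lemma dvmN k X : dvm k X -> dvm k (- X).
Proof. by move=> [c ->]; exists (- c); rewrite scalerN. Qed.
Lemma dvmB k X Y : dvm k X -> dvm k Y -> dvm k (X - Y).
Proof. by move=> hx /dvmN; apply: dvmD. Qed.
Lemma dvmBl k X Y : dvm k (X - Y) -> dvm k X -> dvm k Y.
Proof. by move=> dXY dX; rewrite -[Y](subKr X); apply: dvmB. Qed.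
Lemma dvmMl k X Y : dvm k Y -> dvm k (X *m Y).
Proof. by move=> [c ->]; exists (X *m c); rewrite scalemxAr. Qed.
Lemma dvmMr k X Y : dvm k X -> dvm k (X *m Y).
Proof. by move=> [c ->]; exists (c *m Y); rewrite scalemxAl. Qed.
Lemma dvmM i j X Y : dvm i X -> dvm j Y -> dvm (i + j) (X *m Y).
Proof.
by move=> [c ->] [d ->]; exists (c *m d); rewrite -scalemxAl -scalemxAr scalerA exprD.
Qed.
Lemma dvmZ i j x X : dv i x -> dvm j X -> dvm (i + j) (x *: X).
Proof. by move=> [c ->] [D ->]; exists (c *: D); rewrite !scalerA exprD mulrAC. Qed.
Lemma dvmZr k x X : dvm k X -> dvm k (x *: X).
Proof. by move=> [D ->]; exists (x *: D); rewrite !scalerA mulrC. Qed.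
Lemma dvmZl k x X : dv k x -> dvm k (x *: X).
Proof. by move=> [c ->]; exists (c *: X); rewrite scalerA. Qed.
Lemma dvmW i j X : (i <= j)%N -> dvm j X -> dvm i X.
Proof. by move=> /subnK<- [c ->]; exists (P ^+ (j - i) *: c); rewrite scalerA -exprD addnC. Qed.
Lemma dvm0 k : dvm k 0.
Proof. by exists 0; rewrite scaler0. Qed.
Lemma dvm_exp k X : dvm k (P ^+ k *: X).
Proof. by exists X. Qed.
Lemma dvm_tr k X : dvm k X -> dv k (\tr X).
Proof. by move=> [c ->]; exists (\tr c); rewrite linearZ. Qed.
Lemma dvm_entry k X i j : dvm k X -> dv k (X i j).
Proof. by move=> [c ->]; exists (c i j); rewrite mxE. Qed.
Lemma dvm_mx2 k a b c d : dv k a -> dv k b -> dv k c -> dv k d -> dvm k (mx2 a b c d).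
Proof.
move=> [a' ->] [b' ->] [c' ->] [d' ->].
by exists (mx2 a' b' c' d'); rewrite mx2_scale.
Qed.

Lemma dvm_entryP k X : (forall i j, dv k (X i j)) -> dvm k X.
Proof. by move=> H; rewrite [X]mx2_eta; apply: dvm_mx2. Qed.

Lemma dvm_scalar k x : dvm k x%:M -> dv k x.
Proof. by move=> /(@dvm_entry _ _ 0 0); rewrite mxE. Qed.

Lemma dv_divl k u x : u \is a GRing.unit -> dv k (u * x) -> dv k x.
Proof. by move=> uu /(@dvMl _ u^-1); rewrite mulKr. Qed.

Lemma dvm_divl k (A B X : 'M[T]_2) : B *m A = 1%:M -> dvm k (A *m X) -> dvm k X.
Proof. by move=> BA /(dvmMl B); rewrite mulmxA BA mul1mx. Qed.

Lemma dvm_divr k (A B X : 'M[T]_2) : A *m B = 1%:M -> dvm k (X *m A) -> dvm k X.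
Proof. by move=> AB /(dvmMr B); rewrite -mulmxA AB mulmx1. Qed.

End Congruence.

(** * The common setting of the two families *)

Section CommuteModulo.

Variables (T : finComUnitRingType) (P : T).
Implicit Types (X Y Z : 'M[T]_2).

Definition cm k X Y := dvm P k (X *m Y - Y *m X).

Lemma cm_sym k X Y : cm k X Y -> cm k Y X.
Proof. by move=> /dvmN; rewrite /cm opprB. Qed.
Lemma cmM k X Y Z : cm k X Y -> cm k X Z -> cm k X (Y *m Z).
Proof.
move=> XY XZ; rewrite /cm.
have -> : X *m (Y *m Z) - Y *m Z *m X = (X *m Y - Y *m X) *m Z + Y *m (X *m Z - Z *m X).
  by rewrite mulmxBl mulmxBr !mulmxA addrA subrK.
by apply: dvmD; [apply: dvmMr | apply: dvmMl].
Qed.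
Lemma cmD k X Y Z : cm k X Y -> cm k X Z -> cm k X (Y + Z).
Proof.
by move=> XY XZ; rewrite /cm mulmxDl mulmxDr opprD addrACA; apply: dvmD.
Qed.
Lemma cm_scalar k X a : cm k X a%:M.
Proof. by rewrite /cm scalar_mxC subrr; apply: dvm0. Qed.
Lemma cmZ i j X Y a : dv P i a -> cm j X Y -> cm (i + j) X (a *: Y).
Proof.
by move=> ha XY; rewrite /cm -scalemxAr -scalemxAl -scalerBr; apply: dvmZ.
Qed.
Lemma cmZr k X Y a : cm k X Y -> cm k X (a *: Y).
Proof.
by move=> XY; rewrite /cm -scalemxAr -scalemxAl -scalerBr; apply: dvmZr.
Qed.
Lemma cm_dv k X Y : dvm P k Y -> cm k X Y.
Proof. by move=> hY; apply: dvmB; [apply: dvmMl | apply: dvmMr]. Qed.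
Lemma cmW i j X Y : (i <= j)%N -> cm j X Y -> cm i X Y.
Proof. exact: dvmW. Qed.
Lemma cmV k X Y Y' : Y *m Y' = 1%:M -> Y' *m Y = 1%:M -> cm k X Y -> cm k X Y'.
Proof.
move=> YY' Y'Y XY; rewrite /cm.
have -> : X *m Y' - Y' *m X = Y' *m (Y *m X - X *m Y) *m Y'.
  by rewrite mulmxBr mulmxBl !mulmxA Y'Y mul1mx -!mulmxA YY' mulmx1.
by apply/dvmMr/dvmMl; rewrite -opprB; apply: dvmN.
Qed.
Lemma cm_refl k X : cm k X X.
Proof. by rewrite /cm subrr; apply: dvm0. Qed.

End CommuteModulo.

Section GLmatrix.

Variable T : finComUnitRingType.
Implicit Types g h : {'GL_2[T]}.

Definition mG g : 'M[T]_2 := GLval g.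

Lemma mG_M g h : mG (g * h)%g = mG g *m mG h.
Proof. by []. Qed.
Lemma mG_1 : mG 1%g = 1%:M.
Proof. by []. Qed.
Lemma mG_V g : mG g *m mG g^-1%g = 1%:M.
Proof. by rewrite -mG_M mulgV mG_1. Qed.
Lemma mG_Vl g : mG g^-1%g *m mG g = 1%:M.
Proof. by rewrite -mG_M mulVg mG_1. Qed.
Lemma mG_R g h : mG [~ g, h]%g - 1%:M =
  mG g^-1%g *m (mG h^-1%g *m mG g *m mG h - mG g).
Proof.
rewrite commgEl conjgE !mG_M mulmxBr mG_Vl; congr (_ - _).
by rewrite !mulmxA.
Qed.
Lemma mG_unit (X : 'M[T]_2) : \det X \is a GRing.unit -> exists g, mG g = X.
Proof.
move=> uX; have UX : X \is a GRing.unit by rewrite -[_ \is a _]/(X \in unitmx) unitmxE.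
by exists (FinRing.unit _ UX).
Qed.

End GLmatrix.

(** Here [eps] is [1] for the linear group and [th] for the unitary one. *)
Definition lie_mx (R T : finComUnitRingType) (iota : R -> T) (eps : T) (a b c : R) :
    'M[T]_2 :=
  mx2 (iota a) (eps * iota b) (eps * iota c) (- iota a).

(* The data common to both families: [lie a b c] runs through the traceless
   part of the Lie algebra of [G], an [R]-module of rank 3, also when the
   matrix entries lie in the quadratic extension [T] of [R]. *)
Record matrix_datum (R T : finComUnitRingType) (iota : {rmorphism R -> T}) (p : R)
    (eps : T) (e : R) (psi : T -> algC) (G : {group {'GL_2[T]}}) (l : nat) : Prop :=
  MatrixDatum {
    md_two : (2 : R) \is a GRing.unit;
    md_e : e \is a GRing.unit;
    md_eps : eps * eps = iota e;
    md_locR : forall x : R, x \is a GRing.unit \/ dv p 1 x;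
    md_locT : forall x : T, x \is a GRing.unit \/ dv (iota p) 1 x;
    md_nil : p ^+ l = 0;
    md_ann : forall k x, (k <= l)%N -> iota p ^+ k * x = 0 -> dv (iota p) (l - k) x;
    md_refl : forall k r, dv (iota p) k (iota r) -> dv p k r;
    md_div : forall z : R, z != 0 -> exists c, p ^+ l.-1 = z * c;
    md_psiD : forall x y, psi (x + y) = psi x * psi y;
    md_psi_nt : exists x : R, psi (iota (p ^+ l.-1 * x)) != 1;
    md_Ad : forall g a b c, g \in G -> exists a' b' c',
      mG g *m lie_mx iota eps a b c *m mG g^-1%g = lie_mx iota eps a' b' c';
    md_one : forall a b x y z, a ^+ 2 - b ^+ 2 * (x ^+ 2 + e * y * z) = 1 ->
      exists2 g, g \in G & mG g = (iota a)%:M + iota b *: lie_mx iota eps x y z;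
    md_unit : forall a b x y z,
      a ^+ 2 - b ^+ 2 * (x ^+ 2 + e * y * z) \is a GRing.unit ->
      exists lam g, [/\ lam \is a GRing.unit, g \in G &
        mG g = lam *: ((iota a)%:M + iota b *: lie_mx iota eps x y z)]
  }.

Section Datum.

Variables (R T : finComUnitRingType) (iota : {rmorphism R -> T}) (p : R).
Variables (eps : T) (e : R) (psi : T -> algC) (G : {group {'GL_2[T]}}) (l : nat).
Hypothesis md : matrix_datum iota p eps e psi G l.
Hypothesis psi0 : psi 0 = 1.

Local Notation P := (iota p).
Local Notation lie := (lie_mx iota eps).
Implicit Types (g h n : {'GL_2[T]}) (X Y : 'M[T]_2).

Lemma dv_l x : dv P l x -> x = 0.
Proof. by move=> [c ->]; rewrite -rmorphXn (md_nil md) rmorph0 mul0r. Qed.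

Lemma dvm_l X : dvm P l X -> X = 0.
Proof. by move=> [c ->]; rewrite -rmorphXn (md_nil md) rmorph0 scale0r. Qed.

Lemma dv_ge k x : (l <= k)%N -> dv P k x -> x = 0.
Proof. by move=> lk /(dvW lk)/dv_l. Qed.

Lemma dvm_ge k X : (l <= k)%N -> dvm P k X -> X = 0.
Proof. by move=> lk /(dvmW lk)/dvm_l. Qed.

Lemma unit_not_dv (x : T) : x \is a GRing.unit -> ~ dv P 1 x.
Proof.
move=> ux [c Dx]; have : x ^+ l = 0.
  by rewrite Dx expr1 exprMn -rmorphXn /= (md_nil md) rmorph0 mul0r.
by move=> x0; have := unitrX l ux; rewrite x0 unitr0.
Qed.

Lemma unit_not_dvR (x : R) : x \is a GRing.unit -> ~ dv p 1 x.
Proof.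
move=> ux [c Dx]; apply: (@unit_not_dv (iota x)); first by rewrite rmorph_unit.
by exists (iota c); rewrite Dx rmorphM rmorphXn.
Qed.

Lemma dv_prime (x y : T) : dv P 1 (x * y) -> dv P 1 x \/ dv P 1 y.
Proof.
move=> xy; case: (md_locT md x) => [ux|]; last by left.
by right; apply: dv_divl ux xy.
Qed.

(** Cancelling [P ^+ k] is only possible up to its annihilator, the multiples of [P ^+ (l - k)];
    [k + i <= l] makes these multiples of [P ^+ i]. *)
Lemma dv_cancel k i x : (k + i <= l)%N -> dv P (k + i) (P ^+ k * x) -> dv P i x.
Proof.
move=> ki [c]; rewrite exprD -mulrA => /eqP; rewrite -subr_eq0 -mulrBr => /eqP.
move=> /(md_ann md (leq_trans (leq_addr _ _) ki)) hx.
rewrite -(subrK (P ^+ i * c) x); apply: dvD; last by exists c.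
by apply: dvW hx; rewrite leq_subRL ?(leq_trans (leq_addr _ _) ki).
Qed.

Lemma dvm_cancel k i X : (k + i <= l)%N -> dvm P (k + i) (P ^+ k *: X) -> dvm P i X.
Proof.
move=> ki /dvm_entry hX; apply: dvm_entryP => r s; apply: (dv_cancel ki).
by have := hX r s; rewrite mxE.
Qed.

Lemma two_unit : (2 : T) \is a GRing.unit.
Proof. by rewrite -(rmorph_nat iota) rmorph_unit ?(md_two md). Qed.

Lemma lieB a b c a' b' c' : lie a b c - lie a' b' c' = lie (a - a') (b - b') (c - c').
Proof.
by rewrite /lie_mx !mx2E !rmorphB; congr mx2; ring.
Qed.

Lemma lieD a b c a' b' c' : lie a b c + lie a' b' c' = lie (a + a') (b + b') (c + c').
Proof. by rewrite /lie_mx !mx2E !rmorphD; congr mx2; ring. Qed.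

Lemma lieZ r a b c : iota r *: lie a b c = lie (r * a) (r * b) (r * c).
Proof. by rewrite /lie_mx !mx2E !rmorphM; congr mx2; ring. Qed.

Lemma lie_tr a b c : \tr (lie a b c) = 0.
Proof. by rewrite mx2_tr subrr. Qed.

Lemma lie_sqr a b c : lie a b c *m lie a b c = (iota (a ^+ 2 + e * b * c))%:M.
Proof.
rewrite /lie_mx !mx2E !(rmorphD, rmorphM, rmorphXn) /= -(md_eps md).
by congr mx2; ring.
Qed.

Lemma lie_trM a b c a' b' c' :
  \tr (lie a b c *m lie a' b' c') = iota (2 * (a * a') + e * (b * c' + c * b')).
Proof.
rewrite /lie_mx !mx2E mx2_tr !(rmorphD, rmorphM, rmorph_nat) /= -(md_eps md).
by ring.
Qed.

Lemma lie_bracket a b c a' b' c' :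
  lie a b c *m lie a' b' c' - lie a' b' c' *m lie a b c =
  lie (e * (b * c' - c * b')) (2 * (a * b' - b * a')) (2 * (c * a' - a * c')).
Proof.
rewrite /lie_mx !mx2E !(rmorphD, rmorphB, rmorphM, rmorph_nat) /= -(md_eps md).
by congr mx2; ring.
Qed.

Lemma eps_unit : eps \is a GRing.unit.
Proof.
have : eps * eps \is a GRing.unit by rewrite (md_eps md) rmorph_unit ?(md_e md).
by rewrite unitrM andbb.
Qed.

Lemma lie_dv k a b c : dvm P k (lie a b c) -> [/\ dv p k a, dv p k b & dv p k c].
Proof.
move=> h; split; apply: (md_refl md).
- by have := dvm_entry 0 0 h; rewrite mxE.
- by apply: dv_divl eps_unit _; have := dvm_entry 0 1 h; rewrite mxE.
- by apply: dv_divl eps_unit _; have := dvm_entry 1 0 h; rewrite mxE.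
Qed.

Lemma dv_lie k a b c : dv p k a -> dv p k b -> dv p k c -> dvm P k (lie a b c).
Proof.
move=> [a' ->] [b' ->] [c' ->].
by exists (lie a' b' c'); rewrite -rmorphXn lieZ.
Qed.

Lemma psi_eq_diff x y : psi x = psi y -> psi (x - y) = 1.
Proof.
by move=> exy; rewrite (md_psiD md) exy -(md_psiD md) subrr psi0.
Qed.

(** The multiples of [p ^+ l.-1] lie in every nonzero ideal, and [psi] is nontrivial on them. *)
Lemma char_zero (z : R) : (forall r, psi (iota (z * r)) = 1) -> z = 0.
Proof.
move=> Hz; apply/eqP; apply/idPn => /(md_div md)[c Dc].
by case: (md_psi_nt md) => x; rewrite Dc -mulrA Hz eqxx.
Qed.

(** In the coordinates of [lie] the coefficients of the trace form are [2] and [e], both units, so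
    testing against the three coordinate matrices isolates each entry. *)
Lemma lie_nondeg i a b c : (i <= l)%N ->
  (forall a' b' c', psi (P ^+ i * \tr (lie a b c *m lie a' b' c')) = 1) ->
  dvm P (l - i) (lie a b c).
Proof.
move=> il H; have dvR u x : u \is a GRing.unit ->
    (forall r, psi (iota (p ^+ i * (u * (x * r)))) = 1) -> dv p (l - i) x.
  move=> uu Hx; have x0 : p ^+ i * x = 0.
    apply: char_zero => r; rewrite -(Hx (u^-1 * r)); congr (psi (iota _)).
    by rewrite [x * _]mulrCA mulVKr // mulrA.
  apply: (md_refl md); apply: (md_ann md) => //.
  by rewrite -rmorphXn -rmorphM /= x0 rmorph0.
apply: dv_lie.
- apply: (dvR 2) => [|r]; first exact: (md_two md).
  have := H r 0 0; rewrite lie_trM -rmorphXn -rmorphM => <-.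
  by congr (psi (iota _)); ring.
- apply: (dvR e) => [|r]; first exact: (md_e md).
  have := H 0 0 r; rewrite lie_trM -rmorphXn -rmorphM => <-.
  by congr (psi (iota _)); ring.
- apply: (dvR e) => [|r]; first exact: (md_e md).
  have := H 0 r 0; rewrite lie_trM -rmorphXn -rmorphM => <-.
  by congr (psi (iota _)); ring.
Qed.

(** With [Y = (p ^+ i / 2) X] and [Y ^ 2 = s] scalar, [y] is the Cayley transform
    [(1 + Y) / (1 - Y) = (1 + Y)^2 / (1 - s)]. Its norm is [1], so it belongs to [G] in both
    families. *)
Lemma cayley i a b c : (0 < i)%N ->
  exists2 y, y \in G & dvm P (i + i) (mG y - 1%:M - P ^+ i *: lie a b c).
Proof.
move=> i0; pose eta := a ^+ 2 + e * b * c; pose s := (p ^+ i / 2) ^+ 2 * eta.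
have u2 := md_two md.
have us : 1 - s \is a GRing.unit.
  case: (md_locR md (1 - s)) => // h; case: (@unit_not_dvR 1); first exact: unitr1.
  rewrite -(subrK s 1); apply: dvD => //; rewrite /s expr2 -!mulrA.
  by apply/dvMr/(dvW i0)/dv_exp.
pose mu := (1 - s)^-1.
have e4 : 4 * s = p ^+ i ^+ 2 * eta.
  rewrite /s exprMn; have -> : (4 : R) = 2 ^+ 2 by rewrite -natrX.
  by rewrite mulrA mulrCA -exprMn mulrV // expr1n mulr1.
have mu1 : mu * (1 - s) = 1 by rewrite mulVr.
have [y Gy Dy] : exists2 y, y \in G &
    mG y = (iota (mu * (1 + s)))%:M + iota (mu * p ^+ i) *: lie a b c.
  apply: (md_one md).
  have -> : (mu * (1 + s)) ^+ 2 - (mu * p ^+ i) ^+ 2 * (a ^+ 2 + e * b * c) =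
      mu ^+ 2 * ((1 + s) ^+ 2 - 4 * s) by rewrite e4 /eta; ring.
  have -> : (1 + s) ^+ 2 - 4 * s = (1 - s) ^+ 2 by ring.
  by rewrite -exprMn mu1 expr1n.
exists y => //; rewrite Dy.
have -> : (iota (mu * (1 + s)))%:M + iota (mu * p ^+ i) *: lie a b c - 1%:M
    - P ^+ i *: lie a b c =
    (iota (2 * mu * s))%:M + iota (p ^+ i * (mu * s)) *: lie a b c.
  have -> : 2 * mu * s = mu * (1 + s) - 1.
    by transitivity (mu * (1 + s) - mu * (1 - s)); [ring | rewrite mu1].
  have -> : p ^+ i * (mu * s) = mu * p ^+ i - p ^+ i.
    by transitivity (mu * p ^+ i - p ^+ i * (mu * (1 - s))); [ring | rewrite mu1 mulr1].
  by rewrite !rmorphB /= (rmorph1 iota) scalerBl rmorphXn [RHS]addrACA -opprD opprD addrA.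
have dvs : dv P (i + i) (iota s).
  exists (iota (2^-1 ^+ 2 * eta)); rewrite -rmorphXn -rmorphM /=.
  by congr (iota _); rewrite /s exprD exprMn expr2; ring.
apply: dvmD.
  by rewrite -scalemx1; apply: dvmZl; rewrite rmorphM; apply: dvMl.
by apply: dvmZl; rewrite rmorphM; apply: dvMl; rewrite rmorphM; apply: dvMl.
Qed.

End Datum.

(** * Characters: scalar action and twisting *)

Section ScalarAction.

Variables (gT : finGroupType) (S : {group gT}).

Lemma irr_cent_scalar (i : Iirr S) (B : 'M[algC]_(irr_degree (socle_of_Iirr i))) :
  {in S, forall x, 'Chi_i x *m B = B *m 'Chi_i x} -> exists c, B = c%:M.
Proof.
move=> cB; apply/is_scalar_mxP.
apply: (mx_abs_irr_cent_scalar (rG := 'Chi_i)).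
  by apply: groupC; apply: socle_irr.
by apply/centgmxP => x Sx; rewrite cB.
Qed.

(* The twisted average [\sum_k (f k)^* k] over [K] is an intertwiner, hence a
   scalar; if it is nonzero then [K] acts through [f]. *)
Lemma irr_acts_linearly (K : {group gT}) (f : gT -> algC) (i : Iirr S) y :
    K \subset S -> S \subset 'N(K)%g -> y \in S ->
    {in K &, {morph f : a b / (a * b)%g >-> a * b}} ->
    {in K & S, forall a g, f (a ^ g)%g = f a} ->
    \sum_(x in K) 'chi_i (y * x)%g * (f x)^* != 0 ->
  {in S & K, forall x k, 'chi_i (x * k)%g = 'chi_i x * f k}.
Proof.
move=> sKS nKS Sy fM fJ nz.
have [x0 Kx0 fx0] : exists2 x, x \in K & f x != 0.
  apply/exists_inP; apply: contraR nz => /exists_inPn f0.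
  by rewrite big1 // => x /f0/negPn/eqP->; rewrite conjC0 mulr0.
have f1 : f 1%g = 1.
  by apply: (mulfI fx0); rewrite -fM ?group1 // mulg1 mulr1.
have fX k n : k \in K -> f (k ^+ n)%g = f k ^+ n.
  move=> Kk; elim: n => [|n IHn]; first by rewrite expg0 expr0.
  by rewrite expgS exprS fM ?groupX ?IHn.
have norm_f k : k \in K -> `|f k| = 1.
  move=> Kk; have := fX k #[k]%g Kk; rewrite expg_order f1 => fk1.
  apply/eqP; rewrite -(@pexpr_eq1 _ _ #[k]%g) ?order_gt0 ?normr_ge0 //.
  by rewrite -normrX -fk1 normr1.
have fV k : k \in K -> (f k^-1%g)^* = f k.
  move=> Kk; have nzf : f k != 0 by rewrite -normr_eq0 norm_f ?oner_eq0.
  have -> : f k^-1%g = (f k)^-1.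
    by apply: (mulfI nzf); rewrite divff // -fM ?groupV // mulgV.
  by rewrite invC_norm norm_f // expr1n invr1 mul1r conjCK.
pose E := \sum_(x in K) (f x)^* *: 'Chi_i x.
have chiE z : z \in S -> 'chi_i z = \tr ('Chi_i z).
  by move=> Sz; rewrite -irrRepr cfunE Sz mulr1n.
have trE z : z \in S ->
    \tr ('Chi_i z *m E) = \sum_(x in K) 'chi_i (z * x)%g * (f x)^*.
  move=> Sz; rewrite /E mulmx_sumr raddf_sum /=; apply: eq_bigr => x Kx.
  have Sx := subsetP sKS x Kx.
  by rewrite -scalemxAr linearZ /= -repr_mxM // -chiE ?groupM // mulrC.
have EK k : k \in K -> 'Chi_i k *m E = f k *: E.
  move=> Kk; rewrite /E mulmx_sumr scaler_sumr.
  rewrite [RHS](reindex_inj (mulgI k)) /=.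
  rewrite [RHS](eq_bigl (fun x => x \in K)); last by move=> x; rewrite groupMl.
  apply: eq_bigr => x Kx; have [Sk Sx] := (subsetP sKS k Kk, subsetP sKS x Kx).
  rewrite -scalemxAr -repr_mxM // scalerA fM // rmorphM /= mulrA.
  by rewrite -normCK norm_f // expr1n mul1r.
have cE : {in S, forall x, 'Chi_i x *m E = E *m 'Chi_i x}.
  move=> g Sg; rewrite /E mulmx_sumr mulmx_suml.
  rewrite (reindex_inj (conjg_inj g)) /=.
  rewrite (eq_bigl (fun x => x \in K)); last first.
    by move=> x; rewrite memJ_norm ?(subsetP nKS).
  apply: eq_bigr => x Kx; have Sx := subsetP sKS x Kx.
  rewrite -scalemxAr -scalemxAl fJ // -!repr_mxM ?groupJ //.
  by rewrite conjgE mulgA mulgV mul1g.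
have [c Ec] := irr_cent_scalar cE.
have nzE : c != 0.
  apply: contraNneq nz => c0.
  by rewrite -trE // Ec c0 mul_mx_scalar scale0r mxtrace0.
move=> x k Sx Kk; have Sk := subsetP sKS k Kk.
have -> : 'chi_i (x * k)%g = \tr ('Chi_i x *m 'Chi_i k).
  by rewrite chiE ?groupM // repr_mxM.
have -> : 'Chi_i k = (f k)%:M.
  apply: (scalerI nzE); rewrite -mul_mx_scalar -Ec EK //.
  by rewrite Ec scale_scalar_mx mulrC -scale_scalar_mx.
by rewrite mul_mx_scalar linearZ /= -chiE // mulrC.
Qed.

(** By Schur's lemma [n] acts as a scalar, which has absolute value 1 because [n] has finite
    order. *)
Lemma irr_center_norm (i : Iirr S) n :
    n \in S -> {in S, forall g, [~ n, g]%g \in cfker 'chi_i} ->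
  {in S, forall x, `|'chi_i (n * x)%g| = `|'chi_i x|} /\
  `|'chi_i n| = 'chi_i 1%g.
Proof.
move=> Sn cn.
have [c Dc] : exists c, 'Chi_i n = c%:M.
  apply: irr_cent_scalar => x Sx; rewrite -!repr_mxM //.
  have -> : (n * x = x * n * [~ n, x])%g by rewrite commgC.
  have := cn x Sx; rewrite -irrRepr cfker_repr => /rkerP[Sc ec].
  rewrite (repr_mxM _ (groupM Sx Sn) Sc).
  by rewrite ec mulmx1.
have chiE z : z \in S -> 'chi_i z = \tr ('Chi_i z).
  by move=> Sz; rewrite -irrRepr cfunE Sz mulr1n.
have chi_c x : x \in S -> 'chi_i (n * x)%g = c * 'chi_i x.
  move=> Sx; rewrite chiE ?groupM // repr_mxM // Dc mul_scalar_mx.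
  by rewrite linearZ /= -chiE.
have cX : 'chi_i n = c * 'chi_i 1%g by rewrite -{1}[n]mulg1 chi_c.
have c1 : `|c| = 1.
  have cm m : 'chi_i (n ^+ m)%g = c ^+ m * 'chi_i 1%g.
    elim: m => [|m IHm]; first by rewrite expg0 mul1r.
    by rewrite expgS chi_c ?groupX // IHm exprS mulrA.
  have := cm #[n]%g; rewrite expg_order -[LHS]mul1r => /(mulIf (irr1_neq0 i)) e1.
  apply/eqP; rewrite -(@pexpr_eq1 _ _ #[n]%g) ?order_gt0 ?normr_ge0 //.
  by rewrite -normrX -e1 normr1.
split; first by move=> x Sx; rewrite chi_c // normrM c1 mul1r.
by rewrite cX normrM c1 mul1r ger0_norm ?char1_ge0 ?irr_char.
Qed.

End ScalarAction.

Section LinearCharacterSums.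

Local Open Scope group_scope.
Local Open Scope ring_scope.

(** The characters summed are inflated from the abelian group [S / M], where they add up to the
    regular character. *)
Lemma sum_lin_char_quo (gT : finGroupType) (S M : {group gT}) x :
    (M <| S)%g -> S^`(1)%g \subset M -> x \in S ->
  \sum_(j | M \subset cfker 'chi[S]_j) 'chi_j x =
    (if x \in M then #|S : M|%:R else 0).
Proof.
move=> nsMS sS'M Sx; have [sMS nMS] := andP nsMS.
have abq : abelian (S / M)%g by rewrite sub_der1_abelian.
rewrite (reindex _ (mod_Iirr_bij nsMS)) /=.
rewrite (eq_bigl predT); last by move=> i; rewrite mod_IirrE ?cfker_mod.
transitivity (cfReg (S / M)%g (coset M x)).
  rewrite cfReg_sum sum_cfunE; apply: eq_bigr => j _.
  rewrite mod_IirrE // cfModE // cfunE lin_char1 ?mul1r //.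
  exact/char_abelianP.
rewrite cfRegE card_quotient // (sameP eqP (kerP _ (subsetP nMS x Sx))).
by rewrite ker_coset; case: (x \in M).
Qed.

Lemma card_irr_ker (gT : finGroupType) (S M : {group gT}) :
    (M <| S)%g -> S^`(1)%g \subset M ->
  #|[pred j | M \subset cfker 'chi[S]_j]| = #|S : M|.
Proof.
move=> nsMS sS'M; have [sMS nMS] := andP nsMS.
have abq : abelian (S / M)%g by rewrite sub_der1_abelian.
rewrite -(on_card_preimset (mod_Iirr_bij nsMS)) -card_quotient //.
move: abq; rewrite card_classes_abelian => /eqP <-; rewrite -NirrE -[RHS]card_ord.
by apply: eq_card => i; rewrite !inE mod_IirrE ?cfker_mod.
Qed.

End LinearCharacterSums.

(** * Degree and absolute values of an irreducible character that vanishes on [M :\: N] *)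

Section Degree.

Local Open Scope group_scope.
Local Open Scope ring_scope.

Variables (gT : finGroupType) (S M N TT : {group gT}) (i : Iirr S).
Local Notation phi := ('chi_i).

Hypotheses (nsMS : (M <| S)%g) (sNM : N \subset M) (sS'M : S^`(1)%g \subset M).
Hypothesis phiN : {in N, forall x, `|phi x| = phi 1%g}.
Hypothesis phi0 : {in M :\: N, forall x, phi x = 0}.
Hypotheses (sTS : TT \subset S) (defS : S \subset (TT * M)%g).
Hypothesis kerT : TT^`(1)%g \subset cfker phi.
Hypothesis coMN : coprime #|M : N| #|S : M|.

Let sMS : M \subset S. Proof. exact: normal_sub. Qed.

Let lin j : M \subset cfker 'chi[S]_j -> 'chi_j \is a linear_char.
Proof. by move=> sMk; rewrite lin_irr_der1 (subset_trans sS'M). Qed.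

Let twist_dot j : M \subset cfker 'chi[S]_j ->
  '['chi_j * phi, phi] = ('chi_j * phi == phi)%:R.
Proof.
move=> /lin lj; have /irrP[k ->] := mul_lin_irr lj (mem_irr i).
by rewrite cfdot_irr (inj_eq irr_inj).
Qed.

Let sum_sqr_M : \sum_(x in M) `|phi x| ^+ 2 = #|N|%:R * phi 1%g ^+ 2.
Proof.
rewrite (big_setID N) /= (setIidPr sNM) [X in _ + X]big1 ?addr0; last first.
  by move=> x Mx; rewrite phi0 // normr0 expr0n.
rewrite (eq_bigr (fun=> phi 1%g ^+ 2)) => [|x Nx]; last by rewrite phiN.
by rewrite sumr_const mulr_natl.
Qed.

(** The numbers ['['chi_j * phi, phi]] are the Fourier coefficients of |phi|^2 pushed down to
    [S / M]; this is the inversion formula at the coset of [g]. *)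
Let fourier g : g \in S ->
  \sum_(j | M \subset cfker 'chi[S]_j) ('chi_j g)^* * '['chi_j * phi, phi] =
  #|M|%:R^-1 * \sum_(x in M) `|phi (g * x)%g| ^+ 2.
Proof.
move=> Sg.
have -> : \sum_(x in M) `|phi (g * x)%g| ^+ 2 =
    \sum_(x in S | (g^-1 * x)%g \in M) `|phi x| ^+ 2.
  rewrite [RHS](reindex_inj (mulgI g)) /=; apply: eq_big => [x|//].
  by rewrite mulKg groupMl // andbC; case Mx: (x \in M) => //=; rewrite (subsetP sMS).
transitivity (#|S|%:R^-1 * \sum_(x in S) `|phi x| ^+ 2 *
    \sum_(j | M \subset cfker 'chi[S]_j) 'chi_j (g^-1 * x)%g).
  under eq_bigr do rewrite cfdotE mulrCA.
  rewrite -mulr_sumr; congr (_ * _).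
  under eq_bigr do rewrite mulr_sumr.
  rewrite exchange_big /=; apply: eq_bigr => x Sx; rewrite mulr_sumr.
  apply: eq_bigr => j /lin lj.
  by rewrite cfunE lin_charM ?groupV // lin_charV_conj // normCK; ring.
rewrite (eq_bigr (fun x => `|phi x| ^+ 2 *
    if (g^-1 * x)%g \in M then #|S : M|%:R else 0)); last first.
  by move=> x Sx; rewrite sum_lin_char_quo // groupM ?groupV.
rewrite (bigID (fun x => (g^-1 * x)%g \in M)) /= [X in _ + X]big1 ?addr0; last first.
  by move=> x /andP[_ /negbTE->]; rewrite mulr0.
rewrite (eq_bigr (fun x => `|phi x| ^+ 2 * #|S : M|%:R)) => [|x /andP[_ ->]] //.
rewrite -mulr_suml mulrCA [RHS]mulrC; congr (_ * _).
rewrite -(Lagrange sMS) natrM invfM -mulrA mulVf ?mulr1 //.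
by rewrite pnatr_eq0 -lt0n indexg_gt0.
Qed.

Let supp := [set x in S | phi x != 0].
(** A twist by a character of [S / M] fixes [phi] exactly when that character is trivial on the
    support of [phi], hence on [M']; by duality there are [|S : M'|] such twists. *)
Let M' := <<M :|: supp>>%G.

Let sM'S : M' \subset S.
Proof.
by rewrite gen_subG subUset sMS; apply/subsetP => x; rewrite inE => /andP[].
Qed.

Let sMM' : M \subset M'.
Proof. exact: subset_trans (subsetUl _ _) (subset_gen _). Qed.

Let nsM'S : (M' <| S)%g.
Proof. by apply: sub_der1_normal sM'S; apply: subset_trans sS'M sMM'. Qed.

Let phi_off x : x \notin M' -> phi x = 0.
Proof.
apply: contraNeq => nz; apply: mem_gen; rewrite inE /supp inE nz andbT orbC.
by case Sx: (x \in S) => //; rewrite cfun0 ?Sx ?eqxx in nz.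
Qed.

Let twist_fix j : M \subset cfker 'chi[S]_j ->
  ('chi_j * phi == phi) = (M' \subset cfker 'chi_j).
Proof.
move=> sMk; apply/eqP/idP => [fix_j | sM'k].
  rewrite gen_subG subUset sMk; apply/subsetP => x /setIdP[Sx nz].
  rewrite /= cfkerEirr inE (lin_char1 (lin sMk)); apply/eqP/(mulIf nz).
  by rewrite mul1r -[in RHS]fix_j cfunE.
apply/cfun_inP => x Sx; rewrite cfunE.
have [M'x|/phi_off->] := boolP (x \in M'); last by rewrite mulr0.
by rewrite cfker1 ?(subsetP sM'k) // lin_char1 ?mul1r // lin.
Qed.

Let E := #|S : M'|.

(** The Fourier identity at [1]: its left side counts the fixing twists, its right side is
    [|N| phi(1)^2 / |M|]. *)
Let degE : phi 1%g ^+ 2 = (E * #|M : N|)%:R.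
Proof.
have := fourier (group1 S).
rewrite (eq_bigr (fun j => (M' \subset cfker 'chi[S]_j)%:R)); last first.
  by move=> j sMk; rewrite (lin_char1 (lin sMk)) conjC1 mul1r twist_dot ?twist_fix.
under [in RHS]eq_bigr do rewrite mul1g.
rewrite sum_sqr_M -natr_sum -big_mkcondr /= sum1dep_card.
have -> : #|[set j | (M \subset cfker 'chi[S]_j) && (M' \subset cfker 'chi_j)]| = E.
  rewrite /E -card_irr_ker ?(subset_trans sS'M) //; apply: eq_card => j.
  by rewrite !inE andb_idl // => /(subset_trans sMM').
rewrite -(Lagrange sNM) !natrM => ->.
have [nzN nzI] : #|N|%:R != 0 :> algC /\ #|M : N|%:R != 0 :> algC.
  by rewrite !pnatr_eq0 -!lt0n cardG_gt0 indexg_gt0.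
by field; rewrite nzN nzI.
Qed.

Let D := (TT :&: M')%G.

Let indexTD : #|TT : D| = E.
Proof.
have defTM : (TT * M' = S)%g.
  apply/eqP; rewrite eqEsubset mul_subG //=.
  by rewrite (subset_trans defS) // mulgS.
apply/eqP; rewrite indexgI -(eqn_pmul2r (cardG_gt0 M')) LagrangeMr defTM mulnC.
by rewrite Lagrange.
Qed.

Let E_gt0 : E%:R != 0 :> algC.
Proof. by rewrite pnatr_eq0 -lt0n indexg_gt0. Qed.

(** On [TT] the character [phi] vanishes outside [D], so both inner products are the same sum,
    divided by [|D|] and by [|TT|]. *)
Let dot_D (mu : 'CF(TT)) : '['Res[D] phi, 'Res[D] mu] = E%:R * '['Res[TT] phi, mu].
Proof.
have sDT : D \subset TT by apply: subsetIl.
have sDS := subset_trans sDT sTS.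
rewrite !cfdotE [in RHS](big_setID D) /= (setIidPr sDT) [X in _ + X]big1 ?addr0; last first.
  move=> x /setDP[Tx]; rewrite inE Tx /= => /phi_off phix.
  by rewrite cfResE // phix mul0r.
rewrite -(Lagrange sDT) indexTD natrM invfM mulrA mulrCA mulfV // mulr1.
congr (_ * _); apply: eq_bigr => x Dx.
by rewrite !cfResE // (subsetP sDT).
Qed.

(** On [TT] the character [phi] is a sum of linear characters, so each constituent of its
    restriction to [D] is the restriction of one of them; by [dot_D] its multiplicity there is a
    multiple of [E]. *)
Let dvd_deg : exists k : nat, phi 1%g = (E * k)%:R.
Proof.
suff /natrP[k Dk] : phi 1%g / E%:R \is a Num.nat.
  by exists k; rewrite natrM -Dk mulrC divfK.
have sDT : D \subset TT by apply: subsetIl.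
have sDS := subset_trans sDT sTS.
have NphiT : 'Res[TT] phi \is a character by rewrite cfRes_char ?irr_char.
have -> : phi 1%g = 'Res[D] phi 1%g by rewrite cfRes1.
rewrite ['Res[D] _]cfun_sum_constt sum_cfunE mulr_suml rpred_sum // => w.
rewrite irr_consttE => nzw.
have linT mu : mu \in irr_constt ('Res[TT] phi) -> 'chi_mu \is a linear_char.
  move=> Cmu; rewrite lin_irr_der1; apply: subset_trans (cfker_constt NphiT Cmu).
  rewrite cfker_Res ?irr_char // subsetI kerT andbT.
  exact: der_sub.
have [mu Cmu nzmu] : exists2 mu, mu \in irr_constt ('Res[TT] phi) &
    '['Res[D] 'chi_mu, 'chi_w] != 0.
  apply/exists_inP; apply: contraR nzw => /exists_inPn Hmu.
  rewrite -(cfResRes _ sDT sTS) ['Res[TT] _]cfun_sum_constt linear_sum /= cfdot_suml.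
  rewrite big1 // => mu Cmu; rewrite linearZ /= cfdotZl.
  by have /negPn/eqP-> := Hmu mu Cmu; rewrite mulr0.
have lmu := cfRes_lin_char D (linT mu Cmu).
have Dw : 'chi_w = 'Res[D] 'chi_mu.
  have /irrP[w' Dw'] := lin_char_irr lmu.
  by move: nzmu; rewrite Dw' cfdot_irr pnatr_eq0 eqb0 negbK => /eqP->.
rewrite cfunE Dw dot_D (lin_char1 lmu) mulr1 mulrAC mulfV // mul1r.
exact: Cnat_cfdot_char_irr.
Qed.

(** Putting [phi 1 = E k] into [degE] gives [E k^2 = |M : N|], so [E] divides two coprime
    indices. *)
Let E1 : E = 1%N.
Proof.
have [k Dk] := dvd_deg.
have := degE; rewrite Dk -natrX => /eqP; rewrite eqr_nat expnMn => /eqP.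
have E0 : (0 < E)%N by rewrite indexg_gt0.
rewrite -mulnn -mulnA => /eqP; rewrite eqn_pmul2l // => /eqP dn.
have dvE : (E %| gcdn #|M : N| #|S : M|)%N.
  rewrite dvdn_gcd -dn dvdn_mulr //= /E.
  by rewrite -(Lagrange_index sM'S sMM') dvdn_mulr.
by move: dvE; rewrite (eqP coMN) dvdn1 => /eqP.
Qed.

Lemma irr_degree_sqr : phi 1%g ^+ 2 = #|M : N|%:R.
Proof. by rewrite degE E1 mul1n. Qed.

(** Since only the trivial twist fixes [phi], a single term survives in [fourier], whatever [g]
    is. *)
Lemma sum_sqr_coset g : g \in S ->
  \sum_(x in M) `|phi (g * x)%g| ^+ 2 = #|M|%:R.
Proof.
move=> Sg; have := fourier Sg; rewrite (bigD1 0) /=; last by rewrite cfker_irr0.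
rewrite big1 => [|j /andP[sMk nz_j]]; last first.
  rewrite twist_dot // twist_fix //.
  have -> : M' = S by apply/val_inj/eqP; rewrite eqEsubset sM'S -indexg_eq1; apply/eqP/E1.
  by rewrite subGcfker (negbTE nz_j) mulr0.
rewrite addr0 irr0 mul1r cfnorm_irr cfun1E Sg conjC1 mul1r => e1.
move/(congr1 ( *%R #|M|%:R)): e1; rewrite mulr1 mulVKf //.
by rewrite pnatr_eq0 -lt0n cardG_gt0.
Qed.

Hypothesis nsNS : N <| S.
Hypothesis kerN : {in N & S, forall n g, [~ n, g] \in cfker phi}.
Hypothesis frob : {in S :\: M & M, forall g x, [~ g, x] \in N -> x \in N}.

(** By [frob] the centralizer of [g] in [M / N] is trivial, so the conjugates of [g] under [M] meet
    every coset of [N] in [g M]. As [N] acts by scalars of absolute value 1, |phi| is constant on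
    [g M], where its mean square is 1. *)
Lemma norm_irr_off g : g \in S :\: M -> `|phi g| = 1.
Proof.
case/setDP=> Sg nMg; have [sNS nNS] := andP nsNS.
have conjgM y : y \in M -> `|phi (g * y)%g| = `|phi g|.
  move=> My; have [x Mx [n Nn ->]] : exists2 x, x \in M &
      exists2 n, n \in N & (g * y = n * g ^ x)%g.
    have nNM := subset_trans sMS nNS.
    have Ng := subsetP nNS g Sg.
    have cls : coset N g ^: (M / N) = (coset N g *: (M / N))%g.
      apply/eqP; rewrite eqEcard; apply/andP; split.
        apply/subsetP => _ /imsetP[_ /morphimP[x Nx Mx ->] ->].
        rewrite mem_lcoset -commgEl -morphR // mem_quotient // commgEr.
        by rewrite groupM // memJ_norm ?groupV // (subsetP (normal_norm nsMS)).
      rewrite card_lcoset -index_cent1.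
      have -> : 'C_(M / N)[coset N g] = 1%G :> {set _}.
        apply/trivgP/subsetP => _ /setIP[/morphimP[x Nx Mx ->] /cent1P cx].
        rewrite inE; apply/eqP/coset_id; apply: (@frob g) => //.
          by rewrite inE nMg.
        apply: coset_idr; first by rewrite groupR.
        by rewrite morphR //; apply/eqP/commgP/commute_sym.
      by rewrite indexg1.
    have Ny := subsetP nNM y My.
    have : coset N (g * y)%g \in coset N g ^: (M / N).
      by rewrite cls morphM // mem_lcoset mulKg mem_quotient.
    case/imsetP=> _ /morphimP[x Nx Mx ->].
    rewrite -morphJ // => /rcoset_kercosetP.
    by case/(_ (groupM Ng Ny) (groupJ Ng Nx))/rcosetP => n Nn ->; exists x => //; exists n.
  have Sx := subsetP sMS x Mx.
  rewrite (irr_center_norm (subsetP sNS n Nn) (fun h Sh => kerN Nn Sh)).1 ?groupJ //.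
  by rewrite cfunJ.
have := sum_sqr_coset Sg.
rewrite (eq_bigr (fun=> `|phi g| ^+ 2)) => [|x Mx]; last by rewrite conjgM.
rewrite sumr_const -[LHS]mulr_natl -[RHS]mulr1 => /mulfI.
rewrite pnatr_eq0 -lt0n cardG_gt0 => /(_ isT)/eqP.
by rewrite sqrp_eq1 // => /eqP.
Qed.

End Degree.

(** * Two multiplicity bounds for products of characters *)

Section MultiplicityOne.

Local Open Scope group_scope.
Local Open Scope ring_scope.

Variable gT : finGroupType.

Lemma char_dot_lt2_le1 (G : {group gT}) (j : Iirr G) (chi : 'CF(G)) :
  chi \is a character -> '['chi_j, chi] < 2 -> '['chi_j, chi] <= 1.
Proof.
move=> Nchi; rewrite cfdotC; case/natrP: (Cnat_cfdot_char_irr j Nchi) => m ->.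
by rewrite conjC_nat ltr_nat lern1.
Qed.

Lemma dot_lin_char_le1 (G : {group gT}) (j : Iirr G) (xi : 'CF(G)) :
  xi \is a linear_char -> '['chi_j, xi] <= 1.
Proof. by case/lin_char_irr/irrP=> k ->; rewrite cfdot_irr lern1 leq_b1. Qed.

(** Only [N] and [S :\: M] contribute. The first part is at most [|N| f^3 = |M| f <= |S|], the
    second is [|S| - |M|], and a natural number below 2 is at most 1. *)
Lemma multiplicity_torus (S M N : {group gT}) (f : algC) (i1 i2 j : Iirr S) :
    M \subset S -> N \subset M ->
    f ^+ 2 = #|M : N|%:R -> 0 <= f <= #|S : M|%:R ->
    (forall k, k \in [:: i1; i2; j] ->
      [/\ 'chi_k 1%g = f, {in M :\: N, forall x, 'chi_k x = 0} &
          {in S :\: M, forall x, `|'chi_k x| = 1}]) ->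
  '['chi_j, 'chi_i1 * 'chi_i2] <= 1.
Proof.
move=> sMS sNM f2 /andP[f0 lef] Hk.
have [|f_1 z1 o1] := Hk i1; first by rewrite !inE eqxx.
have [|f_2 z2 o2] := Hk i2; first by rewrite !inE eqxx orbT.
have [|f_j zj oj] := Hk j; first by rewrite !inE eqxx !orbT.
apply: char_dot_lt2_le1; first by rewrite rpredM ?irr_char.
set d := '[_, _]; have d_ge0 : 0 <= d.
  rewrite /d cfdotC; case/natrP: (Cnat_cfdot_char_irr j (rpredM (irr_char i1) (irr_char i2))).
  by move=> m ->; rewrite conjC_nat ler0n.
have S0 : (0 : algC) < #|S|%:R by rewrite ltr0n cardG_gt0.
rewrite -(ger0_norm d_ge0) /d cfdotE normrM ger0_norm ?invr_ge0 ?ler0n //.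
rewrite mulrC ltr_pdivrMr //.
have le_f k x : k \in [:: i1; i2; j] -> `|'chi_k x| <= f.
  by move=> /Hk[<- _ _]; rewrite char1_ge_norm ?irr_char.
apply: le_lt_trans (ler_norm_sum _ _ _) _.
rewrite (big_setID M) /= (setIidPr sMS) (big_setID N) /= (setIidPr sNM).
rewrite [X in _ + X + _]big1 ?addr0; last first.
  by move=> x Mx; rewrite zj ?mul0r ?normr0.
have le1 : \sum_(x in N) `|'chi_j x * (('chi_i1 * 'chi_i2) x)^*| <= #|N|%:R * f ^+ 3.
  rewrite mulr_natl -sumr_const; apply: ler_sum => x Nx.
  rewrite cfunE normrM norm_conjC normrM exprS expr2.
  by rewrite !ler_pM ?mulr_ge0 ?normr_ge0 ?le_f // !inE eqxx ?orbT.
have le2 : \sum_(x in S :\: M) `|'chi_j x * (('chi_i1 * 'chi_i2) x)^*| =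
    #|S|%:R - #|M|%:R.
  rewrite (eq_bigr (fun=> 1)) ?sumr_const.
    by rewrite cardsD (setIidPr sMS) natrB // subset_leq_card.
  by move=> x Sx; rewrite cfunE normrM norm_conjC normrM o1 ?o2 ?oj // !mulr1.
rewrite le2; apply: le_lt_trans (lerD le1 (lexx _)) _.
have cM : #|M|%:R = #|N|%:R * f ^+ 2 :> algC by rewrite f2 -natrM Lagrange.
have M0 : (0 : algC) < #|M|%:R by rewrite ltr0n cardG_gt0.
have le3 : #|N|%:R * f ^+ 3 <= #|S|%:R.
  rewrite exprSr mulrA -cM -(Lagrange sMS) natrM ler_wpM2l ?ler0n //.
rewrite addrA [X in _ < X]mulr_natl mulr2n ltrBlDr.
by apply: le_lt_trans (lerD le3 (lexx _)) _; rewrite ltrDl.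
Qed.

Lemma der1_joing_sub (K Q1 Q2 : {group gT}) :
    Q1 \subset 'N(K) -> Q2 \subset 'N(K) -> Q2 \subset 'N(Q1) ->
    {in Q1 &, forall x y, [~ x, y] \in K} ->
    {in Q2 &, forall x y, [~ x, y] \in K} ->
    {in Q1 & Q2, forall x y, [~ x, y] \in K} ->
  (Q1 <*> Q2)^`(1)%g \subset K.
Proof.
move=> nK1 nK2 nQ c11 c22 c12.
have commK (A C : {group gT}) :
    {in A & C, forall x y, [~ x, y] \in K} -> [~: A, C] \subset K.
  by move=> cAC; rewrite gen_subG; apply/subsetP=> _ /imset2P[x y Ax Cy ->]; apply: cAC.
apply: der1_min; first by rewrite join_subG nK1.
rewrite /= norm_joinEr // quotientMl // abelianM /abelian !quotient_cents2 //.
rewrite !commK //= => x y Qx Qy.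
by rewrite -groupV invg_comm; apply: c12.
Qed.

(** The multiplicity of ['chi_j] is at most that of a constituent [mu] of its restriction to
    [B = Q1 <*> Q2]. Commutators of [B] act trivially in both factors, so [mu] is linear; the
    product vanishes off [Q = Q1 :&: Q2], is bounded by [q^2], and [|B| = |Q| |Q1 : Q| |Q2 : Q|] is
    at least [q^2 |Q|]. *)
Lemma multiplicity_heisenberg (S1 S2 Q1 Q2 : {group gT}) (q : nat) (i1 : Iirr S1)
    (i2 : Iirr S2) (j : Iirr (S1 :&: S2)) :
    (0 < q)%N ->
    Q1 \subset S1 :&: S2 -> Q2 \subset S1 :&: S2 ->
    Q2 \subset 'N(Q1) ->
    {in Q1 & S1, forall n g, [~ n, g] \in cfker 'chi_i1} ->
    {in Q2 & S2, forall n g, [~ n, g] \in cfker 'chi_i2} ->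
    {in Q2 &, forall x y, [~ x, y] \in cfker 'chi_i1} ->
    {in Q1 &, forall x y, [~ x, y] \in cfker 'chi_i2} ->
    {in (Q1 <*> Q2) :\: Q1, forall x, 'chi_i1 x = 0} ->
    {in (Q1 <*> Q2) :\: Q2, forall x, 'chi_i2 x = 0} ->
    'chi_i1 1%g <= q%:R -> 'chi_i2 1%g <= q%:R ->
    (q <= #|Q1 : Q1 :&: Q2|)%N -> (q <= #|Q2 : Q1 :&: Q2|)%N ->
  '['chi_j, 'Res[S1 :&: S2] 'chi_i1 * 'Res[S1 :&: S2] 'chi_i2] <= 1.
Proof.
move=> q0 sQ1 sQ2 nQ ker1 ker2 ker12 ker21 z1 z2 le1 le2 ix1 ix2.
set chi := _ * _.
have Nchi : chi \is a character by rewrite rpredM ?cfRes_char ?irr_char.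
have [/eqP d0|nzd] := boolP ('['chi_j, chi] == 0); first by rewrite d0 ler01.
have Cj : j \in irr_constt chi by rewrite irr_consttE cfdotC conjC_eq0.
pose B := (Q1 <*> Q2)%G; pose Q := (Q1 :&: Q2)%G.
have sBS : B \subset S1 :&: S2 by rewrite join_subG sQ1.
have defB : B = (Q1 * Q2)%g :> {set _} by rewrite /= norm_joinEr.
have sS1 : S1 :&: S2 \subset S1 by apply: subsetIl.
have sS2 : S1 :&: S2 \subset S2 by apply: subsetIr.
have chiE x : x \in B -> 'Res[B] chi x = 'chi_i1 x * 'chi_i2 x.
  by move=> Bx; rewrite cfResE // cfunE !cfResE // (subsetP sBS).
have NchiB : 'Res[B] chi \is a character by rewrite cfRes_char.
have kerB : B^`(1)%g \subset cfker ('Res[B] chi).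
  have sQ1S1 := subset_trans sQ1 sS1; have sQ2S1 := subset_trans sQ2 sS1.
  have sQ1S2 := subset_trans sQ1 sS2; have sQ2S2 := subset_trans sQ2 sS2.
  have k1 : B^`(1)%g \subset cfker 'chi_i1.
    apply: der1_joing_sub; rewrite ?(subset_trans _ (cfker_norm _)) //.
      by move=> x y Qx Qy; apply: ker1 => //; apply: (subsetP sQ1S1).
    by move=> x y Qx Qy; apply: ker1 => //; apply: (subsetP sQ2S1).
  have k2 : B^`(1)%g \subset cfker 'chi_i2.
    apply: der1_joing_sub; rewrite ?(subset_trans _ (cfker_norm _)) //.
      by move=> x y Qx Qy; apply: ker2 => //; apply: (subsetP sQ2S2).
    move=> x y Qx Qy; rewrite -groupV invg_comm; apply: ker2 => //.
    exact: (subsetP sQ1S2).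
  rewrite cfker_Res // subsetI der_sub.
  apply: subset_trans (cfker_mul _ _); rewrite !cfker_Res ?irr_char //.
  rewrite !subsetI k1 k2 !andbT.
  by rewrite !(subset_trans (der_sub 1 B)) // (subset_trans sBS).
have [mu Cmu] := constt_cfRes_irr B j.
have Cmu' : mu \in irr_constt ('Res[B] chi) by apply: constt_Res_trans Cmu.
have lmu : 'chi_mu \is a linear_char.
  by rewrite lin_irr_der1 (subset_trans kerB) // cfker_constt.
have le_mult : '['chi_j, chi] <= '['Res[B] chi, 'chi_mu].
  have -> : 'Res[B] chi = \sum_k '[chi, 'chi_k] *: 'Res[B] 'chi_k.
    rewrite {1}[chi]cfun_sum_cfdot linear_sum /=.
    by apply: eq_bigr => k _; rewrite linearZ.
  rewrite (cfdotC 'chi_j) cfdot_suml (bigD1 j) //= cfdotZl.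
  case/natrP: (Cnat_cfdot_char_irr j Nchi) => m ->; rewrite conjC_nat.
  case/natrP: (Cnat_cfdot_char_irr mu (cfRes_char B (irr_char j))) => r Dr.
  move: Cmu; rewrite irr_consttE Dr pnatr_eq0 -lt0n => r0.
  rewrite -[leLHS]addr0; apply: lerD; first by rewrite -natrM ler_nat leq_pmulr.
  apply: sumr_ge0 => k _; rewrite cfdotZl mulr_ge0 ?natr_ge0 ?Cnat_cfdot_char_irr //.
  by rewrite cfRes_char ?irr_char.
apply: le_trans le_mult _.
have d_ge0 : 0 <= '['Res[B] chi, 'chi_mu] by rewrite natr_ge0 ?Cnat_cfdot_char_irr.
rewrite -(ger0_norm d_ge0) cfdotE normrM ger0_norm ?invr_ge0 ?ler0n //.
have B0 : (0 : algC) < #|B|%:R by rewrite ltr0n cardG_gt0.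
rewrite mulrC ler_pdivrMr // mul1r.
have sQB : Q \subset B by rewrite /= subIset // joing_subl.
apply: le_trans (ler_norm_sum _ _ _) _.
rewrite (big_setID Q) /= (setIidPr sQB) [X in _ + X]big1 ?addr0; last first.
  move=> x /setDP[Bx]; rewrite inE negb_and chiE // => /orP[nQ1|nQ2].
    by rewrite z1 ?mul0r ?normr0 // inE nQ1.
  by rewrite z2 ?mulr0 ?mul0r ?normr0 // inE nQ2.
apply: (@le_trans _ _ (\sum_(x in Q) q%:R ^+ 2)).
  apply: ler_sum => x Qx; have Bx := subsetP sQB x Qx.
  rewrite normrM norm_conjC (normC_lin_char lmu Bx) mulr1 chiE // normrM expr2.
  by rewrite ler_pM ?normr_ge0 // (le_trans (char1_ge_norm _ (irr_char _))).
rewrite sumr_const -[leLHS]mulr_natl -natrX -natrM ler_nat defB.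
rewrite -(leq_pmul2r (cardG_gt0 Q)) /= -mul_cardG.
rewrite -(Lagrange (subsetIl Q1 Q2)) -(Lagrange (subsetIr Q1 Q2)).
rewrite mulnAC [X in (_ <= X)%N]mulnACA -mulnn.
by rewrite leq_mul // leq_mul.
Qed.

End MultiplicityOne.

(** * The stabilizer of a character of the congruence subgroup *)

Lemma leq_card_factor (X Y Z : finType) (D : {pred X}) (f : X -> Y) (h : X -> Z) :
  {in D &, forall x y, h x = h y -> f x = f y} -> (#|f @: D| <= #|h @: D|)%N.
Proof.
move=> H; case: (pickP D) => [x0 Dx0|D0]; last first.
  by rewrite (leq_trans (leq_imset_card _ _)) // (eq_card0 D0).
(* [k] applies [f] to some preimage under [h]; the choice does not matter since [f] is constant on
   the fibres of [h] in [D]. *)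
pose k w := f (odflt x0 [pick x in D | h x == w]).
apply: leq_trans (leq_imset_card k (h @: D)); apply/subset_leq_card/subsetP.
move=> _ /imsetP[x Dx ->]; apply/imsetP; exists (h x); first exact: imset_f.
rewrite /k; case: pickP => [y /andP[Dy /eqP hy]|/(_ x)] /=; first by apply: H.
by rewrite Dx eqxx.
Qed.

Lemma cauchy_quotient (gT : finGroupType) (H K : {group gT}) r : (H <| K)%g -> prime r ->
  (r %| #|K : H|%g)%N -> exists x, [/\ x \in K, x \notin H & (x ^+ r)%g \in H].
Proof.
move=> nsHK pr; have [sHK nHK] := andP nsHK; rewrite -card_quotient // => dvr.
have [_ /morphimP[x Nx Kx ->] ox] := Cauchy pr dvr; exists x; split=> //.
  apply: contraTN (prime_gt1 pr) => Hx.
  by rewrite -ox /= coset_id // order1.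
by apply: coset_idr; rewrite ?groupX // morphX // -ox expg_order.
Qed.

Section CongruenceCentralizer.

Variables (T : finComUnitRingType) (P : T) (G : {group {'GL_2[T]}}).

Definition cent_mod k (A : 'M[T]_2) : {set {'GL_2[T]}} :=
  [set g in G | mxcong P k (mG g *m A) (A *m mG g)].

Lemma cent_modP k A g : reflect (g \in G /\ cm P k (mG g) A) (g \in cent_mod k A).
Proof.
by rewrite inE; apply: (iffP andP) => -[Gg /mxcongP].
Qed.

Fact cent_mod_group_set k A : group_set (cent_mod k A).
Proof.
apply/group_setP; split=> [|g h /cent_modP[Gg cg] /cent_modP[Gh ch]].
  by apply/cent_modP; rewrite group1 mG_1; split=> //; apply/cm_sym/cm_scalar.
apply/cent_modP; rewrite groupM // mG_M; split=> //.
by apply/cm_sym/cmM; apply: cm_sym.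
Qed.
Canonical cent_mod_group k A := Group (cent_mod_group_set k A).

Definition scalar_mod : {set {'GL_2[T]}} :=
  [set g in G | [exists c : T, mxcong P 1 (mG g) c%:M]].

Lemma scalar_modP g :
  reflect (g \in G /\ exists c, dvm P 1 (mG g - c%:M)) (g \in scalar_mod).
Proof.
rewrite inE; apply: (iffP andP) => -[Gg].
  by case/existsP=> c /mxcongP; split=> //; exists c.
by case=> c h; split=> //; apply/existsP; exists c; apply/mxcongP.
Qed.

Fact scalar_mod_group_set : group_set scalar_mod.
Proof.
apply/group_setP; split=> [|g h /scalar_modP[Gg [c cg]] /scalar_modP[Gh [d dh]]].
  apply/scalar_modP; rewrite group1 mG_1; split=> //.
  by exists 1; rewrite subrr; apply: dvm0.
apply/scalar_modP; rewrite groupM // mG_M; split=> //; exists (c * d).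
have -> : mG g *m mG h - (c * d)%:M = (mG g - c%:M) *m mG h + c%:M *m (mG h - d%:M).
  by rewrite mulmxBl mulmxBr scalar_mxM addrA subrK.
by apply: dvmD; [apply: dvmMr | apply: dvmMl].
Qed.
Canonical scalar_mod_group := Group scalar_mod_group_set.

Lemma scalar_mod_cm g X : g \in scalar_mod -> cm P 1 (mG g) X.
Proof.
case/scalar_modP=> _ [c h]; rewrite -[mG g](subrK c%:M).
by apply/cm_sym/cmD; [apply: cm_dv | apply: cm_scalar].
Qed.

Lemma cent_modS j k A : (j <= k)%N -> cent_mod k A \subset cent_mod j A.
Proof.
move=> jk; apply/subsetP=> g /cent_modP[Gg cg]; apply/cent_modP; split=> //.
exact: cmW cg.
Qed.

End CongruenceCentralizer.

Section Stabilizer.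

Variables (R T : finComUnitRingType) (iota : {rmorphism R -> T}) (p : R).
Variables (eps : T) (e : R) (psi : T -> algC) (G : {group {'GL_2[T]}}) (l : nat).
Hypothesis md : matrix_datum iota p eps e psi G l.
Hypothesis psi0 : psi 0 = 1.

Local Notation P := (iota p).
Local Notation lie := (lie_mx iota eps).
Implicit Types (g h n x : {'GL_2[T]}) (X Y : 'M[T]_2).

Variables (z : T) (a0 b0 c0 : R) (A A0 : 'M[T]_2).
Hypotheses (DA0 : A0 = lie a0 b0 c0) (DA : A = z%:M + A0).
Local Notation del := (a0 ^+ 2 + e * b0 * c0).
Hypothesis udel : del \is a GRing.unit.

Variables l1 l2 : nat.
Hypotheses (l12 : (l1 + l2)%N = l) (le12 : (l1 <= l2)%N) (l1_gt0 : (0 < l1)%N).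

Let l_gt0 : (0 < l)%N. Proof. by rewrite -l12 addn_gt0 l1_gt0. Qed.
Let l2_gt0 : (0 < l2)%N. Proof. exact: leq_trans le12. Qed.
Let trA0 : \tr A0 = 0. Proof. by rewrite DA0 lie_tr. Qed.
Let A0sq : A0 *m A0 = (iota del)%:M. Proof. by rewrite DA0 (lie_sqr md). Qed.
Let udelT : iota del \is a GRing.unit. Proof. by rewrite rmorph_unit. Qed.
Let u2 := two_unit md.

Lemma cm_A k X : cm P k X A0 -> cm P k X A.
Proof. by rewrite DA => cX; apply: cmD => //; apply: cm_scalar. Qed.

Lemma cm_decomp k X : cm P k X A0 -> exists u E,
  X = u%:M + (\tr (X *m A0) / (2 * iota del)) *: A0 + P ^+ k *: E.
Proof.
move=> [E DE]; exists (\tr X / 2), ((2 * iota del)^-1 *: (E *m A0)).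
rewrite {1}(traceless_decomp trA0 A0sq u2 udelT X) DE; congr (_ + _).
by rewrite -scalemxAl !scalerA mulrC.
Qed.

Lemma decomp_cm k X u b E : X = u%:M + b *: A0 + P ^+ k *: E -> cm P k X A0.
Proof.
move=> ->; apply/cm_sym/cmD; last by apply/cm_dv/dvm_exp.
by apply: cmD; [apply: cm_scalar | apply/cmZr/cm_refl].
Qed.

(** The coefficient of [A0] is [\tr (g A0)] up to a unit; for [g] scalar modulo [P] it is divisible
    by [P] because [A0] is traceless. *)
Lemma scalar_decomp k g : g \in scalar_mod P G -> cm P k (mG g) A0 ->
  exists u b E, dv P 1 b /\ mG g = u%:M + b *: A0 + P ^+ k *: E.
Proof.
case/scalar_modP=> _ [c h] /cm_decomp[u [E Dg]].
exists u, (\tr (mG g *m A0) / (2 * iota del)), E; split=> //; apply: dvMr.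
rewrite -[mG g](subrK c%:M) mulmxDl linearD /= mul_scalar_mx linearZ /= trA0.
by rewrite mulr0 addr0; apply/dvm_tr/dvmMr.
Qed.

Lemma conj_diff_lie g : g \in G ->
  exists a b c, mG g *m A0 *m mG g^-1%g - A0 = lie a b c.
Proof.
rewrite DA0 => Gg; have [a [b [c ->]]] := md_Ad md a0 b0 c0 Gg.
by exists (a - a0), (b - b0), (c - c0); rewrite -lieB.
Qed.

Lemma cm_conj k g X :
  cm P k (mG g) X <-> dvm P k (mG g *m X *m mG g^-1%g - X).
Proof.
have -> : mG g *m X *m mG g^-1%g - X = (mG g *m X - X *m mG g) *m mG g^-1%g.
  by rewrite mulmxBl -[X *m _ *m _]mulmxA mG_V mulmx1.
by split; [apply: dvmMr | apply/dvm_divr/mG_Vl].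
Qed.

Lemma kersetP k x :
  reflect (x \in G /\ dvm P k (mG x - 1%:M)) (x \in kerset G P k).
Proof. by rewrite inE; apply: (iffP andP) => -[Gx /mxcongP]. Qed.

Lemma trA_conj X Y Z : \tr (A *m (X *m Y *m Z)) = \tr (Z *m A *m X *m Y).
Proof. by rewrite mulmxA mxtrace_mulC !mulmxA. Qed.

(** The quotient of [psi_A (x ^ g)] by [psi_A x] is [psi] of the trace of [(g A g^-1 - A) (x - 1)].
    As [l <= l2 + l2], Cayley elements of level [l2] realize every [1 + P^l2 X] exactly, so
    nondegeneracy puts [g A g^-1 - A] into the multiples of [P ^+ (l - l2)]. *)
Lemma stab_cent : stab G P l2 psi A = cent_mod P G l1 A0.
Proof.
apply/setP=> g; apply/idP/idP=> [|/cent_modP[Gg cg]]; last first.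
  rewrite inE Gg; apply/forall_inP=> x /kersetP[Gx dx]; apply/eqP.
  rewrite /psiA; congr psi; apply/eqP; rewrite -subr_eq0; apply/eqP.
  have -> : GLval (x ^ g)%g - 1%:M = mG g^-1%g *m (mG x - 1%:M) *m mG g.
    by rewrite mulmxBr mulmxBl mulmx1 mG_Vl conjgE -mulmxA.
  rewrite trA_conj -linearB -mulmxBl /=.
  apply: (dv_l md); apply/dvm_tr; rewrite -l12; apply: dvmM => //.
  by apply/cm_conj/cm_A.
rewrite inE => /andP[Gg /forall_inP Hg]; apply/cent_modP; split=> //.
apply/cm_conj; have [a [b [c DC]]] := conj_diff_lie Gg; rewrite DC.
have -> : l1 = (l - l2)%N by rewrite -l12 addnK.
apply: (lie_nondeg md); first by rewrite -l12 leq_addl.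
move=> a' b' c'; have [y Gy dy] := cayley md a' b' c' l2_gt0.
have Dy : mG y - 1%:M = P ^+ l2 *: lie a' b' c'.
  apply/eqP; rewrite -subr_eq0; apply/eqP; apply: (dvm_ge md) dy.
  by rewrite -l12 leq_add2r.
have Ky : y \in kerset G P l2 by apply/kersetP; rewrite Dy; split=> //; apply: dvm_exp.
have /eqP := Hg y Ky; rewrite /psiA.
have -> : GLval (y ^ g)%g - 1%:M = mG g^-1%g *m (mG y - 1%:M) *m mG g.
  by rewrite mulmxBr mulmxBl mulmx1 mG_Vl conjgE -mulmxA.
rewrite trA_conj => /(psi_eq_diff md psi0); rewrite -linearB -mulmxBl /=.
have -> : mG g *m A *m mG g^-1%g - A = lie a b c.
  rewrite -DC DA mulmxDr mulmxDl scalar_mxC -[z%:M *m _ *m _]mulmxA mG_V mulmx1 opprD.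
  by rewrite addrACA subrr add0r.
by rewrite -/(mG y) Dy -scalemxAr linearZ.
Qed.

Lemma tr_conj_diff_dv g (H E : 'M[T]_2) : dvm P l2 E -> cm P l1 (mG g) H ->
  \tr (H *m (mG g^-1%g *m E *m mG g - E)) = 0.
Proof.
move=> dE cH.
rewrite mulmxBr linearB /= !mulmxA mxtrace_mulC !mulmxA -linearB -mulmxBl /=.
apply: (dv_l md); apply/dvm_tr; rewrite -l12; apply: dvmM => //.
exact/cm_conj.
Qed.

Lemma conj_decomp g (B0 X : 'M[T]_2) u b E : X = u%:M + b *: B0 + E ->
  mG g^-1%g *m X *m mG g - X =
  b *: (mG g^-1%g *m B0 *m mG g - B0) + (mG g^-1%g *m E *m mG g - E).
Proof.
move=> ->; rewrite !mulmxDr !mulmxDl !opprD scalar_mxC -[_%:M *m _ *m _]mulmxA.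
rewrite mG_Vl mulmx1 -scalemxAr -scalemxAl scalerBr.
by rewrite addrACA [X in X + _]addrACA subrr add0r.
Qed.

Lemma conj_diff_dv k g : cm P k (mG g) A0 ->
  dvm P k (mG g^-1%g *m A0 *m mG g - A0).
Proof.
move=> /cm_sym cg; rewrite -{2}[A0]mul1mx -(mG_Vl g) -!mulmxA -mulmxBr.
exact: dvmMl.
Qed.

(** Conjugation fixes the scalar [A0 ^ 2]. With [F] the difference, [(A0 + F)^2 = A0^2] gives
    [2 \tr (A0 F) = - \tr (F^2)], which doubles the order of divisibility. *)
Lemma conj_diff_tr g s : cm P s (mG g) A0 ->
  dv P (s + s) (\tr (A0 *m (mG g^-1%g *m A0 *m mG g - A0))).
Proof.
move=> cg; set F := _ - _; have dF : dvm P s F by apply: conj_diff_dv.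
have DF : mG g^-1%g *m A0 *m mG g = A0 + F by rewrite addrC subrK.
have sq : (A0 + F) *m (A0 + F) = A0 *m A0.
  rewrite -DF !mulmxA -[_ *m mG g *m mG g^-1%g]mulmxA mG_V mulmx1.
  rewrite -[_ *m A0 *m A0]mulmxA A0sq scalar_mxC -mulmxA mG_Vl mulmx1 //.
clear DF; clearbody F; move: sq.
rewrite mulmxDl !mulmxDr -addrA -[RHS]addr0 => /addrI/eqP.
rewrite addrA addr_eq0 => /eqP/(congr1 (@mxtrace _ _)) /=.
rewrite [in RHS]linearN /= linearD /= (mxtrace_mulC F) -mulr2n -mulr_natl => tr2.
apply: (dv_divl u2); rewrite tr2; apply/dvN/dvm_tr/dvmM => //.
Qed.

(** Both [n] and [A n^-1] are polynomials in [A0] modulo [P ^+ l2], so only a multiple of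
    [b \tr (A0 F)] survives, where [F = g^-1 A0 g - A0]. By [conj_diff_tr] it has order
    [r + s + s >= l2 + l1 = l]. The pair [(r, s)] is [(0, l2)] for commutators in [TT] and [(1, l1)]
    for those of [N] with [S]. *)
Lemma commutator_ker n g u b E r s :
    n \in G -> g \in G -> mG n = u%:M + b *: A0 + P ^+ l2 *: E ->
    dv P r b -> cm P s (mG g) A0 -> (l1 <= s)%N -> (l2 <= r + s)%N ->
  [~ n, g]%g \in kerset G P l2 /\ psiA psi A [~ n, g]%g = 1.
Proof.
move=> Gn Gg Dn db cg l1s l2rs.
have dc : dvm P l2 (mG [~ n, g]%g - 1%:M).
  rewrite mG_R (conj_decomp g Dn); apply: dvmMl; apply: dvmD.
    by apply: dvmW l2rs _; apply: dvmZ => //; apply: conj_diff_dv.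
  by apply: dvmB; [apply/dvmMr/dvmMl|]; apply: dvm_exp.
split; first by apply/kersetP; rewrite groupR.
rewrite /psiA -/(mG _) mG_R (conj_decomp g Dn) -psi0; congr psi.
set H := A *m mG n^-1%g.
have cnA : cm P l2 A0 (mG n) by apply/cm_sym/(decomp_cm Dn).
have cHA : cm P l2 H A0.
  apply/cm_sym/cmM; first exact/cm_A/cm_refl.
  exact: cmV (mG_V n) (mG_Vl n) cnA.
have cgn : cm P l2 (mG g) (mG n).
  rewrite Dn; apply: cmD; last by apply/cm_dv/dvm_exp.
  apply: cmD; first exact: cm_scalar.
  by apply: cmW l2rs _; apply: cmZ.
have cgH : cm P l1 (mG g) H.
  apply: cmM; first by apply: cmW l1s _; apply: cm_A.
  by apply: cmW le12 _; apply: cmV (mG_V n) (mG_Vl n) cgn.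
rewrite mulmxA -/H mulmxDr linearD /= tr_conj_diff_dv ?addr0 //; last exact: dvm_exp.
have [u' [E' DH]] := cm_decomp cHA; set v := _ / _ in DH.
set F := _ - A0; have dF : dvm P s F by apply: conj_diff_dv.
have trF : \tr F = 0.
  by rewrite /F linearB /= -mulmxA mxtrace_mulC -mulmxA mG_V mulmx1 subrr.
have trAF : dv P (s + s) (\tr (A0 *m F)) by apply: conj_diff_tr cg.
clearbody F v H; rewrite -scalemxAr linearZ /= DH !mulmxDl !linearD /= mul_scalar_mx linearZ /= trF.
rewrite mulr0 add0r -scalemxAl linearZ /=.
have -> : \tr (P ^+ l2 *: E' *m F) = 0.
  apply: (dv_l md); apply/dvm_tr; rewrite -l12 addnC.
  by apply: dvmM; [apply: dvm_exp | apply: dvmW dF].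
rewrite addr0 mulrCA; apply/(dv_ge md)/dvMl; last first.
  exact: dvM db trAF.
by rewrite -l12 addnC addnA leq_add.
Qed.

(** [B0] stands for the other matrix of the pair. Although [B0] need not commute with [A] modulo
    [P ^+ l1], [b *: B0] does: it differs from [x] by a scalar and a multiple of [P ^+ l2]. *)
Lemma commutator_ker_other (B0 : 'M[T]_2) x y u b E u' b' E' :
    x \in G -> y \in G ->
    mG x = u%:M + b *: B0 + P ^+ l2 *: E -> mG y = u'%:M + b' *: B0 + P ^+ l2 *: E' ->
    cm P l1 (mG x) A0 -> cm P l1 (mG y) A0 ->
  [~ x, y]%g \in kerset G P l2 /\ psiA psi A [~ x, y]%g = 1.
Proof.
move=> Gx Gy Dx Dy cx cy.
have cBB X v w : cm P l2 (v%:M + w *: B0 + P ^+ l2 *: X) B0.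
  apply/cm_sym/cmD; last exact/cm_dv/dvm_exp.
  by apply: cmD; [apply: cm_scalar | apply/cmZr/cm_refl].
have cxB : cm P l2 (mG x) B0 by rewrite Dx.
have cyB : cm P l2 (mG y) B0 by rewrite Dy.
have cyx : cm P l2 (mG y) (mG x).
  rewrite Dx; apply: cmD; last by apply/cm_dv/dvm_exp.
  by apply: cmD; [apply: cm_scalar | apply: cmZr].
have dc : dvm P l2 (mG [~ x, y]%g - 1%:M).
  rewrite mG_R; apply: dvmMl; rewrite -{2}[mG x]mul1mx -(mG_Vl y) -!mulmxA -mulmxBr.
  exact/dvmMl/cm_sym.
split; first by apply/kersetP; rewrite groupR.
set H := A *m mG x^-1%g.
have cyH : cm P l1 (mG y) H.
  apply: cmM; first exact: cm_A.
  by apply: cmW le12 _; apply: cmV (mG_V x) (mG_Vl x) cyx.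
rewrite /psiA -/(mG _) mG_R mulmxA -/H -psi0; congr psi.
rewrite (conj_decomp y Dx).
rewrite mulmxDr linearD /= tr_conj_diff_dv ?addr0 //; last exact: dvm_exp.
have -> : mG y^-1%g *m B0 *m mG y - B0 =
    P ^+ l2 *: (mG y^-1%g *m (B0 *m E' - E' *m B0)).
  rewrite -{2}[B0]mul1mx -(mG_Vl y) -!mulmxA -mulmxBr scalemxAr; congr (_ *m _).
  rewrite Dy !mulmxDr !mulmxDl scalar_mxC -!scalemxAr -!scalemxAl !opprD.
  by rewrite addrACA [X in X + _]addrACA !subrr add0r scalerBr add0r.
rewrite -!scalemxAr !linearZ /= mulmxA mulmxBr linearB /=.
set Z := H *m mG y^-1%g.
have -> : \tr (Z *m (B0 *m E')) - \tr (Z *m (E' *m B0)) = \tr ((Z *m B0 - B0 *m Z) *m E').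
  by rewrite mulmxBl linearB /= !mulmxA [X in _ - X]mxtrace_mulC !mulmxA.
rewrite mulrCA -linearZ -linearZ /= (scalemxAl b); apply: (dv_l md).
rewrite -l12 addnC.
apply: (@dvm_tr _ _ _ (_ *: (_ *m _))); apply: dvmZ; first exact: dv_exp.
apply: dvmMr.
have cb : cm P l1 A (b *: B0).
  have -> : b *: B0 = mG x + ((- u)%:M + - (P ^+ l2 *: E)).
    by rewrite Dx raddfN /=; mx_linear.
  apply: cmD; first exact/cm_sym/cm_A.
  by apply: cmD; [apply: cm_scalar | apply/cm_dv/dvmN/(dvmW le12)/dvm_exp].
have cV w : cm P l2 (mG w) B0 -> cm P l1 (b *: B0) (mG w^-1%g).
  move=> cw; apply: cmV (mG_V w) (mG_Vl w) _; apply/cm_sym/cmZr.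
  exact: cmW cw.
have : cm P l1 (b *: B0) Z.
  by do 2?apply: cmM; [apply: cm_sym | apply: cV | apply: cV].
by move/cm_sym; rewrite /cm -scalemxAr -scalemxAl -scalerBr.
Qed.

Local Notation S := (cent_mod_group P G l1 A0).
Local Notation TT := (cent_mod_group P G l2 A0).
Local Notation M := (S :&: scalar_mod_group P G)%G.
Local Notation N := (TT :&: scalar_mod_group P G)%G.

Lemma comm_congr1 k g h : cm P k (mG h) (mG g) -> dvm P k (mG [~ g, h]%g - 1%:M).
Proof.
move=> /cm_sym c; rewrite mG_R -{2}[mG g]mul1mx -(mG_Vl h) -!mulmxA -mulmxBr.
by do 2!apply: dvmMl.
Qed.

(** Modulo [P ^+ l1] the elements of [S] are polynomials in [A0]. *)
Lemma cent_cm g h : g \in S -> h \in S -> cm P l1 (mG g) (mG h).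
Proof.
case/cent_modP=> _ cg /cent_modP[_ /cm_decomp[u [E ->]]].
apply: cmD; last by apply/cm_dv/dvm_exp.
by apply: cmD; [apply: cm_scalar | apply: cmZr].
Qed.

Lemma congr1_scalar k g : (0 < k)%N -> g \in G -> dvm P k (mG g - 1%:M) ->
  g \in scalar_mod P G.
Proof.
by move=> k0 Gg h; apply/scalar_modP; split=> //; exists 1; apply: dvmW h.
Qed.

Lemma congr1_cent k g X : g \in G -> dvm P k (mG g - 1%:M) -> g \in cent_mod P G k X.
Proof.
move=> Gg h; apply/cent_modP; split=> //; rewrite -[mG g](subrK 1%:M).
by apply/cm_sym/cmD; [apply: cm_dv | apply: cm_scalar].
Qed.

Lemma cent_G : S \subset G.
Proof. by apply/subsetP=> g /cent_modP[]. Qed.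

Lemma cent_commg g h : g \in S -> h \in S -> [~ g, h]%g \in M.
Proof.
move=> Sg Sh; have := comm_congr1 (cent_cm Sh Sg).
have Gc : [~ g, h]%g \in G by rewrite groupR ?(subsetP cent_G).
move=> d; rewrite inE groupR //=; exact: congr1_scalar d.
Qed.

Lemma cent_der1 : (S^`(1))%g \subset M.
Proof.
rewrite gen_subG; apply/subsetP=> _ /imset2P[g h Sg Sh ->].
exact: cent_commg.
Qed.

Lemma cent_normal : (M <| S)%g.
Proof. exact: sub_der1_normal cent_der1 (subsetIl _ _). Qed.

Lemma kerset_N x : x \in kerset G P l2 -> x \in N.
Proof.
by case/kersetP=> Gx d; rewrite inE /= (congr1_scalar l2_gt0) // congr1_cent.
Qed.

Lemma TT_sub : TT \subset S. Proof. exact: cent_modS. Qed.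

Lemma N_sub : N \subset M. Proof. exact: setSI TT_sub. Qed.

Lemma TT_comm g h : g \in TT -> h \in TT ->
  [~ g, h]%g \in kerset G P l2 /\ psiA psi A [~ g, h]%g = 1.
Proof.
case/cent_modP=> Gg /cm_decomp[u [E Dg]] /cent_modP[Gh ch].
apply: (commutator_ker Gg Gh Dg (r := 0) (s := l2)) => //.
by exists (\tr (mG g *m A0) / (2 * iota del)); rewrite mul1r.
Qed.

Lemma psiA_mul :
  {in kerset G P l2 &, {morph psiA psi A : x y / (x * y)%g >-> x * y}}.
Proof.
move=> x y /kersetP[Gx dx] /kersetP[Gy dy]; rewrite /psiA -(md_psiD md) -linearD -mulmxDr.
congr (psi (\tr (A *m _))); rewrite -![GLval _]/(mG _) mG_M.
have -> : mG x *m mG y - 1%:M =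
    mG x - 1%:M + (mG y - 1%:M) + (mG x - 1%:M) *m (mG y - 1%:M).
  by rewrite mulmxBl !mulmxBr mul1mx !mulmx1; mx_linear.
have -> : (mG x - 1%:M) *m (mG y - 1%:M) = 0.
  apply: (dvm_ge md); last by apply: dvmM dx dy.
  by rewrite -l12 leq_add2r.
by rewrite addr0.
Qed.

Lemma kerset_sub : kerset G P l2 \subset S.
Proof.
apply/subsetP=> x /kersetP[Gx dx]; apply: congr1_cent => //.
exact: dvmW dx.
Qed.

Lemma kerset_norm (K : {group {'GL_2[T]}}) : K :=: kerset G P l2 -> S \subset 'N(K)%g.
Proof.
move=> DK; apply/normsP=> g /cent_modP[Gg _]; apply/eqP.
rewrite eqEcard cardJg leqnn andbT DK; apply/subsetP=> _ /imsetP[x /kersetP[Gx dx] ->].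
apply/kersetP; rewrite groupJ //; split=> //.
have -> : mG (x ^ g)%g - 1%:M = mG g^-1%g *m (mG x - 1%:M) *m mG g.
  by rewrite mulmxBr mulmxBl mulmx1 mG_Vl conjgE -mulmxA.
exact/dvmMr/dvmMl.
Qed.

Lemma irr_acts_psi (H K : {group {'GL_2[T]}}) (i : Iirr H) y :
    H :=: S -> K :=: kerset G P l2 -> y \in H ->
    \sum_(x in K) 'chi_i (y * x)%g * (psiA psi A x)^* != 0 ->
  {in H & kerset G P l2, forall x k, 'chi_i (x * k)%g = 'chi_i x * psiA psi A k}.
Proof.
move=> DH DK; have {DH}DH : H = S by apply/val_inj.
move: i; rewrite {H}DH => i Sy nz; rewrite -DK.
apply: (irr_acts_linearly (y := y)) => //.
- by rewrite DK kerset_sub.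
- exact: kerset_norm.
- by rewrite DK; apply: psiA_mul.
move=> x g Kx; rewrite /= -stab_cent inE => /andP[_ /forall_inP H].
by apply/eqP/H; rewrite -DK.
Qed.

Lemma cent_lin_irr (H : {group {'GL_2[T]}}) (i : Iirr H) : l1 = l2 -> H :=: S ->
    {in H & kerset G P l2, forall x k, 'chi_i (x * k)%g = 'chi_i x * psiA psi A k} ->
  'chi_i \is a linear_char.
Proof.
move=> eq12 DH; have {DH}DH : H = S by apply/val_inj.
move: i; rewrite {H}DH => i act.
rewrite lin_irr_der1 gen_subG; apply/subsetP=> _ /imset2P[g h Sg Sh ->].
have [Kc pc] : [~ g, h]%g \in kerset G P l2 /\ psiA psi A [~ g, h]%g = 1.
  by apply: TT_comm; rewrite -eq12.
by rewrite /= cfkerEirr inE -{1}[[~ g, h]%g]mul1g act ?group1 // pc mulr1.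
Qed.

(** * Odd level: the chain of [N], [M], [S] and the characters over [psi_A] *)

Section OddLevel.

Hypothesis l2E : l2 = l1.+1.

Lemma N_comm n g : n \in N -> g \in S ->
  [~ n, g]%g \in kerset G P l2 /\ psiA psi A [~ n, g]%g = 1.
Proof.
case/setIP=> /cent_modP[Gn cn] scn /cent_modP[Gg cg].
have [u [b [E [db Dn]]]] := scalar_decomp scn cn.
by apply: (commutator_ker Gn Gg Dn db cg) => //; rewrite l2E.
Qed.

Lemma N_normal : (N <| S)%g.
Proof.
apply/andP; split; first exact: subset_trans N_sub (subsetIl _ _).
apply/normsP=> g Sg; apply/eqP; rewrite eqEcard cardJg leqnn andbT.
apply/subsetP=> _ /imsetP[n Nn ->]; rewrite -(mulKVg n (n ^ g)%g) -commgEl groupM //.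
by apply: kerset_N; case: (N_comm Nn Sg).
Qed.

Lemma scalar_cm_lift k g X : g \in scalar_mod P G -> dvm P k X ->
  cm P k.+1 (mG g) X.
Proof.
move=> sg [Y ->]; rewrite -addn1; apply: cmZ; first exact: dv_exp.
exact: scalar_mod_cm sg.
Qed.

(** Forces [phi x = 0]: [x] is its conjugate under [y] times [[~ y, x]], which acts by a scalar
    other than 1. As [x A x^-1 - A] is a multiple of [P ^+ l1] but not of [P ^+ l2], nondegeneracy
    detects it by some Lie element, and [y] is the Cayley element of level [l1] for it. *)
Lemma vanish_witness x : x \in M -> x \notin N ->
  exists2 y, y \in S &
    [~ y, x]%g \in kerset G P l2 /\ psiA psi A [~ y, x]%g != 1.
Proof.
case/setIP=> /cent_modP[Gx cx] scx; rewrite inE scx andbT => nx.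
have ncx : ~ cm P l2 (mG x) A0 by move=> c; case/negP: nx; apply/cent_modP.
have [a [b [c DC]]] := conj_diff_lie Gx.
have dC : dvm P l1 (lie a b c) by rewrite -DC; apply/cm_conj.
have [[[a' b'] c'] /= nz] : exists t : R * R * R,
    psi (P ^+ l1 * \tr (lie a b c *m lie t.1.1 t.1.2 t.2)) != 1.
  have [/existsP//|] := boolP [exists t : R * R * R,
    psi (P ^+ l1 * \tr (lie a b c *m lie t.1.1 t.1.2 t.2)) != 1].
  rewrite negb_exists => /forallP H; case: ncx; apply/cm_conj; rewrite DC.
  have -> : l2 = (l - l1)%N by rewrite -l12 addKn.
  apply: (lie_nondeg md) => [|a' b' c']; first by rewrite -l12 leq_addr.
  by have /negPn/eqP := H (a', b', c').
have [y Gy dy] := cayley md a' b' c' l1_gt0; set Y := lie a' b' c' in nz dy.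
have dy1 : dvm P l1 (mG y - 1%:M).
  rewrite -(subrK (P ^+ l1 *: Y) (mG y - 1%:M)).
  by apply: dvmD; [apply: dvmW dy; apply: leq_addr | apply: dvm_exp].
exists y; first exact: congr1_cent.
have cxy : cm P l2 (mG x) (mG y).
  rewrite -[mG y](subrK 1%:M); apply: cmD; last exact: cm_scalar.
  by rewrite l2E; apply: scalar_cm_lift.
split; first by apply/kersetP; rewrite groupR //; split=> //; apply: comm_congr1.
rewrite /psiA -/(mG _) mG_R.
have -> : mG x^-1%g *m mG y *m mG x - mG y =
    mG x^-1%g *m (mG y - 1%:M) *m mG x - (mG y - 1%:M).
  by rewrite mulmxBr mulmxBl mulmx1 mG_Vl; mx_linear.
set D := mG y - 1%:M in dy1 dy *; set W := _ - D.
have dW : dvm P l2 W.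
  have -> : W = - (mG x^-1%g *m (mG x *m D - D *m mG x)).
    by rewrite mulmxBr !mulmxA mG_Vl mul1mx opprB.
  by apply/dvmN/dvmMl; rewrite l2E; apply: scalar_cm_lift.
have -> : \tr (A *m (mG y^-1%g *m W)) = \tr (A *m W).
  apply/eqP; rewrite -subr_eq0 -linearB -mulmxBr /= -{2}[W]mul1mx -mulmxBl.
  apply/eqP/(dv_l md)/dvm_tr/dvmMl; rewrite -l12; apply: dvmM => //.
  have -> : mG y^-1%g - 1%:M = - (mG y^-1%g *m D).
    by rewrite mulmxBr mG_Vl mulmx1 opprB.
  exact/dvmN/dvmMl.
have -> : \tr (A *m W) = \tr (lie a b c *m D).
  rewrite /W mulmxBr linearB /= trA_conj -linearB -mulmxBl /=; congr (\tr (_ *m _)).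
  rewrite -DC DA mulmxDr mulmxDl scalar_mxC -[z%:M *m _ *m _]mulmxA mG_V mulmx1 opprD.
  by rewrite addrACA subrr add0r.
move: dy; set E := D - _ => dE; have -> : D = P ^+ l1 *: Y + E by rewrite addrC subrK.
rewrite mulmxDr linearD /= -scalemxAr linearZ /=.
suff -> : \tr (lie a b c *m E) = 0 by rewrite addr0.
(* The Cayley error has order [l1 + l1] and [lie a b c] has order [l1]; [l1 + l1 + l1 >= l1 + l2]
   because [l1 >= 1]. *)
apply: (dv_ge md); last by apply/dvm_tr; apply: dvmM dC dE.
by rewrite -l12 l2E leq_add2l -{1}[l1]add0n -addSn leq_add2r.
Qed.

Lemma commutator_shuffle (a b c d f s t : 'M[T]_2) :
  a + b = c + d + f -> b - s = c - s + (d - t + (t - a)) + f.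
Proof. by move=> e1; rewrite -[b](addKr a) e1; mx_linear. Qed.

(** Let [[x, A0] = P^l1 D1]. Applying the derivation [ad] to [g x = x g [~ g, x]] shows that [D1]
    commutes with [g] modulo [P], hence with [A0], because [g = u + v A0] modulo [P] with [v] a
    unit. But a commutator with [A0] anticommutes with [A0], whose square is scalar; so [2 D1 A0],
    and then [D1], vanishes modulo [P]. *)
Lemma frobenius_cond g x : g \in S -> g \notin M -> x \in M ->
  [~ g, x]%g \in N -> x \in N.
Proof.
move=> Sg nMg /setIP[/cent_modP[Gx cx] scx] /setIP[/cent_modP[Gn cn] _].
have /cent_modP[Gg cg] := Sg.
rewrite inE scx andbT; apply/cent_modP; split=> //.
pose ad X := X *m A0 - A0 *m X.
have adM X Y : ad (X *m Y) = ad X *m Y + X *m ad Y.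
  by rewrite /ad mulmxBl mulmxBr !mulmxA; mx_linear.
have d1 : dvm P 1 (mG [~ g, x]%g - 1%:M) by apply: comm_congr1; apply: scalar_mod_cm scx.
have cgD : cm P l2 (mG g) (ad (mG x)).
  have eqad : ad (mG g) *m mG x + mG g *m ad (mG x) =
    ad (mG x) *m mG g *m mG [~ g, x]%g + mG x *m ad (mG g) *m mG [~ g, x]%g
      + mG x *m mG g *m ad (mG [~ g, x]%g).
    by rewrite -!mulmxDl -!adM -!mG_M -commgC.
  rewrite /cm; have -> : mG g *m ad (mG x) - ad (mG x) *m mG g =
     ad (mG x) *m mG g *m (mG [~ g, x]%g - 1%:M) +
     (mG x *m ad (mG g) *m (mG [~ g, x]%g - 1%:M) +
     (mG x *m ad (mG g) - ad (mG g) *m mG x))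
     + mG x *m mG g *m ad (mG [~ g, x]%g).
    rewrite !(mulmxBr _ (mG [~ g, x]%g)) !mulmx1.
    exact: commutator_shuffle eqad.
  apply: dvmD; last exact/dvmMl.
  rewrite l2E -addn1.
  apply: dvmD; first by apply: dvmM d1; apply: dvmMr.
  apply: dvmD; first by apply: dvmM d1; apply: dvmMl.
  by rewrite addn1; apply: scalar_cm_lift.
have [D1 DD] := cx.
have cgD1 : cm P 1 (mG g) D1.
  apply: (dvm_cancel md (k := l1)); first by rewrite -l12 leq_add2l.
  by have := cgD; rewrite /ad DD /cm -scalemxAr -scalemxAl -scalerBr l2E addn1.
have anti : dvm P 1 (A0 *m D1 + D1 *m A0).
  apply: (dvm_cancel md (k := l1)); first by rewrite -l12 leq_add2l.
  rewrite scalerDr scalemxAr scalemxAl -DD mulmxBl mulmxBr !mulmxA.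
  rewrite -[_ *m A0 *m A0]mulmxA A0sq -scalar_mxC.
  by rewrite addrC addrA subrK subrr; apply: dvm0.
have [u [E Dg]] := cm_decomp cg; set v := _ / _ in Dg.
have nv : ~ dv P 1 v.
  move=> dv1; case/negP: nMg; rewrite inE Sg; apply/scalar_modP; split=> //.
  exists u; have -> : mG g - u%:M = v *: A0 + P ^+ l1 *: E by rewrite Dg; mx_linear.
  apply: dvmD; first exact: dvmZl.
  by apply: dvmW (dvm_exp _ _ _).
have uv : v \is a GRing.unit by case: (md_locT md v).
have cAD : cm P 1 D1 A0.
  have : cm P 1 D1 (v *: A0).
    have -> : v *: A0 = mG g + ((- u)%:M + - (P ^+ l1 *: E)).
      by rewrite {1}Dg raddfN /=; mx_linear.
    apply: cmD; first exact: cm_sym.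
    by apply: cmD; [apply: cm_scalar | apply/cm_dv/dvmN/(dvmW l1_gt0)/dvm_exp].
  by move/(cmZr v^-1); rewrite scalerA mulVr // scale1r.
have dD1 : dvm P 1 D1.
  have : dvm P 1 (2 *: (D1 *m A0)).
    rewrite scaler_nat mulr2n -[X in _ + X](subrK (A0 *m D1)) addrCA addrC.
    by apply: dvmD => //; rewrite addrC.
  move/(dvmZr (2 : T)^-1); rewrite scalerA mulVr // scale1r => /(dvmMr A0).
  rewrite -mulmxA A0sq scalar_mxC mul_scalar_mx => /(dvmZr (iota del)^-1).
  by rewrite scalerA mulVr // scale1r.
by rewrite /cm DD l2E -addn1; apply: dvmZ => //; apply: dv_exp.
Qed.

(** One step of successive approximation: [F1] is the defect of [g] in order [l1], and a factor [x]
    in [M] has to cancel it, which requires solving [[X, A0] = F1] modulo [P]. This is possible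
    because [F1] is orthogonal to [A0] modulo [P]. *)
Lemma cent_lift : S \subset (TT * M)%g.
Proof.
apply/subsetP=> g Sg; have /cent_modP[Gg cg] := Sg.
have GV : g^-1%g \in G by rewrite groupV.
have [a [b [c]]] := conj_diff_lie GV; rewrite invgK => DF.
have dF : dvm P l1 (lie a b c) by rewrite -DF; apply: conj_diff_dv.
have [[a1 Da] [b1 Db] [c1 Dc]] := lie_dv md dF.
set F1 := lie a1 b1 c1.
have DF1 : mG g^-1%g *m A0 *m mG g = A0 + P ^+ l1 *: F1.
  by rewrite -rmorphXn lieZ -Da -Db -Dc -DF addrC subrK.
have dtau : dv P 1 (\tr (A0 *m F1)).
  apply: (dv_cancel md (k := l1)); first by rewrite -l12 leq_add2l.
  have := conj_diff_tr cg; rewrite DF1 addrC addKr -scalemxAr linearZ /=.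
  by apply: dvW; rewrite leq_add2l.
(* Bracketing twice with [A0] is multiplication by [4 * del] on the orthogonal complement of
   [A0]. *)
pose r := (4 * del)^-1; pose X := iota r *: (F1 *m A0 - A0 *m F1).
have u4 : 4 * del \is a GRing.unit.
  have -> : (4 : R) = 2 * 2 by rewrite -natrM.
  by rewrite !unitrM (md_two md).
have [a2 [b2 [c2 DX]]] : exists a b c, X = lie a b c.
  by do 3!eexists; rewrite /X /F1 DA0 (lie_bracket md) lieZ.
have [x Gx dx] := cayley md a2 b2 c2 l1_gt0.
have dx1 : dvm P l1 (mG x - 1%:M).
  rewrite -(subrK (P ^+ l1 *: lie a2 b2 c2) (mG x - 1%:M)).
  by apply: dvmD; [apply: dvmW dx; apply: leq_addr | apply: dvm_exp].
have Mx : x \in M by rewrite inE /= congr1_cent // (congr1_scalar l1_gt0).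
suff Tgx : (g * x)%g \in TT.
  by rewrite -(mulgK x g); apply: mem_mulg => //; rewrite groupV.
apply/cent_modP; rewrite groupM //; split=> //; rewrite /cm mG_M.
have -> : mG g *m mG x *m A0 - A0 *m (mG g *m mG x) =
    mG g *m (mG x *m A0 - (A0 + P ^+ l1 *: F1) *m mG x).
  by rewrite -DF1 mulmxBr !mulmxA mG_V mul1mx.
apply: dvmMl; move: dx; rewrite -DX; set E := _ - _ - _ => dE.
have -> : mG x = 1%:M + P ^+ l1 *: X + E by rewrite /E; mx_linear.
clearbody E; have le2 : (l2 <= l1 + l1)%N by rewrite l2E -addn1 leq_add2l.
have dE2 := dvmW le2 dE.
have -> : (1%:M + P ^+ l1 *: X + E) *m A0 -
    (A0 + P ^+ l1 *: F1) *m (1%:M + P ^+ l1 *: X + E) =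
    P ^+ l1 *: (X *m A0 - A0 *m X - F1) +
    (E *m A0 - (A0 + P ^+ l1 *: F1) *m E - P ^+ l1 *: F1 *m (P ^+ l1 *: X)).
  rewrite !(mulmxDl, mulmxDr, mul1mx, mulmx1) -!scalemxAl -!scalemxAr.
  by mx_linear.
apply: dvmD; last first.
  apply: dvmB; first by apply: dvmB; [apply: dvmMr | apply: dvmMl].
  by apply: dvmW le2 _; apply: dvmM; apply: dvm_exp.
rewrite l2E -addn1; apply: dvmZ; first exact: dv_exp.
have -> : X *m A0 - A0 *m X - F1 = - (2 * \tr (A0 *m F1) / iota (4 * del)) *: A0.
  have trF1 : \tr F1 = 0 by apply: lie_tr.
  have anti := traceless_anticomm trA0 trF1; set tau := \tr _ in anti *.
  have dbl : X *m A0 - A0 *m X = iota r *: (iota (4 * del) *: F1 - (2 * tau) *: A0).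
    rewrite /X -scalemxAl -scalemxAr -scalerBr; congr (_ *: _).
    have AFA : A0 *m F1 *m A0 = tau *: A0 - iota del *: F1.
      rewrite -mul_scalar_mx -anti mulmxDl -[F1 *m A0 *m A0]mulmxA A0sq.
      by rewrite scalar_mxC mul_scalar_mx addrK.
    rewrite mulmxBl mulmxBr !mulmxA AFA A0sq mul_scalar_mx -mulmxA A0sq.
    rewrite scalar_mxC mul_scalar_mx rmorphM rmorph_nat.
    by mx_linear.
  rewrite dbl scalerBr scalerA -rmorphM mulVr // rmorph1 scale1r scalerA.
  by rewrite addrAC subrr add0r /r rmorphV // mulrC scaleNr.
by apply: dvmZl; apply/dvN/dvMr/dvMl.
Qed.

(** [x] is scalar modulo [P], so it commutes with [[x, A0]] modulo [P ^+ l2], and the Leibniz rule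
    gives the usual logarithmic derivative of a power. *)
Lemma ad_expg x k : x \in M ->
  dvm P l2 ((mG (x ^+ k)%g *m A0 - A0 *m mG (x ^+ k)%g) *m mG x -
            k%:R *: (mG (x ^+ k)%g *m (mG x *m A0 - A0 *m mG x))).
Proof.
case/setIP=> /cent_modP[Gx cx] scx; elim: k => [|k IHk].
  by rewrite expg0 mG_1 mul1mx mulmx1 subrr mul0mx scale0r subrr; apply: dvm0.
rewrite expgSr mG_M; set Y := mG (x ^+ k)%g in IHk *; set X := mG x in IHk cx *.
have -> : (Y *m X *m A0 - A0 *m (Y *m X)) *m X -
    k.+1%:R *: (Y *m X *m (X *m A0 - A0 *m X)) =
    ((Y *m A0 - A0 *m Y) *m X - k%:R *: (Y *m (X *m A0 - A0 *m X))) *m X +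
    k.+1%:R *: (Y *m ((X *m A0 - A0 *m X) *m X - X *m (X *m A0 - A0 *m X))).
  rewrite !(mulmxBl, mulmxBr) -!scalemxAl !(mulmxBl, mulmxBr) !mulmxA -natr1.
  by mx_linear.
apply: dvmD; first exact: dvmMr.
by apply/dvmZr/dvmMl; rewrite l2E; apply/cm_sym/scalar_cm_lift.
Qed.

Lemma expg_N_residue x r : x \in M -> x \notin N -> (x ^+ r)%g \in N -> dv p 1 r%:R.
Proof.
move=> Mx nNx /setIP[/cent_modP[Gr cr] _].
case: (md_locR md r%:R) => // ur; case/negP: nNx.
have /setIP[/cent_modP[Gx cx] scx] := Mx.
rewrite inE scx andbT; apply/cent_modP; split=> //.
have urT : (r%:R : T) \is a GRing.unit by rewrite -(rmorph_nat iota) rmorph_unit.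
have : dvm P l2 (r%:R *: (mG (x ^+ r)%g *m (mG x *m A0 - A0 *m mG x))).
  by apply: dvmBl (ad_expg r Mx) _; apply: dvmMr.
move/(dvmZr r%:R^-1); rewrite scalerA mulVr // scale1r.
exact/dvm_divl/mG_Vl.
Qed.

Lemma dv_expn (v : T) k : dv P 1 (v ^+ k) -> dv P 1 v.
Proof.
elim: k => [|k IHk].
  by rewrite expr0 => /(unit_not_dv md); case; apply: unitr1.
by rewrite exprS => /(dv_prime md)[].
Qed.

(** Modulo [P], [g = u + v A0], and for the residue characteristic [r], which is odd, the binomial
    theorem gives [g^r = u^r + v^r del^((r-1)/2) A0]. This is scalar only if [P] divides [v]. *)
Lemma expg_M_residue g r : prime r -> dv p 1 (r%:R : R) -> g \in S ->
  (g ^+ r)%g \in M -> g \in M.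
Proof.
move=> pr dr Sg /setIP[_ /scalar_modP[_ [c dc]]]; have /cent_modP[Gg cg] := Sg.
have [u [E Dg]] := cm_decomp cg; set v := _ / _ in Dg.
rewrite inE Sg; apply/scalar_modP; split=> //; exists u.
have -> : mG g - u%:M = v *: A0 + P ^+ l1 *: E by rewrite Dg; mx_linear.
apply: dvmD; last by apply: dvmW (dvm_exp _ _ _).
apply: dvmZl; apply: (@dv_expn _ r).
pose Z : 'M[T]_2 := u%:M + v *: A0.
have dZ k : dvm P 1 (mG (g ^+ k)%g - (Z : 'M[T]_1.+1) ^+ k).
  elim: k => [|k IHk]; first by rewrite expg0 expr0 mG_1 subrr; apply: dvm0.
  rewrite expgS exprS mG_M -[X in _ - X]/(Z *m (Z : 'M[T]_1.+1) ^+ k).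
  have -> : mG g *m mG (g ^+ k)%g - Z *m (Z : 'M[T]_1.+1) ^+ k =
     (mG g - Z) *m mG (g ^+ k)%g + Z *m (mG (g ^+ k)%g - (Z : 'M[T]_1.+1) ^+ k).
    by rewrite mulmxBl mulmxBr; mx_linear.
  apply: dvmD; last exact: dvmMl.
  apply: dvmMr; have -> : mG g - Z = P ^+ l1 *: E by rewrite Dg /Z; mx_linear.
  exact: dvmW (dvm_exp _ _ _).
have drT : dv P 1 (r%:R : T).
  by case: dr => d Dd; exists (iota d); rewrite -(rmorph_nat iota) Dd rmorphM rmorphXn.
have r_odd : odd r.
  case: (even_prime pr) => // r2; case: (unit_not_dvR md (md_two md)).
  by move: dr; rewrite r2.
have comm_uv : GRing.comm (u%:M : 'M[T]_1.+1) (v *: A0).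
  by rewrite /GRing.comm -!mulmxE scalar_mxC.
have A0r : (A0 : 'M[T]_1.+1) ^+ r = iota del ^+ r./2 *: A0.
  rewrite -{1}(odd_double_half r) r_odd add1n exprS -muln2 mulnC exprM.
  have -> : (A0 : 'M[T]_1.+1) ^+ 2 = (iota del)%:M by rewrite expr2 -mulmxE A0sq.
  have -> : ((iota del)%:M : 'M[T]_1.+1) ^+ r./2 = (iota del ^+ r./2)%:M.
    by rewrite rmorphXn.
  by rewrite -mulmxE scalar_mxC mul_scalar_mx.
have bin : dvm P 1 ((Z : 'M[T]_1.+1) ^+ r - (u ^+ r)%:M - (v ^+ r * iota del ^+ r./2) *: A0).
  rewrite /Z exprDn_comm // (bigD1 ord0) //= (bigD1 ord_max) /=; last first.
    by rewrite -val_eqE /= -lt0n prime_gt0.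
  rewrite subn0 expr0 mulr1 bin0 mulr1n subnn expr0 mul1r binn mulr1n exprZn A0r scalerA.
  have -> : (u%:M : 'M[T]_1.+1) ^+ r = (u ^+ r)%:M by rewrite rmorphXn.
  rewrite [(u ^+ r)%:M + _]addrC addrK [_ *: A0 + _]addrC addrK.
  apply: (big_ind (dvm P 1)) => [||i /andP[i0 ir]]; [exact: dvm0 | exact: dvmD |].
  have lti : (0 < i < r)%N.
    rewrite lt0n -val_eqE /= in i0 *; rewrite i0 ltn_neqAle -ltnS ltn_ord andbT.
    by move: ir; rewrite -val_eqE.
  have /dvdnP[k ->] := prime_dvd_bin pr lti.
  by rewrite -scaler_nat natrM; apply/dvmZl/dvMl.
have : dvm P 1 (c%:M - (u ^+ r)%:M - (v ^+ r * iota del ^+ r./2) *: A0).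
  have -> : c%:M - (u ^+ r)%:M - (v ^+ r * iota del ^+ r./2) *: A0 =
     ((Z : 'M[T]_1.+1) ^+ r - (u ^+ r)%:M - (v ^+ r * iota del ^+ r./2) *: A0)
     + (mG (g ^+ r)%g - (Z : 'M[T]_1.+1) ^+ r) - (mG (g ^+ r)%g - c%:M) by mx_linear.
  by apply: dvmB => //; apply: dvmD.
move=> /(dvmMr A0)/dvm_tr; rewrite !mulmxBl !mul_scalar_mx -scalemxAl A0sq.
rewrite !linearB !linearZ /= trA0 !mulr0 subrr sub0r mxtrace_scalar => /dvN.
rewrite opprK -[v ^+ r * _ * _]mulrA [v ^+ r * _]mulrC; apply: dv_divl.
by rewrite unitrM unitrX //= -mulr_natl unitrM u2.
Qed.

(** By Cauchy's theorem a common prime is the order of an element of [M / N], hence lies in the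
    maximal ideal, and also the order of an element of [S / M], which [expg_M_residue] excludes. *)
Lemma coprime_index : coprime #|M : N|%g #|S : M|%g.
Proof.
rewrite /coprime; set d := gcdn _ _.
have d0 : (0 < d)%N by rewrite gcdn_gt0 indexg_gt0.
apply/negPn/negP => d1.
have dgt1 : (1 < d)%N by rewrite ltn_neqAle eq_sym d1.
have pr := pdiv_prime dgt1; have dvd := pdiv_dvd d.
have nsNM : (N <| M)%g by apply: normalS N_normal; [apply: N_sub | apply: subsetIl].
have [x [Mx nNx Nxr]] := cauchy_quotient nsNM pr (dvdn_trans dvd (dvdn_gcdl _ _)).
have [g [Sg nMg Mgr]] := cauchy_quotient cent_normal pr (dvdn_trans dvd (dvdn_gcdr _ _)).
by case/negP: nMg; apply: expg_M_residue Mgr => //; apply: expg_N_residue Nxr.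
Qed.

Lemma kerN_of_psi (i : Iirr S) x :
    {in S & kerset G P l2, forall y k, 'chi_i (y * k)%g = 'chi_i y * psiA psi A k} ->
    x \in kerset G P l2 /\ psiA psi A x = 1 -> x \in cfker 'chi_i.
Proof.
move=> act [Kx px]; rewrite cfkerEirr inE -{1}[x]mul1g act ?group1 //.
by rewrite px mulr1.
Qed.

Lemma odd_irr (i : Iirr S) :
    {in S & kerset G P l2, forall x k, 'chi_i (x * k)%g = 'chi_i x * psiA psi A k} ->
  [/\ 'chi_i 1%g ^+ 2 = #|M : N|%g%:R, {in M :\: N, forall x, 'chi_i x = 0},
      {in S :\: M, forall x, `|'chi_i x| = 1} &
      {in N & S, forall n g, [~ n, g]%g \in cfker 'chi_i}].
Proof.
move=> act; have sMS : M \subset S := subsetIl _ _.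
have kerN : {in N & S, forall n g, [~ n, g]%g \in cfker 'chi_i}.
  by move=> n g Nn Sg; apply: kerN_of_psi act (N_comm Nn Sg).
have phiN : {in N, forall x, `|'chi_i x| = 'chi_i 1%g}.
  move=> n Nn; have Sn : n \in S by apply: (subsetP sMS); apply: (subsetP N_sub).
  by have [] := irr_center_norm Sn (fun g Sg => kerN n g Nn Sg).
have phi0 : {in M :\: N, forall x, 'chi_i x = 0}.
  move=> x /setDP[Mx nNx]; have [y Sy [Kc nz]] := vanish_witness Mx nNx.
  have Sx := subsetP sMS x Mx.
  have Dx : x = (x ^ y * [~ y, x])%g by rewrite commgEr conjVg mulKVg.
  apply/eqP; have := act _ _ (groupJ Sx Sy) Kc; rewrite -Dx cfunJ // => /eqP.
  rewrite -{1}['chi_i x]mulr1 -subr_eq0 -mulrBr mulf_eq0 subr_eq0.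
  by rewrite [1 == _]eq_sym (negbTE nz) orbF.
have kerT : (TT^`(1))%g \subset cfker 'chi_i.
  rewrite gen_subG; apply/subsetP=> _ /imset2P[g h Tg Th ->].
  by apply: kerN_of_psi act (TT_comm Tg Th).
split=> //.
  exact: (irr_degree_sqr cent_normal N_sub cent_der1 phiN phi0 TT_sub cent_lift kerT
    coprime_index).
apply: (norm_irr_off cent_normal N_sub cent_der1 phiN phi0 TT_sub cent_lift kerT
  coprime_index N_normal kerN).
by move=> g x /setDP[Sg nMg] Mx; apply: frobenius_cond.
Qed.

Lemma odd_irr_eq (H M' N' : {group {'GL_2[T]}}) (i : Iirr H) :
    H :=: S -> M' :=: M -> N' :=: N ->
    {in H & kerset G P l2, forall x k, 'chi_i (x * k)%g = 'chi_i x * psiA psi A k} ->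
  [/\ 'chi_i 1%g ^+ 2 = #|M' : N'|%g%:R, {in M' :\: N', forall x, 'chi_i x = 0},
      {in H :\: M', forall x, `|'chi_i x| = 1} &
      {in N' & H, forall n g, [~ n, g]%g \in cfker 'chi_i}].
Proof.
move=> DH -> ->; have {DH}DH : H = S by apply/val_inj.
by move: i; rewrite {H}DH; apply: odd_irr.
Qed.

(** The order of the residue field, counted inside [R] as the size of the ideal generated by
    [p ^+ l.-1], which is isomorphic to [R / p R]. *)
Definition residues := #|[set p ^+ l.-1 * r | r : R]|.

Lemma residue_eq r s : (p ^+ l.-1 * r = p ^+ l.-1 * s) <-> dv p 1 (r - s).
Proof.
split=> [/eqP|[c Dc]]; last first.
  apply/eqP; rewrite -subr_eq0 -mulrBr Dc mulrA -exprD addn1 prednK //.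
  by rewrite (md_nil md) mul0r.
rewrite -subr_eq0 -mulrBr => /eqP rs0; apply: (md_refl md).
have {1}-> : 1%N = (l - l.-1)%N by rewrite -{1}(prednK l_gt0) subSnn.
apply: (md_ann md); first exact: leq_pred.
by rewrite -rmorphXn -rmorphM /= rs0 rmorph0.
Qed.

Lemma residue_unit r : ~ dv p 1 r -> r \is a GRing.unit.
Proof. by move=> nr; case: (md_locR md r). Qed.

(** The matrices [r + A0] have unit norm [r ^+ 2 - del] and can be rescaled into [G]. Two of them
    are proportional modulo [P] only if their [r] agree modulo [p]. *)
Lemma index_M_ge : (forall t : R, t ^+ 2 - del \is a GRing.unit) ->
  (residues <= #|S : M|%g)%N.
Proof.
move=> nsq.
have /fin_all_exists[g Hg] (r : R) : exists g, g \in S /\ exists2 lam,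
    lam \is a GRing.unit & mG g = lam *: ((iota r)%:M + A0).
  have : r ^+ 2 - 1 ^+ 2 * del \is a GRing.unit by rewrite expr1n mul1r.
  case/(md_unit md) => lam [g [ul Gg]]; rewrite rmorph1 scale1r -DA0 => Dg.
  exists g; split; last by exists lam.
  apply/cent_modP; split=> //; rewrite Dg; apply/cm_sym/cmZr/cmD.
    exact: cm_scalar.
  exact: cm_refl.
rewrite /residues; apply: leq_trans (_ : #|[set (M :* g r)%g | r : R]| <= _)%N.
  apply: leq_card_factor => r s _ _ Ers; apply/residue_eq; apply: (md_refl md).
  have [Sr [lr ur Dr]] := Hg r; have [Ss [ls us Ds]] := Hg s.
  have : g r \in (M :* g s)%g by rewrite -Ers rcoset_refl.
  case/rcosetP=> m /setIP[_ /scalar_modP[_ [c [C DC]]]] Dgr.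
  have E : lr *: ((iota r)%:M + A0) - (c * ls) *: ((iota s)%:M + A0) =
      P ^+ 1 *: (C *m mG (g s)).
    rewrite -Dr Dgr mG_M -scalerA -Ds -mul_scalar_mx -mulmxBl DC -scalemxAl //.
  have e1 : dv P 1 (lr - c * ls).
    have : dv P 1 (\tr ((lr *: ((iota r)%:M + A0) - (c * ls) *: ((iota s)%:M + A0)) *m A0)).
      by rewrite E; apply/dvm_tr/dvmMr/dvm_exp.
    rewrite mulmxBl -!scalemxAl !mulmxDl !mul_scalar_mx A0sq linearB !linearZ !linearD /=.
    rewrite !linearZ /= trA0 !mulr0 !add0r mxtrace_scalar -mulrBl mulrC.
    by apply: dv_divl; rewrite -mulr_natl unitrM u2.
  have : dv P 1 (\tr (lr *: ((iota r)%:M + A0) - (c * ls) *: ((iota s)%:M + A0))).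
    by rewrite E; apply/dvm_tr/dvm_exp.
  rewrite linearB !linearZ !linearD /= trA0 !addr0 !mxtrace_scalar => e2.
  apply: (dv_divl (u := lr * 2)); first by rewrite unitrM ur.
  have -> : lr * 2 * iota (r - s) =
    (lr * (iota r *+ 2) - c * ls * (iota s *+ 2)) - (lr - c * ls) * (iota s *+ 2).
    by rewrite rmorphB; ring.
  by apply: dvB => //; apply: dvMr.
rewrite /indexg; apply/subset_leq_card/subsetP => _ /imsetP[r _ ->].
by apply/rcosetsP; exists (g r) => //; case: (Hg r).
Qed.

(** Write [x^-1 A0 x = A0 + P^l1 F]. The coset of [x] is determined by [F] modulo [p], and by
    [conj_diff_tr] this [F] is orthogonal to [A0] modulo [p]: it lies in a plane over the residue
    field. *)
Lemma index_N_le : (#|M : N|%g <= residues * residues)%N.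
Proof.
have /fin_all_exists[t Ht] (x : {'GL_2[T]}) : exists t : R * R * R, x \in M ->
    mG x^-1%g *m A0 *m mG x - A0 = P ^+ l1 *: lie t.1.1 t.1.2 t.2 /\
    dv p 1 (2 * (a0 * t.1.1) + e * (b0 * t.2 + c0 * t.1.2)).
  have [/setIP[/cent_modP[Gx cx] scx]|nMx] := boolP (x \in M); last by exists (0, 0, 0).
  have GV : x^-1%g \in G by rewrite groupV.
  have [a [b [c]]] := conj_diff_lie GV; rewrite invgK => DF.
  have dF : dvm P l1 (lie a b c) by rewrite -DF; apply: conj_diff_dv.
  have [[a1 Da] [b1 Db] [c1 Dc]] := lie_dv md dF.
  exists (a1, b1, c1) => _ /=; split; first by rewrite DF -rmorphXn lieZ -Da -Db -Dc.
  apply: (md_refl md); rewrite -(lie_trM md).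
  apply: (dv_cancel md (k := l1)); first by rewrite -l12 leq_add2l.
  have := conj_diff_tr cx; rewrite DF Da Db Dc -lieZ rmorphXn -scalemxAr linearZ /= DA0.
  by apply: dvW; rewrite leq_add2l.
have sameN x y : x \in M -> y \in M ->
    dv p 1 ((t x).1.1 - (t y).1.1) -> dv p 1 ((t x).1.2 - (t y).1.2) ->
    dv p 1 ((t x).2 - (t y).2) -> (N :* x = N :* y)%g.
  move=> Mx My d1 d2 d3; apply/rcoset_eqP; rewrite mem_rcoset.
  have [Ex _] := Ht x Mx; have [Ey _] := Ht y My.
  have d : dvm P l2 (mG x^-1%g *m A0 *m mG x - mG y^-1%g *m A0 *m mG y).
    have -> : mG x^-1%g *m A0 *m mG x - mG y^-1%g *m A0 *m mG y =
      P ^+ l1 *: lie (t x).1.1 (t x).1.2 (t x).2 - P ^+ l1 *: lie (t y).1.1 (t y).1.2 (t y).2.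
      by rewrite -Ex -Ey; mx_linear.
    rewrite -scalerBr lieB l2E -addn1; apply: dvmZ; first exact: dv_exp.
    exact: dv_lie.
  have /setIP[/cent_modP[Gx _] scx] := Mx; have /setIP[/cent_modP[Gy _] scy] := My.
  apply/setIP; split; last by rewrite groupM ?groupV.
  apply/cent_modP; rewrite groupM ?groupV //; split=> //; rewrite /cm mG_M.
  have -> : mG x *m mG y^-1%g *m A0 - A0 *m (mG x *m mG y^-1%g) =
     - (mG x *m (mG x^-1%g *m A0 *m mG x - mG y^-1%g *m A0 *m mG y) *m mG y^-1%g).
    rewrite mulmxBr mulmxBl !mulmxA mG_V mul1mx -!mulmxA mG_V mulmx1.
    by mx_linear.
  exact/dvmN/dvmMr/dvmMl.
have key (f h : R * R * R -> R) :
    (forall x y, x \in M -> y \in M -> dv p 1 (f (t x) - f (t y)) ->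
       dv p 1 (h (t x) - h (t y)) -> (N :* x = N :* y)%g) ->
    (#|M : N|%g <= residues * residues)%N.
  move=> H.
  pose fh x := (p ^+ l.-1 * f (t x), p ^+ l.-1 * h (t x)).
  apply: leq_trans (_ : #|[set fh x | x in M]| <= _)%N.
    rewrite /indexg -[rcosets _ _]/((rcoset N) @: M); apply: leq_card_factor.
    by move=> x y Mx My [/residue_eq e1 /residue_eq e2]; rewrite !rcosetE; apply: H.
  rewrite /residues -cardsX; apply/subset_leq_card/subsetP => _ /imsetP[x Mx ->].
  by rewrite inE /= !imset_f.
(* Since [del] is a unit, so is [a0] or [b0], and the orthogonality relation then expresses one
   coordinate by the other two. *)
have [ua|da] := md_locR md a0.
  apply: (key (fun u => u.1.2) (fun u => u.2)) => x y Mx My d2 d3; apply: sameN => //.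
  have [[_ rx] [_ ry]] := (Ht x Mx, Ht y My).
  apply: (dv_divl (u := 2 * a0)); first by rewrite unitrM (md_two md).
  have -> : 2 * a0 * ((t x).1.1 - (t y).1.1) =
    (2 * (a0 * (t x).1.1) + e * (b0 * (t x).2 + c0 * (t x).1.2)) -
    (2 * (a0 * (t y).1.1) + e * (b0 * (t y).2 + c0 * (t y).1.2)) -
    (e * b0 * ((t x).2 - (t y).2) + e * c0 * ((t x).1.2 - (t y).1.2)) by ring.
  by apply: dvB; [apply: dvB | apply: dvD; apply: dvMl].
have [ub|db] := md_locR md b0.
  apply: (key (fun u => u.1.1) (fun u => u.1.2)) => x y Mx My d1 d2; apply: sameN => //.
  have [[_ rx] [_ ry]] := (Ht x Mx, Ht y My).
  apply: (dv_divl (u := e * b0)); first by rewrite unitrM (md_e md).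
  have -> : e * b0 * ((t x).2 - (t y).2) =
    (2 * (a0 * (t x).1.1) + e * (b0 * (t x).2 + c0 * (t x).1.2)) -
    (2 * (a0 * (t y).1.1) + e * (b0 * (t y).2 + c0 * (t y).1.2)) -
    (2 * a0 * ((t x).1.1 - (t y).1.1) + e * c0 * ((t x).1.2 - (t y).1.2)) by ring.
  by apply: dvB; [apply: dvB | apply: dvD; apply: dvMl].
case: (unit_not_dvR md udel); apply: dvD; first by rewrite expr2; apply: dvMl.
by apply/dvMr/dvMl.
Qed.

End OddLevel.

End Stabilizer.

(** * Pairs of matrices *)

Section Pair.

Variables (R T : finComUnitRingType) (iota : {rmorphism R -> T}) (p : R).
Variables (eps : T) (e : R) (psi : T -> algC) (G : {group {'GL_2[T]}}) (l : nat).
Hypothesis md : matrix_datum iota p eps e psi G l.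
Hypothesis psi0 : psi 0 = 1.

Local Notation P := (iota p).
Local Notation lie := (lie_mx iota eps).
Local Notation q := (residues p l).

Variables l1 l2 : nat.
Hypotheses (l12 : (l1 + l2)%N = l) (le12 : (l1 <= l2)%N) (l1_gt0 : (0 < l1)%N).

Local Notation cent := (cent_mod_group P G).
Local Notation scal := (scalar_mod_group P G).

Lemma cent_sub_of_cm a b c (B C : 'M[T]_2) : B = lie a b c ->
    a ^+ 2 + e * b * c \is a GRing.unit -> cm P l1 B C ->
  cent l1 B \subset cent l1 C.
Proof.
move=> DB uB cBC; apply/subsetP=> g /cent_modP[Gg /(cm_decomp md DB uB)[u [E Dg]]].
apply/cent_modP; split=> //; rewrite Dg; apply/cm_sym/cmD; last exact/cm_dv/dvm_exp.
by apply: cmD; [apply: cm_scalar | apply/cmZr/cm_sym].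
Qed.

(** In [g = u + v B] modulo [P ^+ l2] the coefficient [v] is divisible by [P]; this supplies the
    order missing from [[B, C]]. *)
Lemma N_sub_of_cm a b c (B C : 'M[T]_2) : l2 = l1.+1 -> B = lie a b c ->
    a ^+ 2 + e * b * c \is a GRing.unit -> cm P l1 B C ->
  cent l2 B :&: scal \subset cent l2 C :&: scal.
Proof.
move=> l2E DB uB cBC; apply/subsetP=> g /setIP[/cent_modP[Gg cg] scg].
apply/setIP; split=> //; apply/cent_modP; split=> //.
have [u [v [E [dv1 ->]]]] := scalar_decomp md DB uB scg cg.
apply/cm_sym/cmD; last exact/cm_dv/dvm_exp.
apply: cmD; first exact: cm_scalar.
by rewrite l2E -add1n; apply: cmZ => //; apply: cm_sym.
Qed.

Lemma cm_gap (B C : 'M[T]_2) n : ~ cm P n B C ->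
  exists2 j, (j < n)%N & cm P j B C /\ ~ cm P j.+1 B C.
Proof.
elim: n => [|n IHn] nc.
  by case: nc; exists (B *m C - C *m B); rewrite expr0 scale1r.
have [c|c] := boolP (mxcong P n (B *m C) (C *m B)).
  by exists n => //; split=> //; apply/mxcongP.
case: IHn => [/mxcongP|j jn Hj]; first by rewrite (negbTE c).
by exists j => //; apply: leq_trans jn _.
Qed.

Lemma residues_gt0 : (0 < q)%N.
Proof. by apply/card_gt0P; exists (p ^+ l.-1 * 0); apply/imsetP; exists 0. Qed.

Lemma char_deg_le (f : algC) n : 0 <= f -> f ^+ 2 = n%:R -> (n <= q * q)%N -> f <= q%:R.
Proof.
move=> f0 f2 le_n; rewrite -(ler_pXn2r (n := 2)) ?nnegrE ?ler0n // f2.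
by rewrite -natrX ler_nat -mulnn.
Qed.

(** Let [[B, C] = P^j D] with [j < l1] and [D] nonzero modulo [P]. The elements [1 + P^(l1-j) r B],
    rescaled into [G], commute with [B], and their bracket with [C] is [r P^l1 D] up to a unit. So
    they lie in the first group, while modulo [P ^+ l2], where the second group commutes with [C],
    the bracket still sees the residue of [r]. *)
Lemma index_Q_ge a b c (B C : 'M[T]_2) :
    l2 = l1.+1 -> B = lie a b c -> ~ cm P l1 B C ->
  (q <= #|(cent l2 B :&: scal) :&: cent l1 C :
          ((cent l2 B :&: scal) :&: cent l1 C) :&: ((cent l2 C :&: scal) :&: cent l1 B)|%g)%N.
Proof.
move=> l2E DB nc; have [j ltj [[D DD] ncj]] := cm_gap nc.
set Q1 := (_ :&: cent l1 C); set Q2 := (_ :&: cent l1 B).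
have k0 : (0 < l1 - j)%N by rewrite subn_gt0.
have nD : ~ dvm P 1 D.
  move=> dD; apply: ncj; rewrite /cm DD -addn1; apply: dvmZ => //; exact: dv_exp.
have /fin_all_exists[g Hg] (r : R) : exists g, g \in Q1 /\ exists2 lam,
    lam \is a GRing.unit & mG g = lam *: (1%:M + (P ^+ (l1 - j) * iota r) *: B).
  have us : 1 ^+ 2 - (p ^+ (l1 - j) * r) ^+ 2 * (a ^+ 2 + e * b * c) \is a GRing.unit.
    apply: (residue_unit md) => h; case: (unit_not_dvR md (unitr1 R)).
    have := dvD h; rewrite expr1n => /(_ ((p ^+ (l1 - j) * r) ^+ 2 * (a ^+ 2 + e * b * c))).
    rewrite subrK; apply; apply: dvMr; rewrite expr2 -mulrA; apply: dvMr.
    by apply: dvW k0 _; apply: dv_exp.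
  have [lam [g [ul Gg Dg]]] := md_unit md us.
  rewrite rmorph1 rmorphM rmorphXn -DB in Dg.
  exists g; split; last by exists lam.
  rewrite !inE Gg /= -!andbA; apply/and3P; split.
  - apply/mxcongP; rewrite Dg -/(cm _ _ _ _); apply/cm_sym/cmZr/cmD.
      exact: cm_scalar.
    exact/cmZr/cm_refl.
  - apply/existsP; exists lam; apply/mxcongP; rewrite Dg scalerDr scalemx1 addrC addKr.
    by apply/dvmZr/dvmZl/dvMr; apply: dvW k0 _; apply: dv_exp.
  apply/mxcongP; rewrite Dg -/(cm _ _ _ _); apply/cm_sym/cmZr/cmD.
    exact: cm_scalar.
  rewrite -[X in cm _ X](subnK (ltnW ltj)); apply: cmZ; last by apply: cm_sym; exists D.
  exact/dvMr/dv_exp.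
rewrite /residues; apply: leq_trans (_ : #|[set ((Q1 :&: Q2) :* g r)%g | r : R]| <= _)%N.
  apply: leq_card_factor => r s _ _ Ers; apply/(residue_eq md l12 l1_gt0).
  have [_ [lr ur Dr]] := Hg r; have [_ [ls us Ds]] := Hg s.
  have : g r \in ((Q1 :&: Q2)%G :* g s)%g by rewrite /= -Ers rcoset_refl.
  case/rcosetP=> m /setIP[_ /setIP[/setIP[/cent_modP[Gm cm2] /scalar_modP[_ [u du]]] _]] Dgr.
  case: (md_locR md (r - s)) => // urs; case: nD.
  have dls : dvm P 1 (mG (g s) - ls%:M).
    rewrite Ds scalerDr scalemx1 addrC addKr.
    by apply/dvmZr/dvmZl/dvMr; apply: dvW k0 _; apply: dv_exp.
  have dlr : dvm P 1 (mG (g r) - lr%:M).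
    rewrite Dr scalerDr scalemx1 addrC addKr.
    by apply/dvmZr/dvmZl/dvMr; apply: dvW k0 _; apply: dv_exp.
  have dl : dv P 1 (lr - u * ls).
    apply: dvm_scalar; rewrite raddfB /= scalar_mxM.
    have -> : lr%:M - u%:M *m ls%:M = (mG m - u%:M) *m mG (g s)
       + u%:M *m (mG (g s) - ls%:M) - (mG (g r) - lr%:M).
      by rewrite Dgr mG_M mulmxBl mulmxBr; mx_linear.
    by apply: dvmB => //; apply: dvmD; [apply: dvmMr | apply: dvmMl].
  have adE t lt : mG (g t) = lt *: (1%:M + (P ^+ (l1 - j) * iota t) *: B) ->
      mG (g t) *m C - C *m mG (g t) = P ^+ l1 *: ((lt * iota t) *: D).
    move=> ->; rewrite -scalemxAl -scalemxAr -scalerBr mulmxDl mulmxDr mul1mx mulmx1.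
    have -> : C + (P ^+ (l1 - j) * iota t) *: B *m C - (C + C *m ((P ^+ (l1 - j) * iota t) *: B)) =
       (P ^+ (l1 - j) * iota t) *: (B *m C - C *m B).
      by rewrite -scalemxAl -scalemxAr; mx_linear.
    rewrite DD !scalerA; congr (_ *: _).
    by rewrite -{2}(subnK (ltnW ltj)) exprD; ring.
  have : dvm P l2 (P ^+ l1 *: ((lr * iota r - u * ls * iota s) *: D)).
    have -> : P ^+ l1 *: ((lr * iota r - u * ls * iota s) *: D) =
      (mG m *m C - C *m mG m) *m mG (g s) + (mG m - u%:M) *m (mG (g s) *m C - C *m mG (g s)).
      have -> : (mG m *m C - C *m mG m) *m mG (g s) +
          (mG m - u%:M) *m (mG (g s) *m C - C *m mG (g s)) =
          mG (g r) *m C - C *m mG (g r) - u *: (mG (g s) *m C - C *m mG (g s)).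
        rewrite Dgr mG_M -mul_scalar_mx !mulmxBl !mulmxBr !mulmxA.
        by mx_linear.
      by rewrite (adE _ _ Dr) (adE _ _ Ds); mx_linear.
    apply: dvmD; first exact: dvmMr.
    rewrite (adE _ _ Ds) l2E -addn1 addnC; apply: dvmM => //; exact: dvm_exp.
  have ll : (l1 + 1 <= l)%N by rewrite -l12 leq_add2l (leq_trans l1_gt0).
  rewrite l2E -addn1 => /(dvm_cancel md ll) dD.
  have : dvm P 1 ((lr * iota (r - s)) *: D).
    have -> : (lr * iota (r - s)) *: D = (lr * iota r - u * ls * iota s) *: D
        - ((lr - u * ls) * iota s) *: D by rewrite rmorphB; mx_linear.
    by apply: dvmB => //; apply/dvmZl/dvMr.
  move/(dvmZr (lr * iota (r - s))^-1); rewrite scalerA mulVr ?scale1r //.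
  by rewrite unitrM ur rmorph_unit.
rewrite /indexg; apply/subset_leq_card/subsetP => _ /imsetP[r _ ->].
by apply/rcosetsP; exists (g r) => //; case: (Hg r).
Qed.

End Pair.

(** * Multiplicity freeness for a matrix datum *)

Section MultiplicityFree.

Variables (R T : finComUnitRingType) (iota : {rmorphism R -> T}) (p : R).
Variables (eps : T) (e : R) (psi : T -> algC) (G : {group {'GL_2[T]}}) (l : nat).
Hypothesis md : matrix_datum iota p eps e psi G l.
Hypothesis l_gt1 : (1 < l)%N.

Local Notation P := (iota p).
Local Notation lie := (lie_mx iota eps).
Local Notation q := (residues p l).
Local Notation l1 := l./2.
Local Notation l2 := (uphalf l).
Local Notation cent := (cent_mod_group P G).
Local Notation scal := (scalar_mod_group P G).

Let l12 : (l1 + l2)%N = l.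
Proof. by rewrite uphalf_half addnCA addnn odd_double_half. Qed.
Let le12 : (l1 <= l2)%N.
Proof. by rewrite uphalf_half leq_addl. Qed.
Let l1_gt0 : (0 < l1)%N.
Proof. by rewrite half_gt0. Qed.

Variables (z1 z2 : T) (a1 b1 c1 a2 b2 c2 : R) (A1 A2 B1 B2 : 'M[T]_2).
Hypotheses (DB1 : B1 = lie a1 b1 c1) (DA1 : A1 = z1%:M + B1).
Hypotheses (DB2 : B2 = lie a2 b2 c2) (DA2 : A2 = z2%:M + B2).
Hypothesis nsq1 : forall t : R, t ^+ 2 - (a1 ^+ 2 + e * b1 * c1) \is a GRing.unit.
Hypothesis nsq2 : forall t : R, t ^+ 2 - (a2 ^+ 2 + e * b2 * c2) \is a GRing.unit.
Hypothesis reg : regular P (A1 + A2).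

Let ud1 : a1 ^+ 2 + e * b1 * c1 \is a GRing.unit.
Proof. by have := nsq1 0; rewrite expr0n sub0r unitrN. Qed.
Let ud2 : a2 ^+ 2 + e * b2 * c2 \is a GRing.unit.
Proof. by have := nsq2 0; rewrite expr0n sub0r unitrN. Qed.

Let B3 := B1 + B2.
Let DB3 : B3 = lie (a1 + a2) (b1 + b2) (c1 + c2).
Proof. by rewrite /B3 DB1 DB2 lieD. Qed.
Let DA3 : A1 + A2 = (z1 + z2)%:M + B3.
Proof. by rewrite DA1 DA2 raddfD addrACA. Qed.

Lemma square_perturb (X Y W : 'M[T]_2) : X = Y + P *: W ->
  Y *m Y = X *m X - P *: (W *m X) - P *: (Y *m W).
Proof.
by move=> DX; rewrite {1}DX mulmxDl -scalemxAl addrK DX mulmxDr -scalemxAr addrK.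
Qed.

(** Modulo [P], comparing traces gives [B2 = v B1], hence [B3 = (1 + v) B1]. Regularity of [A1 + A2]
    makes [1 + v] a unit, and the discriminant of [B3] is [(1 + v)^2] times that of [B1]. *)
Lemma sum_disc_unit : cm P l1 B2 B1 ->
  (a1 + a2) ^+ 2 + e * (b1 + b2) * (c1 + c2) \is a GRing.unit.
Proof.
move=> /(cm_decomp md DB1 ud1)[u [E]]; set v := _ / _ => D2.
have u2 := two_unit md.
have trB1 : \tr B1 = 0 by rewrite DB1 lie_tr.
have trB2 : \tr B2 = 0 by rewrite DB2 lie_tr.
have du : dv P l1 u.
  apply: (dv_divl u2); rewrite mulr_natl -mxtrace_scalar.
  have -> : \tr (u%:M : 'M[T]_2) = - \tr (P ^+ l1 *: E).
    apply/eqP; rewrite -addr_eq0 -linearD /=.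
    have -> : u%:M + P ^+ l1 *: E = B2 - v *: B1 by rewrite {1}D2; mx_linear.
    by rewrite linearB linearZ /= trB1 trB2 mulr0 subr0.
  exact/dvN/dvm_tr/dvm_exp.
have [E' DE] : exists E', B3 = (1 + v) *: B1 + P *: E'.
  have [w Dw] : dvm P 1 (u%:M + P ^+ l1 *: E).
    rewrite -scalemx1; apply: dvmD; first exact/dvmZl/(dvW l1_gt0).
    exact/(dvmW l1_gt0)/dvm_exp.
  exists w; rewrite -[P in P *: w]expr1 -Dw /B3 {1}D2; mx_linear.
have uv : 1 + v \is a GRing.unit.
  case: (md_locT md (1 + v)) => // -[w Dw]; case/negP: reg.
  apply/existsP; exists (z1 + z2); apply/mxcongP; exists (w *: B1 + E').
  by rewrite DA3 DE Dw expr1; mx_linear.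
apply: (residue_unit md) => -[d Dd].
have : (iota ((a1 + a2) ^+ 2 + e * (b1 + b2) * (c1 + c2)))%:M = B3 *m B3.
  by rewrite DB3 (lie_sqr md).
rewrite Dd => sq.
apply: (unit_not_dv md (x := (1 + v) ^+ 2 * iota (a1 ^+ 2 + e * b1 * c1))).
  by rewrite unitrM unitrX // rmorph_unit.
apply: dvm_scalar.
have -> : ((1 + v) ^+ 2 * iota (a1 ^+ 2 + e * b1 * c1))%:M =
    B3 *m B3 - P *: (E' *m B3) - P *: ((1 + v) *: B1 *m E').
  rewrite -(square_perturb DE) -!scalemxAl -!scalemxAr scalerA.
  by rewrite DB1 (lie_sqr md) scale_scalar_mx expr2.
rewrite -sq -[P in P *: _]expr1.
apply: dvmB; last exact: dvm_exp.
apply: dvmB; last exact: dvm_exp.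
by rewrite rmorphM rmorphXn -scalemx1 -scalerA; apply: dvm_exp.
Qed.

(* Averages the inner product over right translations by [K]. *)
Lemma product_constituent (S K : {group {'GL_2[T]}}) (i1 i2 j : Iirr S) :
    K :=: kerset G P l2 -> K \subset S ->
    {in S & kerset G P l2, forall x k, 'chi_i1 (x * k)%g = 'chi_i1 x * psiA psi A1 k} ->
    {in S & kerset G P l2, forall x k, 'chi_i2 (x * k)%g = 'chi_i2 x * psiA psi A2 k} ->
    '['chi_j, 'chi_i1 * 'chi_i2] != 0 ->
  exists2 y, y \in S & \sum_(x in K) 'chi_j (y * x)%g * (psiA psi (A1 + A2) x)^* != 0.
Proof.
move=> DK sKS act1 act2 nz; apply/exists_inP; apply: contraR nz => /exists_inPn H.
have e1 k : k \in K -> \sum_(y in S) 'chi_j y * (('chi_i1 * 'chi_i2) y)^* =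
    \sum_(y in S) (('chi_i1 * 'chi_i2) y)^* *
       ('chi_j (y * k)%g * (psiA psi (A1 + A2) k)^*).
  move=> Kk; have Sk := subsetP sKS k Kk.
  rewrite (reindex_inj (mulIg k)) /=.
  rewrite (eq_bigl (fun y => y \in S)) => [|y]; last by rewrite groupMr.
  apply: eq_bigr => y Sy; rewrite !cfunE act1 -?DK // act2 -?DK //.
  have -> : psiA psi (A1 + A2) k = psiA psi A1 k * psiA psi A2 k.
    by rewrite /psiA -(md_psiD md) -linearD -mulmxDl.
  by rewrite !rmorphM /=; ring.
have : #|K|%:R * \sum_(y in S) 'chi_j y * (('chi_i1 * 'chi_i2) y)^* = 0.
  rewrite mulr_natl -sumr_const (eq_bigr _ e1) exchange_big big1 //= => y Sy.
  by rewrite -mulr_sumr; have /negPn/eqP-> := H y Sy; rewrite mulr0.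
move/eqP; rewrite mulf_eq0 pnatr_eq0 -[#|K| == 0%N]negbK -lt0n cardG_gt0 /=.
by move/eqP=> s0; rewrite cfdotE s0 mulr0.
Qed.

Lemma datum_mult_free : mult_free_claim G P l psi A1 A2.
Proof.
move=> S1 S2 K DS1 DS2 DK i1 i2 h1 h2 j.
(* The functional equation alone would also allow [psi] to vanish identically, which contradicts
   [h1]. *)
have psi0 : psi 0 = 1.
  have [x0 nx0] : exists x, psi x != 0.
    have [/existsP//|/existsPn H] := boolP [exists x, psi x != 0].
    case/negP: h1; rewrite big1 // => x _; rewrite /psiA.
    by have /negPn/eqP-> := H (\tr (A1 *m (GLval x - 1%:M))); rewrite conjC0 mulr0.
  by apply: (mulfI nx0); rewrite -(md_psiD md) addr0 mulr1.
rewrite (stab_cent md psi0 DB1 DA1 l12 le12 l1_gt0) in DS1.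
rewrite (stab_cent md psi0 DB2 DA2 l12 le12 l1_gt0) in DS2.
have sK1 : K \subset S1 by rewrite DK DS1; apply: kerset_sub.
have sK2 : K \subset S2 by rewrite DK DS2; apply: kerset_sub.
have act1 : {in S1 & kerset G P l2, forall x k, 'chi_i1 (x * k)%g = 'chi_i1 x * psiA psi A1 k}.
  apply: (irr_acts_psi md psi0 DB1 DA1 l12 le12 l1_gt0 (K := K) (y := 1%g)) => //.
  by under eq_bigr => x Kx do rewrite mul1g -(cfResE _ sK1 Kx).
have act2 : {in S2 & kerset G P l2, forall x k, 'chi_i2 (x * k)%g = 'chi_i2 x * psiA psi A2 k}.
  apply: (irr_acts_psi md psi0 DB2 DA2 l12 le12 l1_gt0 (K := K) (y := 1%g)) => //.
  by under eq_bigr => x Kx do rewrite mul1g -(cfResE _ sK2 Kx).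
have [odd_l|even_l] := boolP (odd l); last first.
  have eq12 : l1 = l2 by rewrite uphalf_half (negbTE even_l).
  apply: dot_lin_char_le1; rewrite rpredM // cfRes_lin_char //.
    exact: (cent_lin_irr md psi0 DB1 DA1 ud1 l12 le12 eq12 DS1 act1).
  exact: (cent_lin_irr md psi0 DB2 DA2 ud2 l12 le12 eq12 DS2 act2).
have l2E : l2 = l1.+1 by rewrite uphalf_half odd_l.
have irr1 := odd_irr_eq md psi0 DB1 DA1 ud1 l12 le12 l1_gt0 l2E.
have irr2 := odd_irr_eq md psi0 DB2 DA2 ud2 l12 le12 l1_gt0 l2E.
have n1 := index_N_le md DB1 ud1 l12 le12 l1_gt0 l2E.
have n2 := index_N_le md DB2 ud2 l12 le12 l1_gt0 l2E.
have deg_ge0 (H : {group {'GL_2[T]}}) (i : Iirr H) : 0 <= 'chi_i 1%g.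
  by rewrite char1_ge0 ?irr_char.
have [/mxcongP c12|nc12] := boolP (mxcong P l1 (B1 *m B2) (B2 *m B1)); last first.
  have nc : ~ cm P l1 B1 B2 by move/mxcongP; rewrite (negbTE nc12).
  have nc' : ~ cm P l1 B2 B1 by move/cm_sym.
  pose Q1 := ((cent l2 B1 :&: scal) :&: cent l1 B2)%G.
  pose Q2 := ((cent l2 B2 :&: scal) :&: cent l1 B1)%G.
  have [d1 v1 _ k1] := irr1 S1 _ _ i1 DS1 erefl erefl act1.
  have [d2 v2 _ k2] := irr2 S2 _ _ i2 DS2 erefl erefl act2.
  have sT1 : cent l2 B1 \subset cent l1 B1 by apply: cent_modS.
  have sT2 : cent l2 B2 \subset cent l1 B2 by apply: cent_modS.
  have sQ1 : Q1 \subset S1 :&: S2.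
    rewrite DS1 DS2; apply: setSI; apply: subset_trans sT1; exact: subsetIl.
  have sQ2 : Q2 \subset S1 :&: S2.
    rewrite DS1 DS2; apply/subsetP=> x /setIP[/setIP[Tx _] Sx].
    by apply/setIP; split=> //; apply: (subsetP sT2).
  have sB : (Q1 <*> Q2)%g \subset S1 :&: S2 by rewrite join_subG sQ1.
  have sBsc : (Q1 <*> Q2)%g \subset scal.
    by rewrite join_subG; apply/andP; split; apply/subsetP=> x /setIP[/setIP[_]].
  apply: (@multiplicity_heisenberg _ S1 S2 Q1 Q2 q) => //.
  - exact: residues_gt0.
  - have [_ nN1] := andP (N_normal md psi0 DB1 DA1 ud1 l12 le12 l1_gt0 l2E).
    apply: subset_trans sQ2 _; rewrite DS1 DS2; apply: normsI.
      exact: subset_trans (subsetIl _ _) nN1.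
    exact: subset_trans (subsetIr _ _) (normG _).
  - by move=> n g /setIP[Nn _]; apply: k1.
  - by move=> n g /setIP[Nn _]; apply: k2.
  - move=> x y /setIP[/setIP[/cent_modP[Gx cx] _] /cent_modP[_ cx1]].
    move=> /setIP[/setIP[/cent_modP[Gy cy] _] /cent_modP[_ cy1]].
    have [u [E Dx]] := cm_decomp md DB2 ud2 cx; have [u' [E' Dy]] := cm_decomp md DB2 ud2 cy.
    have [Kc pc] := commutator_ker_other md psi0 DA1 l12 le12 Gx Gy Dx Dy cx1 cy1.
    by rewrite cfkerEirr inE -{1}[[~ x, y]%g]mul1g act1 ?group1 // pc mulr1.
  - move=> x y /setIP[/setIP[/cent_modP[Gx cx] _] /cent_modP[_ cx1]].
    move=> /setIP[/setIP[/cent_modP[Gy cy] _] /cent_modP[_ cy1]].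
    have [u [E Dx]] := cm_decomp md DB1 ud1 cx; have [u' [E' Dy]] := cm_decomp md DB1 ud1 cy.
    have [Kc pc] := commutator_ker_other md psi0 DA2 l12 le12 Gx Gy Dx Dy cx1 cy1.
    by rewrite cfkerEirr inE -{1}[[~ x, y]%g]mul1g act2 ?group1 // pc mulr1.
  (* Elements of [Q1 <*> Q2] are scalar modulo [P] and lie in both stabilizers, so outside [Q1] they
     are in [M :\: N] for [B1]. *)
  - move=> x /setDP[Bx nQx]; have /setIP[S1x S2x] := subsetP sB x Bx.
    rewrite DS1 in S1x; rewrite DS2 in S2x; have scx := subsetP sBsc x Bx.
    apply: v1; rewrite inE andbC; apply/andP; split; first by apply/setIP.
    by apply: contra nQx => Nx; apply/setIP.
  - move=> x /setDP[Bx nQx]; have /setIP[S1x S2x] := subsetP sB x Bx.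
    rewrite DS1 in S1x; rewrite DS2 in S2x; have scx := subsetP sBsc x Bx.
    apply: v2; rewrite inE andbC; apply/andP; split; first by apply/setIP.
    by apply: contra nQx => Nx; apply/setIP.
  - exact: char_deg_le d1 n1.
  - exact: char_deg_le d2 n2.
  - exact: (index_Q_ge md l12 le12 l1_gt0 l2E DB1 nc).
  rewrite setIC; exact: (index_Q_ge md l12 le12 l1_gt0 l2E DB2 nc').
have c21 : cm P l1 B2 B1 by apply: cm_sym.
have ud3 := sum_disc_unit c21.
have c13 : cm P l1 B1 B3 by apply: cmD => //; apply: cm_refl.
have eqS2 : cent l1 B2 :=: cent l1 B1.
  apply/eqP; rewrite eqEsubset (cent_sub_of_cm md DB2 ud2 c21).
  by rewrite (cent_sub_of_cm md DB1 ud1 c12).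
have eqS3 : cent l1 B3 :=: cent l1 B1.
  apply/eqP; rewrite eqEsubset (cent_sub_of_cm md DB3 ud3 (cm_sym c13)).
  by rewrite (cent_sub_of_cm md DB1 ud1 c13).
have eqN2 : cent l2 B2 :&: scal = cent l2 B1 :&: scal.
  apply/eqP; rewrite eqEsubset (N_sub_of_cm md l2E DB2 ud2 c21).
  by rewrite (N_sub_of_cm md l2E DB1 ud1 c12).
have eqN3 : cent l2 B3 :&: scal = cent l2 B1 :&: scal.
  apply/eqP; rewrite eqEsubset (N_sub_of_cm md l2E DB3 ud3 (cm_sym c13)).
  by rewrite (N_sub_of_cm md l2E DB1 ud1 c13).
have irr3 := odd_irr_eq md psi0 DB3 DA3 ud3 l12 le12 l1_gt0 l2E.
have {sK2}eqS12 : S2 = S1 by apply/val_inj; rewrite /= DS1 DS2.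
subst S2.
(* [S1 :&: S1] equals [S1] as a set but indexes other types of characters; quantifying over all
   groups equal to [S1] permits the substitution. *)
have : forall H : {group {'GL_2[T]}}, H :=: S1 -> forall j : Iirr H,
    '['chi_j, 'Res[H] 'chi_i1 * 'Res[H] 'chi_i2] <= 1.
  move=> H /val_inj ->{H j} j; rewrite !cfRes_id.
  have [/eqP->|nzd] := boolP ('['chi_j, 'chi_i1 * 'chi_i2] == 0); first exact: ler01.
  have [y Sy nzy] := product_constituent DK sK1 act1 act2 nzd.
  have DS3 : S1 :=: cent l1 B3 by rewrite DS1 eqS3.
  have act3 := irr_acts_psi md psi0 DB3 DA3 l12 le12 l1_gt0 DS3 DK Sy nzy.
  pose M := (cent l1 B1 :&: scal)%G; pose N := (cent l2 B1 :&: scal)%G.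
  have [d1 v1 o1 _] := irr1 S1 M N i1 DS1 erefl erefl act1.
  have [d2 v2 o2 _] : [/\ 'chi_i2 1%g ^+ 2 = #|M : N|%g%:R,
      {in M :\: N, forall x, 'chi_i2 x = 0}, {in S1 :\: M, forall x, `|'chi_i2 x| = 1} &
      {in N & S1, forall n g, [~ n, g]%g \in cfker 'chi_i2}].
    by apply: irr2 act2 => //=; rewrite ?eqS2 ?eqN2.
  have [d3 v3 o3 _] : [/\ 'chi_j 1%g ^+ 2 = #|M : N|%g%:R,
      {in M :\: N, forall x, 'chi_j x = 0}, {in S1 :\: M, forall x, `|'chi_j x| = 1} &
      {in N & S1, forall n g, [~ n, g]%g \in cfker 'chi_j}].
    by apply: irr3 act3 => //=; rewrite ?eqS3 ?eqN3.
  have sq_inj (f g : algC) : 0 <= f -> 0 <= g -> f ^+ 2 = g ^+ 2 -> f = g.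
    by move=> f0 g0 /eqP; rewrite eqrXn2 // => /eqP.
  apply: (@multiplicity_torus _ S1 M N ('chi_i1 1%g)) => //.
  - by rewrite DS1 subsetIl.
  - by apply: setSI; apply: cent_modS.
  - rewrite deg_ge0 (le_trans (char_deg_le (deg_ge0 _ _) d1 n1)) // ler_nat DS1.
    exact: (index_M_ge md DB1 ud1 l12 l1_gt0 nsq1).
  move=> k; rewrite !inE => /or3P[]/eqP->; split=> //.
    by apply: sq_inj; rewrite ?deg_ge0 // d2.
  by apply: sq_inj; rewrite ?deg_ge0 // d3.
by move=> /(_ (S1 :&: S1)%G (setIid _) j).
Qed.

End MultiplicityFree.

(** * Quotients of complete discrete valuation rings *)

Section CompleteDVR.

Variables (O : idomainType) (pi : O).
Hypothesis dvr : is_complete_dvr_odd pi.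

Let pi_neq0 : pi != 0. Proof. by case: dvr. Qed.
Let pi_nunit : pi \notin GRing.unit. Proof. by case: dvr. Qed.
Let two_unitO : (2%:R : O) \is a GRing.unit. Proof. by case: dvr => _ _ _ _ []. Qed.

Lemma dvr_local (x : O) : x \is a GRing.unit \/ exists c, x = pi * c.
Proof.
case: dvr => _ _ fac _ _; have [->|/fac[n [u [uu ->]]]] := eqVneq x 0.
  by right; exists 0; rewrite mulr0.
case: n => [|n]; first by left; rewrite expr0 mulr1.
by right; exists (u * pi ^+ n); rewrite exprS mulrCA.
Qed.

Lemma dvr_not_unit (c : O) : pi * c \isn't a GRing.unit.
Proof. by rewrite unitrM (negbTE pi_nunit). Qed.

Lemma dvr_sep (x : O) : (forall k, exists c, x = pi ^+ k * c) -> x = 0.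
Proof.
case: dvr => _ _ fac _ _ H; apply/eqP/idPn => /fac[n [u [uu Dx]]].
have [c] := H n.+1; rewrite Dx exprSr mulrC -mulrA => /(mulfI (expf_neq0 n pi_neq0)) Du.
by have := dvr_not_unit c; rewrite -Du uu.
Qed.

(* Newton iteration for a square root of [d]. *)
Lemma dvr_hensel_sqrt (d t c : O) : d \is a GRing.unit -> t ^+ 2 - d = pi * c ->
  exists s, d = s * s.
Proof.
move=> ud Dt; pose step a := a - (a ^+ 2 - d) / (2%:R * a).
pose a n := iter n step t.
have unit_a x m w : x ^+ 2 - d = pi ^+ m.+1 * w -> x \is a GRing.unit.
  case: (dvr_local x) => // -[y ->] Dx; move: ud.
  have -> : d = pi * (y * (pi * y) - pi ^+ m * w).
    by rewrite -{1}[d](subKr ((pi * y) ^+ 2)) Dx (exprS pi); ring.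
  by rewrite (negbTE (dvr_not_unit _)).
have Ha n : exists w, a n ^+ 2 - d = pi ^+ n.+1 * w.
  elim: n => [|n [w Dw]]; first by exists c; rewrite expr1.
  have ua := unit_a _ _ _ Dw.
  exists (pi ^+ n * w ^+ 2 / (2%:R * a n) ^+ 2).
  have u2a : 2%:R * a n \is a GRing.unit by rewrite unitrM two_unitO.
  rewrite /= /step -/(a n); set r := _ / _.
  have Dr : r * (2%:R * a n) = a n ^+ 2 - d by rewrite divrK.
  have -> : (a n - r) ^+ 2 - d = r ^+ 2.
    transitivity (a n ^+ 2 - d - r * (2%:R * a n) + r ^+ 2); first by ring.
    by rewrite Dr subrr add0r.
  rewrite /r Dw exprMn exprVn mulrA; congr (_ / _).
  rewrite exprMn mulrA -exprD -exprM; congr (_ ^+ _ * _).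
  by rewrite addSn -addnS muln2 -addnn addSn addnS.
have Hstep n : exists w, a n.+1 - a n = pi ^+ n.+1 * w.
  have [w Dw] := Ha n; exists (- w / (2%:R * a n)).
  by rewrite /= /step -/(a n) Dw addrC addKr mulrA mulrN mulNr.
have Hk k n : exists w, a (k + n)%N - a k = pi ^+ k * w.
  elim: n => [|n [w Dw]]; first by exists 0; rewrite addn0 subrr mulr0.
  have [w' Dw'] := Hstep (k + n)%N.
  exists (pi ^+ n.+1 * w' + w); rewrite addnS -(subrK (a (k + n)%N) (a _)) -addrA Dw Dw'.
  by rewrite -addnS exprD mulrDr mulrA.
case: dvr => _ _ _ /(_ a)[k|L HL _].
  exists k => m n km kn.
  have [w Dw] := Hk k (m - k)%N; have [w' Dw'] := Hk k (n - k)%N.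
  rewrite subnKC // in Dw; rewrite subnKC // in Dw'.
  by exists (w - w'); rewrite mulrBr -Dw -Dw' opprB addrA subrK.
exists L; apply/eqP; rewrite -subr_eq0 -oppr_eq0 opprB -expr2; apply/eqP.
apply: dvr_sep => k; have [N HN] := HL k.
have [w Dw] := HN (maxn N k) (leq_maxl _ _); have [w' Dw'] := Ha (maxn N k).
exists (- w * (a (maxn N k) + L) + pi ^+ ((maxn N k).+1 - k) * w').
have Dk : pi ^+ (maxn N k).+1 = pi ^+ k * pi ^+ ((maxn N k).+1 - k).
  by rewrite -exprD subnKC // (leq_trans (leq_maxr N k)).
set A := a (maxn N k) in Dw Dw' *.
transitivity (- (A - L) * (A + L) + (A ^+ 2 - d)); first by ring.
by rewrite Dw Dw' Dk; ring.
Qed.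

Variables (l : nat) (R : finComUnitRingType) (red : {rmorphism O -> R}).
Hypotheses (l_gt0 : (0 < l)%N) (quo : is_quotient_mod_pow pi l red).

Local Notation p := (red pi).

Lemma quo_two : (2 : R) \is a GRing.unit.
Proof. by rewrite -(rmorph_nat red) rmorph_unit. Qed.

Lemma quo_nil : p ^+ l = 0.
Proof. by rewrite -rmorphXn; apply/(proj2 quo); exists 1; rewrite mulr1. Qed.

Lemma quo_local (x : R) : x \is a GRing.unit \/ dv p 1 x.
Proof.
have [y <-] := proj1 quo x; case: (dvr_local y) => [uy|[c ->]].
  by left; rewrite rmorph_unit.
by right; exists (red c); rewrite rmorphM.
Qed.

Lemma quo_ann k (x : R) : (k <= l)%N -> p ^+ k * x = 0 -> dv p (l - k) x.
Proof.
move=> kl; have [y <-] := proj1 quo x; rewrite -rmorphXn -rmorphM.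
case/(proj2 quo) => c; rewrite -(subnKC kl) exprD -mulrA.
move/(mulfI (expf_neq0 k pi_neq0)) => ->; exists (red c).
by rewrite subnKC // rmorphM rmorphXn.
Qed.

Lemma quo_div (x : R) : x != 0 -> exists c, p ^+ l.-1 = x * c.
Proof.
have [y <-] := proj1 quo x => nz.
have ny : y != 0 by apply: contraNneq nz => ->; rewrite rmorph0.
case: dvr => _ _ /(_ y ny)[n [u [uu Dy]]] _ _.
have nl : (n <= l.-1)%N.
  rewrite -ltnS prednK // ltnNge; apply: contraNN nz => ln.
  by rewrite Dy rmorphM rmorphXn -(subnKC ln) exprD quo_nil mul0r mulr0.
exists (red (u^-1 * pi ^+ (l.-1 - n))); rewrite -rmorphM Dy.
by rewrite mulrACA mulrV // mul1r -exprD subnKC // rmorphXn.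
Qed.

Lemma quo_unit_ndv (x : R) : x \is a GRing.unit -> ~ dv p 1 x.
Proof.
move=> ux [c Dx]; have : x ^+ l = 0 by rewrite Dx expr1 exprMn quo_nil mul0r.
by move=> x0; have := unitrX l ux; rewrite x0 unitr0.
Qed.

Lemma quo_ndv_unit (x : R) : ~ dv p 1 x -> x \is a GRing.unit.
Proof. by move=> nx; case: (quo_local x). Qed.

Lemma quo_congr_unit (x y : R) : x \is a GRing.unit -> dv p 1 (y - x) -> y \is a GRing.unit.
Proof.
move=> ux dyx; apply: quo_ndv_unit => dy; apply: (quo_unit_ndv ux).
by rewrite -(subKr y x); apply: dvB.
Qed.

(** The Newton correction [r] turns the error into [r * r], whose order is higher; the induction
    keeps one order per step. *)
Lemma quo_hensel k (s t : R) : s \is a GRing.unit -> dv p 1 (t * t - s) ->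
  exists t', dv p k (t' * t' - s).
Proof.
move=> us dt; suff [t' _ dt'] : exists2 t', t' \is a GRing.unit & dv p k.+1 (t' * t' - s).
  by exists t'; apply: dvW dt'.
elim: k => [|k [t' ut' [c Dc]]].
  exists t => //; have := quo_congr_unit us dt.
  by rewrite unitrM => /andP[].
have u2t : 2 * t' \is a GRing.unit by rewrite unitrM quo_two.
pose r := p ^+ k.+1 * c / (2 * t').
have Dr : r * (2 * t') = t' * t' - s by rewrite divrK.
have dr : dv p k.+1 r by exists (c / (2 * t')); rewrite mulrA.
exists (t' - r).
  apply: quo_congr_unit ut' _; rewrite addrC addKr; apply: dvN.
  exact: dvW dr.
have -> : (t' - r) * (t' - r) - s = r * r.
  transitivity (t' * t' - s - r * (2 * t') + r * r); first by ring.
  by rewrite Dr subrr add0r.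
by apply: dvW (dvM dr dr); rewrite addSn addnS !ltnS leq_addl.
Qed.

(** A non-unit value would be an approximate root in [O], which Newton iteration turns into a square
    root of [d]. *)
Lemma quo_nonsquare (d : O) (t : R) : d \is a GRing.unit ->
  ~ (exists s : O, d = s * s) -> t ^+ 2 - red d \is a GRing.unit.
Proof.
move=> ud nsq; apply: quo_ndv_unit => -[c]; have [t' <-] := proj1 quo t.
have [c' <-] := proj1 quo c; rewrite expr1 -rmorphXn -rmorphB -rmorphM => /eqP.
rewrite -subr_eq0 -rmorphB => /eqP/(proj2 quo)[w Dw].
apply: nsq; apply: (@dvr_hensel_sqrt d t' (c' + pi ^+ l.-1 * w)) => //.
by rewrite mulrDr mulrA -exprS prednK // -Dw; ring.
Qed.

(** [u - v] and [u + v] add up to the unit [2 u], so one of them is a unit and the other must be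
    zero. *)
Lemma quo_sqr_eq (u v : R) : u \is a GRing.unit -> u ^+ 2 = v ^+ 2 -> v = u \/ v = - u.
Proof.
move=> uu /eqP; rewrite -subr_eq0 subr_sqr => /eqP e0.
case: (quo_local (u - v)) => [uv|dvuv].
  right; apply/eqP; rewrite -addr_eq0 addrC; apply/eqP/(mulrI uv).
  by rewrite e0 mulr0.
left; have usum : u + v \is a GRing.unit.
  apply: (@quo_congr_unit (2 * u)); first by rewrite unitrM quo_two.
  have -> : u + v - 2 * u = - (u - v) by ring.
  exact: dvN.
by apply/eqP; rewrite -subr_eq0 -oppr_eq0 opprB; apply/eqP/(mulIr usum); rewrite e0 mul0r.
Qed.

(** Squaring is at most two-to-one on units, so the squares form at least half of them and the
    disjoint coset of [a] fills the rest. *)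
Lemma quo_nonsquare_coset (a c : R) : a \is a GRing.unit -> c \is a GRing.unit ->
    (forall t, a != t ^+ 2) ->
  exists w, c = w ^+ 2 \/ c = a * w ^+ 2.
Proof.
move=> ua uc nsq; pose U := [set u : R | u \is a GRing.unit].
pose Q := [set u ^+ 2 | u in U]; pose aQ := [set a * v | v in Q].
have sQU : Q :|: aQ \subset U.
  apply/subsetP=> _ /setUP[/imsetP[u Uu ->]|/imsetP[_ /imsetP[u Uu ->] ->]];
    by move: Uu; rewrite !inE ?unitrM ?unitrX ?ua // => ->.
have cQ : (#|U| <= #|Q| + #|Q|)%N.
  rewrite -sum1_card (partition_big (fun u => u ^+ 2) (mem Q)) => [|u Uu]; last exact: imset_f.
  rewrite addnn -muln2 -sum_nat_const; apply: leq_sum => v /imsetP[u Uu ->].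
  rewrite sum1dep_card; apply: (@leq_trans #|[set u; - u]|); last first.
    by rewrite cards2; case: (_ != _).
  apply/subset_leq_card/subsetP=> w; rewrite !inE => /andP[_ /eqP e].
  by rewrite inE in Uu; case: (quo_sqr_eq Uu (esym e)) => ->; rewrite eqxx ?orbT.
have dis : [disjoint Q & aQ].
  rewrite -setI_eq0; apply/eqP/setP=> x; rewrite in_set0 in_setI; apply/negP.
  case/andP=> /imsetP[u _ ->] /imsetP[_ /imsetP[w Uw ->] E]; rewrite inE in Uw.
  by have := nsq (u / w); rewrite exprMn exprVn E mulrK ?unitrX ?eqxx.
have caQ : #|aQ| = #|Q| by apply: card_imset; apply: mulrI.
have : c \in Q :|: aQ.
  have -> : Q :|: aQ = U; last by rewrite inE.
  apply/eqP; rewrite eqEcard sQU cardsU (disjoint_setI0 dis) cards0 subn0 caQ.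
  exact: cQ.
case/setUP=> /imsetP[u]; first by move=> _ ->; exists u; left.
by case/imsetP=> w _ -> ->; exists w; right.
Qed.

(* If every value [x ^+ 2 - d] were a square, then so would be [- d], [- 2 d],
   ..., and, the characteristic being positive, [d] itself. *)
Lemma quo_norm_surj (d c : R) : (forall t : R, t ^+ 2 - d \is a GRing.unit) ->
  c \is a GRing.unit -> exists x y, x ^+ 2 - d * y ^+ 2 = c.
Proof.
move=> nsq uc.
have [/existsP[x /forallP nx]|] := boolP [exists x : R, [forall t : R, x ^+ 2 - d != t ^+ 2]].
  have [w [->|->]] := quo_nonsquare_coset (nsq x) uc nx.
    by exists w, 0; rewrite expr0n mulr0 subr0.
  by exists (x * w), w; ring.
rewrite negb_exists => /forallP H.
have Hn n : exists y : R, y ^+ 2 = - (d *+ n).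
  elim: n => [|n [y Dy]]; first by exists 0; rewrite mulr0n oppr0 expr0n.
  have /forallPn[t /negPn/eqP Dt] := H y; exists t.
  by rewrite -Dt Dy mulrS opprD addrC.
have [y Dy] := Hn #|R|.-1; have := nsq y.
have R0 : (0 < #|R|)%N by apply/card_gt0P; exists 0.
have -> : y ^+ 2 - d = - (d *+ #|R|).
  by rewrite Dy -{2}(prednK R0) mulrS opprD addrC.
have -> : d *+ #|R| = 0.
  by have := expg_cardG (in_setT d); rewrite cardsT FinRing.zmodXgE.
by rewrite oppr0 unitr0.
Qed.

End CompleteDVR.

(** * Discriminants under conjugation modulo [P ^+ k] *)

Section DiscriminantModulo.

Variables (T : finComUnitRingType) (P : T).
Hypothesis u2 : (2 : T) \is a GRing.unit.

(** Conjugating [C] by [g] keeps its trace and square. Comparing traces matches the scalar parts, so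
    the traceless parts, and hence their squares, are congruent. *)
Lemma disc_congr k (A C g g' : 'M[T]_2) (x s d : T) :
    g *m g' = 1%:M -> g' *m g = 1%:M -> \tr C = 0 -> C *m C = s%:M ->
    dvm P k (g *m A - (x%:M + C) *m g) ->
    (A - (\tr A / 2)%:M) *m (A - (\tr A / 2)%:M) = d%:M ->
  dv P k (d - s).
Proof.
move=> gg' g'g trC C2 /(dvmMl g'); set z := _ / 2; set B := A - _ => dA B2.
have -> : d - s = (d%:M - s%:M : 'M[T]_2) 0 0 by rewrite !mxE.
pose C' := g' *m C *m g.
have {}dA : dvm P k (A - (x%:M + C')).
  have -> : A - (x%:M + C') = g' *m (g *m A - (x%:M + C) *m g).
    rewrite mulmxBr mulmxA g'g mul1mx mulmxDl mulmxDr !mulmxA scalar_mxC.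
    by rewrite -[x%:M *m _ *m _]mulmxA g'g mulmx1.
  by [].
have trC' : \tr C' = 0 by rewrite /C' mxtrace_mulC mulmxA gg' mul1mx.
have dz : dv P k (z - x).
  apply: (dv_divl u2); have := dvm_tr dA.
  rewrite linearB linearD /= trC' addr0 mxtrace_scalar.
  by rewrite mulrBr mulrC divrK // mulr_natl.
have dB : dvm P k (B - C').
  have -> : B - C' = (A - (x%:M + C')) - (z - x)%:M.
    by rewrite /B raddfB /=; mx_linear.
  by apply: dvmB => //; rewrite -scalemx1; apply: dvmZl.
have C'2 : C' *m C' = s%:M.
  rewrite /C' !mulmxA -[_ *m g *m g']mulmxA gg' mulmx1 -[_ *m C *m C]mulmxA C2.
  by rewrite scalar_mxC -mulmxA g'g mulmx1.
clearbody B C'; apply: dvm_entry; rewrite -B2 -C'2.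
have -> : B *m B - C' *m C' = (B - C') *m B + C' *m (B - C').
  by rewrite mulmxBl mulmxBr; mx_linear.
by apply: dvmD; [apply: dvmMr | apply: dvmMl].
Qed.

Lemma antidiag_sqr (a b : T) : mx2 0 a b 0 *m mx2 0 a b 0 = (a * b)%:M.
Proof. by rewrite !mx2E; congr mx2; ring. Qed.

End DiscriminantModulo.

(** * The general linear group *)

Lemma lie_det (R T : finComUnitRingType) (iota : {rmorphism R -> T}) eps e a b x y z :
    eps * eps = iota e ->
  \det ((iota a)%:M + iota b *: lie_mx iota eps x y z) =
    iota (a ^+ 2 - b ^+ 2 * (x ^+ 2 + e * y * z)).
Proof.
move=> De; rewrite /lie_mx !mx2E mx2_det !(rmorphB, rmorphD, rmorphM, rmorphXn) /= -De.
by ring.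
Qed.

Section GeneralLinear.

Variables (O : idomainType) (pi : O) (l : nat) (R : finComUnitRingType).
Variables (red : {rmorphism O -> R}) (psi : R -> algC).
Hypotheses (dvr : is_complete_dvr_odd pi) (l_gt1 : (1 < l)%N).
Hypothesis quo : is_quotient_mod_pow pi l red.
Hypothesis psiP : is_add_char_nontriv (red pi) l psi.

Let l_gt0 : (0 < l)%N. Proof. exact: ltnW. Qed.

Lemma GL_datum :
  matrix_datum (idfun : {rmorphism R -> R}) (red pi) 1 1 psi [set: {'GL_2[R]}]%G l.
Proof.
have d11 : (1 : R) * 1 = (idfun : {rmorphism R -> R}) 1 by rewrite mulr1.
split.
- exact: (quo_two dvr red).
- exact: unitr1.
- exact: mulr1.
- exact: (quo_local dvr quo).
- exact: (quo_local dvr quo).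
- exact: (quo_nil quo).
- exact: (quo_ann dvr quo).
- by [].
- exact: (quo_div dvr l_gt0 quo).
- by case: psiP.
- by case: psiP.
- move=> g a b c _; set X := lie_mx _ _ _ _ _; pose Y := mG g *m X *m mG g^-1%g.
  have trY : \tr Y = 0 by rewrite /Y mxtrace_mulC mulmxA mG_Vl mul1mx lie_tr.
  exists (Y 0 0), (Y 0 1), (Y 1 0); rewrite -/Y {1}(mx2_traceless trY).
  by rewrite /lie_mx !mul1r.
- move=> a b x y z E.
  have /mG_unit[g Dg] : \det ((idfun a)%:M + idfun b *: lie_mx idfun 1 x y z)
      \is a GRing.unit by rewrite (lie_det a b x y z d11) /= E unitr1.
  by exists g => //; rewrite inE.
- move=> a b x y z E.
  have /mG_unit[g Dg] : \det ((idfun a)%:M + idfun b *: lie_mx idfun 1 x y z)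
      \is a GRing.unit by rewrite (lie_det a b x y z d11).
  by exists 1, g; rewrite unitr1 inE scale1r.
Qed.

(** The discriminant is congruent to [s] modulo [p ^+ l./2]. A non-unit [t ^+ 2 - del] would make
    [s] a square modulo [p], hence modulo [p ^+ l./2] by [quo_hensel]. *)
Lemma cus_GL_disc (A : 'M[R]_2) : cus_GL (red pi) l./2 A -> exists z a b c,
  A = z%:M + lie_mx idfun 1 a b c /\
  forall t : R, t ^+ 2 - (a ^+ 2 + 1 * b * c) \is a GRing.unit.
Proof.
case=> g [x [s [/existsP[u /scongP du] [v /scongP dv1] nsq /mxcongP dA]]].
have k0 : (0 < l./2)%N by rewrite half_gt0.
have u2 := quo_two dvr red.
have us : s \is a GRing.unit.
  have := quo_congr_unit dvr quo (unitr1 R) (dvW k0 dv1).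
  by rewrite unitrM => /andP[].
have udg : \det g \is a GRing.unit.
  have := quo_congr_unit dvr quo (unitr1 R) (dvW k0 du).
  by rewrite unitrM => /andP[].
pose z := \tr A / 2; pose B := A - z%:M.
have trB : \tr B = 0.
  by rewrite linearB /= mxtrace_scalar -[_ *+ 2]mulr_natr divrK // subrr.
have DB : B = lie_mx idfun 1 (B 0 0) (B 0 1) (B 1 0).
  by rewrite {1}(mx2_traceless trB) /lie_mx !mul1r.
exists z, (B 0 0), (B 0 1), (B 1 0); rewrite -DB; split; first by rewrite addrC subrK.
set del := _ + _ * _ * _.
have B2 : B *m B = del%:M by rewrite {1 2}DB (lie_sqr GL_datum).
have ug : g \in unitmx by rewrite unitmxE.
have dds : dv (red pi) l./2 (del - s).
  apply: (disc_congr u2 (C := mx2 0 s 1 0) (x := x) (mulmxV ug) (mulVmx ug)) B2.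
  - by rewrite mx2_tr addr0.
  - by rewrite antidiag_sqr mulr1.
  have -> : x%:M + mx2 0 s 1 0 = mx2 x s 1 x by rewrite !mx2E !addr0 !add0r.
  exact: dA.
move=> t; apply: (quo_ndv_unit dvr quo) => dt; apply: nsq.
have d1 : dv (red pi) 1 (t * t - s).
  have -> : t * t - s = t ^+ 2 - del + (del - s) by rewrite -expr2; ring.
  by apply: dvD => //; apply: dvW dds.
have [t' dt'] := quo_hensel dvr quo l./2 us d1.
by exists t'; apply/scongP.
Qed.

End GeneralLinear.

(** * The unitary group *)

Section Unitary.

Variables (O : idomainType) (pi : O) (l : nat) (R : finComUnitRingType).
Variables (red : {rmorphism O -> R}) (S : finComUnitRingType).
Variables (iota : {rmorphism R -> S}) (th : S) (d : O) (conj : S -> S).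
Variables (psi' : R -> algC) (psi : S -> algC).
Hypotheses (dvr : is_complete_dvr_odd pi) (l_gt1 : (1 < l)%N).
Hypothesis quo : is_quotient_mod_pow pi l red.
Hypothesis ext : is_unram_quad_ext red iota th d conj.
Hypothesis psiP : is_add_char_nontriv (red pi) l psi'.
Hypothesis psiE : forall x y : R, psi (iota x + iota y * th) = psi' x * psi' y.

Local Notation p := (red pi).
Local Notation P := (iota p).
Local Notation e := (red d).
Local Notation lie := (lie_mx iota th).
Local Notation star := (star conj).

Let l_gt0 : (0 < l)%N. Proof. exact: ltnW. Qed.
Let u2 : (2 : R) \is a GRing.unit. Proof. exact: (quo_two dvr red). Qed.
Let th2 : th * th = iota e. Proof. by case: ext => _ _; rewrite expr2. Qed.
Let ue : e \is a GRing.unit. Proof. by case: ext => ud _ _ _ _; rewrite rmorph_unit. Qed.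
Let nsq (t : R) : t ^+ 2 - e \is a GRing.unit.
Proof. by case: ext => ud ns _ _ _; apply: (quo_nonsquare dvr l_gt0 quo). Qed.

Lemma quad_coord (s : S) : exists x y, s = iota x + iota y * th.
Proof. by case: ext => _ _ _ /(_ s)[[x y] /= [Ds _]] _; exists x, y. Qed.

Lemma quad_inj x y x' y' :
  iota x + iota y * th = iota x' + iota y' * th -> x = x' /\ y = y'.
Proof.
move=> E; case: ext => _ _ _ /(_ (iota x + iota y * th))[u [_ uniq]] _.
have := uniq (x, y) erefl; have := uniq (x', y') E.
by move=> -> [-> ->].
Qed.

Lemma conjE x y : conj (iota x + iota y * th) = iota x - iota y * th.
Proof. by case: ext. Qed.

Lemma conj_iota x : conj (iota x) = iota x.
Proof. by have := conjE x 0; rewrite rmorph0 mul0r addr0 subr0. Qed.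

Lemma conj_ith y : conj (th * iota y) = - (th * iota y).
Proof. by have := conjE 0 y; rewrite rmorph0 add0r sub0r mulrC. Qed.

Lemma conjD : {morph conj : s t / s + t}.
Proof.
move=> s t; have [x [y ->]] := quad_coord s; have [x' [y' ->]] := quad_coord t.
have -> : iota x + iota y * th + (iota x' + iota y' * th) =
  iota (x + x') + iota (y + y') * th by rewrite !rmorphD; ring.
by rewrite !conjE !rmorphD; ring.
Qed.

Lemma conjM : {morph conj : s t / s * t}.
Proof.
move=> s t; have [x [y ->]] := quad_coord s; have [x' [y' ->]] := quad_coord t.
have -> : (iota x + iota y * th) * (iota x' + iota y' * th) =
    iota (x * x' + y * y' * e) + iota (x * y' + y * x') * th.
  by rewrite !rmorphD !rmorphM -th2; ring.
by rewrite !conjE !rmorphD !rmorphM -th2; ring.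
Qed.

Lemma conjN s : conj (- s) = - conj s.
Proof. by rewrite -mulN1r -(rmorphN1 iota) conjM conj_iota rmorphN1 mulN1r. Qed.

Lemma quad_norm x y :
  (iota x + iota y * th) * (iota x - iota y * th) = iota (x ^+ 2 - e * y ^+ 2).
Proof. by rewrite !(rmorphB, rmorphM, rmorphXn) /= -th2; ring. Qed.

Lemma quad_norm_surj c : c \is a GRing.unit -> exists s, conj s * s = iota c.
Proof.
move=> uc; have [x [y Dc]] := quo_norm_surj dvr quo nsq uc.
by exists (iota x + iota y * th); rewrite conjE mulrC quad_norm Dc.
Qed.

(** As [e] is a non-square modulo [p], the norm form [x^2 - e y^2] is anisotropic there: it lies in
    the maximal ideal only if [x] and [y] do. *)
Lemma quad_local (s : S) : s \is a GRing.unit \/ dv P 1 s.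
Proof.
have [x [y ->]] := quad_coord s.
case: (quo_local dvr quo (x ^+ 2 - e * y ^+ 2)) => [un|dn].
  left; have : iota (x ^+ 2 - e * y ^+ 2) \is a GRing.unit by rewrite rmorph_unit.
  by rewrite -quad_norm unitrM => /andP[].
right; have dy : dv p 1 y.
  case: (quo_local dvr quo y) => // uy; case: (quo_unit_ndv quo (nsq (x / y))).
  apply: (dv_divl (u := y ^+ 2)); first exact: unitrX.
  have -> : y ^+ 2 * ((x / y) ^+ 2 - e) = x ^+ 2 - e * y ^+ 2; last by [].
  by rewrite mulrBr exprMn exprVn mulrC divrK ?unitrX // [e * _]mulrC.
have dx : dv p 1 x.
  case: (quo_local dvr quo x) => // ux; case: (quo_unit_ndv quo (unitrX 2 ux)).
  rewrite -(subrK (e * y ^+ 2) (x ^+ 2)); apply: dvD => //.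
  by rewrite expr2; do 2!apply: dvMl.
case: dx dy => [x' ->] [y' ->]; exists (iota x' + iota y' * th).
by rewrite !expr1 !rmorphM; ring.
Qed.

Lemma quad_refl k (r : R) : dv P k (iota r) -> dv p k r.
Proof.
case=> c; have [x [y ->]] := quad_coord c => E; exists x.
have [] : r = p ^+ k * x /\ 0 = p ^+ k * y; last by [].
by apply: quad_inj; rewrite rmorph0 mul0r addr0 E !rmorphM !rmorphXn; ring.
Qed.

Lemma quad_ann k (s : S) : (k <= l)%N -> P ^+ k * s = 0 -> dv P (l - k) s.
Proof.
move=> kl; have [x [y ->]] := quad_coord s => E.
have [] : p ^+ k * x = 0 /\ p ^+ k * y = 0.
  by apply: quad_inj; rewrite !rmorph0 mul0r addr0 -E !rmorphM !rmorphXn; ring.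
move=> /(quo_ann dvr quo kl)[x' ->] /(quo_ann dvr quo kl)[y' ->].
by exists (iota x' + iota y' * th); rewrite !rmorphM !rmorphXn; ring.
Qed.

Lemma psi'0 x : psi' x * psi' 0 = psi' x.
Proof. by case: psiP => psiD _; rewrite -psiD addr0. Qed.

Lemma quad_psiD s t : psi (s + t) = psi s * psi t.
Proof.
case: psiP => psiD _; have [x [y ->]] := quad_coord s; have [x' [y' ->]] := quad_coord t.
have -> : iota x + iota y * th + (iota x' + iota y' * th) =
  iota (x + x') + iota (y + y') * th by rewrite !rmorphD; ring.
by rewrite !psiE !psiD; ring.
Qed.

Lemma quad_psi_iota x : psi (iota x) = psi' x.
Proof. by rewrite -[iota x]addr0 -(mul0r th) -(rmorph0 iota) psiE psi'0. Qed.

Lemma star_mx2 a b c f : star (mx2 a b c f) = mx2 (conj f) (conj b) (conj c) (conj a).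
Proof.
rewrite /star /Wmx; have -> : (map_mx conj (mx2 a b c f))^T =
    mx2 (conj a) (conj c) (conj b) (conj f) by rewrite [LHS]mx2_eta !mxE.
by rewrite !mx2_mul; congr mx2; ring.
Qed.

Lemma starM X Y : star (X *m Y) = star Y *m star X.
Proof.
rewrite [X]mx2_eta [Y]mx2_eta !mx2_mul !star_mx2 !mx2_mul !conjD !conjM.
by congr mx2; ring.
Qed.

Lemma conj0 : conj 0 = 0.
Proof. by rewrite -(rmorph0 iota) conj_iota. Qed.

(** On such matrices [star] is the adjugate, so [star X *m X] is the determinant and being unitary
    becomes a norm equation. *)
Lemma star_lie a b x y z :
  star ((iota a)%:M + iota b *: lie x y z) = (iota a)%:M - iota b *: lie x y z.
Proof.
rewrite /lie_mx !mx2E !star_mx2.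
by congr mx2; rewrite ?(conj_ith, conj_iota, conj0, conjD, conjN, conjM); ring.
Qed.

Lemma lie_norm a b x y z :
  ((iota a)%:M - iota b *: lie x y z) *m ((iota a)%:M + iota b *: lie x y z) =
  (iota (a ^+ 2 - b ^+ 2 * (x ^+ 2 + e * y * z)))%:M.
Proof.
rewrite /lie_mx !mx2E !(rmorphB, rmorphD, rmorphM, rmorphXn) /= -th2.
by congr mx2; ring.
Qed.

Lemma star_scale s X : star (s *: X) = conj s *: star X.
Proof. by rewrite [X]mx2_eta !(mx2_scale, star_mx2) !conjM. Qed.

Lemma star1 : star 1%:M = 1%:M.
Proof.
rewrite mx2_scalar star_mx2 -(rmorph1 iota) -(rmorph0 iota) !conj_iota.
by rewrite rmorph1 rmorph0.
Qed.

Fact GU_group_set : group_set (GU_set conj).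
Proof.
apply/group_setP; split=> [|g h].
  by rewrite inE -[GLval 1]/(1%:M : 'M[S]_2) star1 mulmx1.
rewrite !inE => /eqP Hg /eqP Hh; rewrite -[GLval (g * h)]/(mG g *m mG h) starM.
by rewrite mulmxA -[_ *m star _ *m _]mulmxA Hg mulmx1 Hh.
Qed.
Definition GU_group := Group GU_group_set.

Lemma star_GU g : g \in GU_group -> star (mG g) = mG g^-1%g.
Proof.
rewrite inE => /eqP Hg.
by rewrite -[LHS]mulmx1 -(mG_V g) mulmxA Hg mul1mx.
Qed.

(** [star] conjugates all entries and swaps the diagonal ones; for traceless [X] the diagonal is
    therefore fixed by [conj], while the other entries are negated by it. *)
Lemma antihermitian_lie X : \tr X = 0 -> star X = - X -> exists a b c, X = lie a b c.
Proof.
move=> /mx2_traceless->; rewrite star_mx2 mx2_opp => /mx2_inj[_ Eb Ec].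
rewrite opprK => Ea.
have half (y : R) : y = - y -> y = 0.
  by move=> Ey; apply: (mulrI u2); rewrite mulr0 mulr_natl mulr2n {1}Ey addNr.
have real s : conj s = s -> exists r, s = iota r.
  have [x [y ->]] := quad_coord s; rewrite conjE => E; exists x.
  have [_ Ey] : x = x /\ - y = y by apply: quad_inj; rewrite rmorphN mulNr.
  by rewrite (half y) ?rmorph0 ?mul0r ?addr0.
have imag s : conj s = - s -> exists r, s = th * iota r.
  have [x [y ->]] := quad_coord s; rewrite conjE => E; exists y.
  have [Ex _] : x = - x /\ - y = - y.
    by apply: quad_inj; rewrite !rmorphN mulNr E; ring.
  by rewrite (half x) // rmorph0 add0r mulrC.
have [a Da] := real _ Ea; have [b Db] := imag _ Eb; have [c Dc] := imag _ Ec.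
by exists a, b, c; rewrite /lie_mx -Da -Db -Dc.
Qed.

Lemma GU_datum : matrix_datum iota p th e psi GU_group l.
Proof.
split.
- exact: u2.
- exact: ue.
- exact: th2.
- exact: (quo_local dvr quo).
- exact: quad_local.
- exact: (quo_nil quo).
- exact: quad_ann.
- exact: quad_refl.
- exact: (quo_div dvr l_gt0 quo).
- exact: quad_psiD.
- by case: psiP => _ [x nx]; exists x; rewrite quad_psi_iota.
- move=> g a b c Gg; apply: antihermitian_lie.
    by rewrite mxtrace_mulC mulmxA mG_Vl mul1mx lie_tr.
  have GV : g^-1%g \in GU_group by rewrite groupV.
  have sl : star (lie a b c) = - lie a b c.
    by have := star_lie 0 1 a b c; rewrite rmorph0 rmorph1 scale1r raddf0 add0r sub0r.
  by rewrite !starM star_GU // star_GU // invgK sl mulNmx mulmxN mulmxA.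
- move=> a b x y z E; set X := _ + _.
  have /mG_unit[g Dg] : \det X \is a GRing.unit.
    by rewrite (lie_det _ _ _ _ _ th2) E rmorph1 unitr1.
  by exists g => //; rewrite inE -[GLval g]/(mG g) Dg star_lie lie_norm E rmorph1.
move=> a b x y z uN; set N := _ - _ in uN.
(* Scaling by [s] multiplies [star X *m X] by the norm of [s], and every unit of [R] is such a
   norm. *)
have [s Ds] : exists s, conj s * s = iota N^-1 by apply: quad_norm_surj; rewrite unitrV.
have us : s \is a GRing.unit.
  have : conj s * s \is a GRing.unit by rewrite Ds rmorph_unit // unitrV.
  by rewrite unitrM => /andP[].
pose X := (iota a)%:M + iota b *: lie x y z.
have /mG_unit[g Dg] : \det (s *: X) \is a GRing.unit.
  by rewrite detZ unitrM unitrX // (lie_det _ _ _ _ _ th2) rmorph_unit.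
exists s, g; split=> //; rewrite inE -[GLval g]/(mG g) Dg star_scale star_lie.
rewrite -scalemxAl -scalemxAr scalerA lie_norm -/N scale_scalar_mx Ds -rmorphM.
by rewrite mulVr // rmorph1.
Qed.

Lemma mx2_congr1_unit (X : 'M[S]_2) : dvm P 1 (X - 1%:M) -> \det X \is a GRing.unit.
Proof.
move=> dX; case: (quad_local (\det X)) => // dd.
have d1 : dv P 1 (\det X - 1).
  have E i j := dvm_entry i j dX; move: (E 0 0) (E 0 1) (E 1 0) (E 1 1).
  rewrite [X in \det X]mx2_eta mx2_det !mxE /= ?subr0 => h00 h01 h10 h11.
  have -> : X 0 0 * X 1 1 - X 0 1 * X 1 0 - 1 =
     (X 0 0 - 1) * X 1 1 + (X 1 1 - 1) - X 0 1 * X 1 0 by ring.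
  by apply: dvB; [apply: dvD => //; apply: dvMr | apply: dvMr].
case: (unit_not_dv GU_datum (unitr1 S)).
by rewrite -(subKr (\det X) 1); apply: dvB.
Qed.

(** Because [th * th = iota e], the discriminant is congruent to [e * s] with [s] a square unit, so
    it is a non-square since [e] is one. Hence the condition on sigma is opposite to the linear
    case. *)
Lemma cus_GU_disc (A : 'M[S]_2) : in_gu_mod conj P l A -> cus_GU conj iota p P th l./2 A ->
  exists z a b c, A = z%:M + lie a b c /\
    forall t : R, t ^+ 2 - (a ^+ 2 + e * b * c) \is a GRing.unit.
Proof.
move=> /mxcongP guA [g [x [s [/mxcongP gg _ [v /scongP dv1] [tau /scongP dtau] /mxcongP dA]]]].
have k0 : (0 < l./2)%N by rewrite half_gt0.
have u2S := two_unit GU_datum.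
have starA : star A = - A.
  by apply/eqP; rewrite -addr_eq0 addrC -[_ + _]subr0; apply/eqP/(dvm_l GU_datum).
have us : s \is a GRing.unit.
  have := quo_congr_unit dvr quo (unitr1 R) (dvW k0 dv1).
  by rewrite unitrM => /andP[].
have udg : \det g \is a GRing.unit.
  have := mx2_congr1_unit (dvmW k0 gg).
  by rewrite det_mulmx unitrM => /andP[].
pose z := \tr A / 2; pose B := A - z%:M.
have trB : \tr B = 0.
  by rewrite linearB /= mxtrace_scalar -[_ *+ 2]mulr_natr divrK // subrr.
have starB : star B = - B.
  have conj_tr : conj (\tr A) = - \tr A.
    by rewrite -linearN -starA /= {1 2}[A]mx2_eta star_mx2 !mx2_tr conjD addrC.
  have conj2 : conj 2^-1 = 2^-1.
    by rewrite -(rmorph_nat iota) -rmorphV // conj_iota.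
  have conjz : conj z = - z by rewrite /z conjM conj_tr conj2 mulNr.
  rewrite /B -[A - z%:M]addrC; move: starA; rewrite [A]mx2_eta !mx2E !star_mx2 !conjD !conjN.
  rewrite conjz conj0 => /mx2_inj[-> -> -> ->].
  by congr mx2; ring.
have [a [b [c DB]]] := antihermitian_lie trB starB.
exists z, a, b, c; rewrite -DB; split; first by rewrite addrC subrK.
have B2 : B *m B = (iota (a ^+ 2 + e * b * c))%:M by rewrite DB (lie_sqr GU_datum).
have ug : g \in unitmx by rewrite unitmxE.
set del := _ + _ * _ * _ in B2 *.
have dds : dv p l./2 (del - e * s).
  apply: quad_refl; rewrite rmorphB rmorphM -th2.
  apply: (disc_congr u2S (C := mx2 0 (th * iota s) th 0) (x := x) (mulmxV ug) (mulVmx ug)) B2.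
  - by rewrite mx2_tr addr0.
  - by rewrite antidiag_sqr mulrAC.
  have -> : x%:M + mx2 0 (th * iota s) th 0 = mx2 x (th * iota s) th x.
    by rewrite !mx2E !addr0 !add0r.
  exact: dA.
move=> t; apply: (quo_ndv_unit dvr quo) => dt.
have utau : tau \is a GRing.unit.
  have := quo_congr_unit dvr quo us (dvW k0 dtau).
  by rewrite unitrM => /andP[].
apply: (quo_unit_ndv quo (nsq (t / tau))).
apply: (dv_divl (u := tau ^+ 2)); first exact: unitrX.
have -> : tau ^+ 2 * ((t / tau) ^+ 2 - e) = t ^+ 2 - e * tau ^+ 2.
  by rewrite mulrBr exprMn exprVn mulrC divrK ?unitrX // [e * _]mulrC.
have -> : t ^+ 2 - e * tau ^+ 2 = t ^+ 2 - del + (del - e * s) - e * (tau * tau - s) by ring.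
apply: dvB; first by apply: dvD => //; apply: dvW dds.
by apply: dvMl; apply: dvW dtau.
Qed.

End Unitary.

Theorem theorem5p1 :
  (* Case G = GL_2 *)
  (forall (O : idomainType) (pi : O) (l : nat)
          (R : finComUnitRingType) (red : {rmorphism O -> R})
          (psi : R -> algC) (A1 A2 : 'M[R]_2),
     is_complete_dvr_odd pi -> (2 <= l)%N -> is_quotient_mod_pow pi l red ->
     is_add_char_nontriv (red pi) l psi ->
     regular (red pi) A1 -> regular (red pi) A2 -> regular (red pi) (A1 + A2) ->
     cus_GL (red pi) l./2 A1 -> cus_GL (red pi) l./2 A2 ->
     mult_free_claim (GL_set R) (red pi) l psi A1 A2)
  /\
  (* Case G = GU_2 *)
  (forall (O : idomainType) (pi : O) (l : nat)
          (R : finComUnitRingType) (red : {rmorphism O -> R})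
          (S : finComUnitRingType) (iota : {rmorphism R -> S})
          (th : S) (d : O) (conj : S -> S)
          (psi' : R -> algC) (psi : S -> algC) (A1 A2 : 'M[S]_2),
     is_complete_dvr_odd pi -> (2 <= l)%N -> is_quotient_mod_pow pi l red ->
     is_unram_quad_ext red iota th d conj ->
     is_add_char_nontriv (red pi) l psi' ->
     (forall x y : R, psi (iota x + iota y * th) = psi' x * psi' y) ->
     in_gu_mod conj (iota (red pi)) l A1 -> in_gu_mod conj (iota (red pi)) l A2 ->
     regular (iota (red pi)) A1 -> regular (iota (red pi)) A2 ->
     regular (iota (red pi)) (A1 + A2) ->
     cus_GU conj iota (red pi) (iota (red pi)) th l./2 A1 ->
     cus_GU conj iota (red pi) (iota (red pi)) th l./2 A2 ->
     mult_free_claim (GU_set conj) (iota (red pi)) l psi A1 A2).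
Proof.
split.
  move=> O pi l R red psi A1 A2 dvr l_gt1 quo psiP _ _ reg.
  move=> /(cus_GL_disc dvr l_gt1 quo psiP)[z1 [a1 [b1 [c1 [DA1 nsq1]]]]].
  move=> /(cus_GL_disc dvr l_gt1 quo psiP)[z2 [a2 [b2 [c2 [DA2 nsq2]]]]].
  have md := GL_datum dvr l_gt1 quo psiP.
  exact: (datum_mult_free md l_gt1 erefl DA1 erefl DA2 nsq1 nsq2 reg).
move=> O pi l R red S iota th d conj psi' psi A1 A2 dvr l_gt1 quo ext psiP psiE.
move=> gu1 gu2 _ _ reg.
move=> /(cus_GU_disc dvr l_gt1 quo ext psiP psiE gu1)[z1 [a1 [b1 [c1 [DA1 nsq1]]]]].
move=> /(cus_GU_disc dvr l_gt1 quo ext psiP psiE gu2)[z2 [a2 [b2 [c2 [DA2 nsq2]]]]].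
have md := GU_datum dvr l_gt1 quo ext psiP psiE.
exact: (datum_mult_free md l_gt1 erefl DA1 erefl DA2 nsq1 nsq2 reg).
Qed.
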